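(* For $h>0$ and $g\in H$ let $u_{hg}\in K_h$ be the unique solution of $$a(u_{hg},v_h-u_{hg})\ \ge\ (g,v_h-u_{hg})_H-\int_{\Gamma_2}q\,(v_h-u_{hg})\,d\gamma\qquad\forall\,v_h\in K_h ,$$ and define $J_h:H\to\mathbb{R}^+_0$ by $J_h(g)=\frac12\|u_{hg}\|_H^2+\frac M2\|g\|_H^2$. Then: (a) $\displaystyle\lim_{\|g\|_H\to\infty}J_h(g)=\infty$. (b) There is a constant $C$ independent of $h$ such that $J_h(g)\ge\frac M2\|g\|_H^2-C\|g\|_H$ for $g\in H$. (c) The functional $J_h$ is weakly lower semi-continuous on $H$. (d) For every $h>0$ there exists a solution of the discrete optimal control problem: there exists $g_{op_h}\in H$ such that $J_h(g_{op_h})=\min_{g\in H}J_h(g)$.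
   Context: $\Omega\subset\mathbb{R}^n$ is a bounded polygonal domain whose boundary $\partial\Omega=\Gamma_1\cup\Gamma_2$ is the union of two disjoint portions $\Gamma_1,\Gamma_2$ with $\mathrm{meas}(\Gamma_1)>0$. Set $V=H^1(\Omega)$, $H=L^2(\Omega)$ with inner product $(u,v)_H=\int_\Omega uv\,dx$, $Q=L^2(\Gamma_2)$, and $a(u,v)=\int_\Omega\nabla u\cdot\nabla v\,dx$ for $u,v\in V$. Boundary values are taken in the sense of traces. The data are constants $b>0$, $M>0$ and $q\in Q$. With $V_0=\{v\in V: v|_{\Gamma_1}=0\}$, the form $a$ is bilinear, continuous and symmetric on $V$ and coercive on $V_0$: there is $\lambda>0$ with $a(v,v)\ge\lambda\|v\|_V^2$ for all $v\in V_0$. Finite elements: $\{\tau_h\}$ is a regular family of triangulations of $\Omega$ with Lagrange triangles of type 1 (affine-equivalent finite elements of class $C^0$), where the parameter $h>0$ is the longest side of the triangles $T\in\tau_h$. $\mathbb{P}_1(T)$ is the set of polynomials of degree at most $1$ on $T$, and $$K_h=\{v_h\in C^0(\overline{\Omega}): v_h\ge 0,\ v_h|_{\Gamma_1}=b,\ v_h|_T\in\mathbb{P}_1(T)\ \forall\,T\in\tau_h\}.$$ *)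

(* Defs.v *)
From HB Require Import structures.
From mathcomp Require Import all_boot all_order all_algebra.
From mathcomp Require Import all_classical all_reals all_analysis.

Set Implicit Arguments.
Unset Strict Implicit.
Unset Printing Implicit Defensive.
Import Order.TTheory GRing.Theory Num.Theory.
Import numFieldNormedType.Exports.

Local Open Scope classical_set_scope.
Local Open Scope ring_scope.

(* The value [None] lets a cover be finite or empty, so that the empty set has
   measure zero whatever [w] is. *)
Section cover_measure.
Context {R : realType} {T I : Type}.
Variables (C : set I) (S : I -> set T) (w : I -> \bar R).
Hypothesis w_ge0 : forall i, (0 <= w i)%E.
Local Open Scope ereal_scope.

Definition piece (o : option I) : set T := if o is Some i then S i else set0.
Definition weight (o : option I) : \bar R := if o is Some i then w i else 0.

Definition countable_cover (A : set T) : set (nat -> option I) :=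
  [set F | (forall k i, F k = Some i -> C i) /\ A `<=` \bigcup_k piece (F k)].

Definition cover_measure (A : set T) : \bar R :=
  ereal_inf [set \sum_(k <oo) weight (F k) | F in countable_cover A].

Lemma weight_ge0 o : 0 <= weight o.
Proof. by case: o => /=. Qed.

Lemma cover_measure_ge0 A : 0 <= cover_measure A.
Proof.
apply: le_ereal_inf_tmp => x [F _ <-{x}].
by apply: nneseries_ge0 => *; exact: weight_ge0.
Qed.

Lemma cover_measure0 : cover_measure set0 = 0.
Proof.
apply/eqP; rewrite eq_le cover_measure_ge0 andbT.
apply: ereal_inf_lbound; exists (fun=> None); first by split.
by apply: eseries0.
Qed.

Lemma le_cover_measure : {homo cover_measure : A B / A `<=` B >-> A <= B}.
Proof.
move=> A B AB; apply/ereal_inf_le_tmp => x [F [CF BF] <-{x}].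
by exists F => //; split => //; exact: subset_trans BF.
Qed.

Lemma cover_measure_sigma_subadditive : sigma_subadditive cover_measure.
Proof.
move=> A; have [[i ioo]|] := pselect (exists i, cover_measure (A i) = +oo).
  rewrite (eseries_pinfty _ _ ioo) ?leey// => n _.
  by rewrite -ltNye (lt_le_trans _ (cover_measure_ge0 _)).
rewrite -forallNE => Aoo.
suff add2e (e : {posnum R}) :
    cover_measure (\bigcup_n A n) <=
    \sum_(i <oo) cover_measure (A i) + e%:num%:E.
  by apply/lee_addgt0Pr => _/posnumP[].
rewrite (le_trans _ (epsilon_trick _ _ _))//; last first.
  by move=> n; exact: cover_measure_ge0.
pose P n (F : nat -> option I) := countable_cover (A n) F /\
  \sum_(k <oo) weight (F k) <=
  cover_measure (A n) + (e%:num / (2 ^ n.+1)%:R)%:E.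
have [G PG] : {G : nat -> nat -> option I & forall n, P n (G n)}.
  apply: (@choice _ _ P) => n; rewrite /P.
  have fn : cover_measure (A n) \is a fin_num.
    by rewrite ge0_fin_numE ?cover_measure_ge0// ltey; exact/eqP/Aoo.
  have en1 : (0 < e%:num / (2 ^ n.+1)%:R)%R by [].
  have [_ [F AF <-] lF] := lb_ereal_inf_adherent en1 fn.
  by exists F; split => //; exact: ltW.
have /card_esym/ppcard_eqP[f] := card_nat2.
pose H k := G (f k).1 (f k).2.
apply: (@le_trans _ _ (\sum_(k <oo) weight (H k))).
  apply: ereal_inf_lbound; exists H => //; split.
    by move=> k i; exact: (PG _).1.1.
  move=> t [i _ /(PG i).1.2[j _ Gt]].
  by exists (f^-1%FUN (i, j)) => //; rewrite /H invK ?inE.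
rewrite nneseries_esumT; last by move=> *; exact: weight_ge0.
have -> : \esum_(k in setT) weight (H k) =
    \esum_(p in [set: nat * nat]) weight (G p.1 p.2).
  rewrite (@reindex_esum _ _ _ setT setT f)//.
rewrite (_ : [set: nat * nat] = setT `*`` (fun=> setT)); last first.
  by apply/seteqP; split.
rewrite -(@esum_esum _ _ _ setT (fun=> setT) (fun i j => weight (G i j)));
  last by move=> *; exact: weight_ge0.
rewrite nneseries_esumT; last first.
  by move=> *; rewrite adde_ge0 ?cover_measure_ge0// lee_fin.
apply: le_esum => n _; rewrite -nneseries_esumT; first exact: (PG n).2.
by move=> *; exact: weight_ge0.
Qed.

End cover_measure.

Section lebesgue.
Variables (R : realType) (n : nat).
Local Notation Rn := 'rV[R]_n.
Local Open Scope ereal_scope.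

Definition box (ab : Rn * Rn) : set Rn :=
  [set x | forall i, (ab.1 ord0 i <= x ord0 i <= ab.2 ord0 i)%R].

Definition box_volume (ab : Rn * Rn) : \bar R :=
  (\prod_(i < n) Num.max 0 (ab.2 ord0 i - ab.1 ord0 i))%R%:E.

Definition lebesgue_outer (A : set Rn) : \bar R :=
  cover_measure setT box box_volume A.

Lemma box_volume_ge0 ab : 0 <= box_volume ab.
Proof. by rewrite lee_fin prodr_ge0// => i _; rewrite le_max lexx. Qed.

HB.instance Definition _ := isOuterMeasure.Build R Rn lebesgue_outer
  (cover_measure0 _ _ box_volume_ge0)
  (cover_measure_ge0 _ _ box_volume_ge0)
  (@le_cover_measure R Rn _ setT box box_volume)
  (cover_measure_sigma_subadditive _ _ box_volume_ge0).

End lebesgue.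

(* The measure carried by the sigma-algebra of Lebesgue measurable sets. *)
Definition lebesgue (R : realType) (n : nat) :
  set (caratheodory_type (@lebesgue_outer R n)) -> \bar R := (@lebesgue_outer R n).

HB.instance Definition _ (R : realType) (n : nat) :=
  isMeasure.Build _ (caratheodory_type (@lebesgue_outer R n)) R (@lebesgue R n)
    (@caratheodory_measure0 _ _ (@lebesgue_outer R n))
    (@caratheodory_measure_ge0 _ _ (@lebesgue_outer R n))
    (@caratheodory_measure_sigma_additive _ _ (@lebesgue_outer R n)).

(* [`|x|] on ['rV[R]_n] is the sup norm; it has the same topology. *)
Definition enorm (R : realType) n (x : 'rV[R]_n) : R :=
  Num.sqrt (\sum_(i < n) x ord0 i ^+ 2).

Definition diam (R : realType) n (A : set 'rV[R]_n) : R :=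
  sup [set enorm (p.1 - p.2) | p in A `*` A].

Section hausdorff.
Variables (R : realType) (n k : nat).
Local Notation Rn := 'rV[R]_n.
Local Open Scope ereal_scope.

Definition unit_ball_volume : \bar R :=
  lebesgue_outer [set x : 'rV[R]_k | (enorm x <= 1)%R].

Definition hausdorff_weight (A : set Rn) : \bar R :=
  unit_ball_volume * ((diam A / 2) ^+ k)%R%:E.

Definition hausdorff_delta (d : R) (A : set Rn) : \bar R :=
  cover_measure
    [set B : set Rn | forall x y, B x -> B y -> (enorm (x - y) <= d)%R]
    id hausdorff_weight A.

Definition hausdorff_outer (A : set Rn) : \bar R :=
  ereal_sup [set hausdorff_delta d A | d in [set d : R | (0 < d)%R]].

Lemma hausdorff_weight_ge0 A : 0 <= hausdorff_weight A.
Proof.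
rewrite mule_ge0 ?outer_measure_ge0// lee_fin exprn_ge0// divr_ge0//.
rewrite /diam; set E := image _ _; have [supE|/sup_out-> //] := pselect (has_sup E).
have [_ [p Ap _]] := supE.1.
apply: le_trans (ub_le_sup supE.2 (ex_intro2 _ _ p Ap erefl)).
exact: sqrtr_ge0.
Qed.

Let hausdorff_delta_le d A : (0 < d)%R ->
  hausdorff_delta d A <= hausdorff_outer A.
Proof. by move=> d0; apply: ereal_sup_ubound; exists d. Qed.

Lemma hausdorff_outer0 : hausdorff_outer set0 = 0.
Proof.
rewrite /hausdorff_outer (_ : image _ _ = [set 0]) ?ereal_sup1//.
apply/seteqP; split => [_ [d _ <-]|_ ->].
  exact: cover_measure0 _ _ hausdorff_weight_ge0.
by exists 1%R => //=; exact: cover_measure0 _ _ hausdorff_weight_ge0.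
Qed.

Lemma hausdorff_outer_ge0 A : 0 <= hausdorff_outer A.
Proof.
apply: le_trans (@hausdorff_delta_le 1%R A _) => //.
exact: cover_measure_ge0 _ _ hausdorff_weight_ge0 _.
Qed.

Lemma le_hausdorff_outer :
  {homo hausdorff_outer : A B / A `<=` B >-> A <= B}.
Proof.
move=> A B AB; apply: ge_ereal_sup => _ [d d0 <-].
by apply: le_trans (hausdorff_delta_le _ d0); exact: le_cover_measure.
Qed.

Lemma hausdorff_outer_sigma_subadditive : sigma_subadditive hausdorff_outer.
Proof.
move=> F; apply: ge_ereal_sup => _ [d d0 <-].
apply: (le_trans (cover_measure_sigma_subadditive _ _ hausdorff_weight_ge0 F)).
apply: lee_nneseries => [k1 _|k1 _]; last exact: hausdorff_delta_le.
by move=> *; exact: (cover_measure_ge0 _ _ hausdorff_weight_ge0).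
Qed.

HB.instance Definition _ := isOuterMeasure.Build R Rn hausdorff_outer
  hausdorff_outer0 hausdorff_outer_ge0 le_hausdorff_outer
  hausdorff_outer_sigma_subadditive.

End hausdorff.

(* Surface measure: the normalized (n-1)-dimensional Hausdorff measure. *)
Definition surface (R : realType) (n : nat) :
  set (caratheodory_type (@hausdorff_outer R n n.-1)) -> \bar R := (@hausdorff_outer R n n.-1).

HB.instance Definition _ (R : realType) (n : nat) :=
  isMeasure.Build _ (caratheodory_type (@hausdorff_outer R n n.-1)) R (@surface R n)
    (@caratheodory_measure0 _ _ (@hausdorff_outer R n n.-1))
    (@caratheodory_measure_ge0 _ _ (@hausdorff_outer R n n.-1))
    (@caratheodory_measure_sigma_additive _ _ (@hausdorff_outer R n n.-1)).

(* Elements of L^2(D) are represented by functions on the whole space, whose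
   values outside D are ignored. *)
Section L2.
Context d (T : measurableType d) (R : realType).
Variables (mu : {measure set T -> \bar R}) (D : set T).

Definition L2 : set (T -> R) := [set g | g \_ D \in Lfun mu 2%:E].

Definition inner (f g : T -> R) : R := Rintegral mu D (fun x => f x * g x).

Definition norm2 (f : T -> R) : R := Num.sqrt (inner f f).

(* The coarsest topology making all the functionals (., phi) continuous; by the
   Riesz theorem these are all the continuous linear functionals on L^2(D). *)
Definition weakL2 : Type :=
  initial_topology (fun g : L2 =>
    (fun phi => inner (\val g) (\val phi)) : {ptws L2 -> R}).

HB.instance Definition _ := Topological.on weakL2.

Definition weakly_lower_semicontinuous (J : (T -> R) -> R) : Prop :=
  lower_semicontinuous (fun g : weakL2 => (J (\val (g : L2)))%:E).

End L2.

Section dirichlet.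
Variables (R : realType) (n : nat).
Local Notation Rn := 'rV[R]_n.

Definition partial (i : 'I_n) (f : Rn -> R) : Rn -> R :=
  fun x => 'D_(delta_mx ord0 i) f x.

Definition partials (s : seq 'I_n) (f : Rn -> R) : Rn -> R := foldr partial f s.

Definition smooth (f : Rn -> R) : Prop := forall s,
  continuous (partials s f) /\
  forall i x, derivable (partials s f) x (delta_mx ord0 i).

Definition test_function (Omega : set Rn) (phi : Rn -> R) : Prop :=
  smooth phi /\
  exists K, [/\ compact K, K `<=` Omega & forall x, ~ K x -> phi x = 0].

Definition is_weak_gradient (Omega : set Rn) (u : Rn -> R) (G : Rn -> Rn) :=
  forall i,
    L2 (@lebesgue R n) Omega (fun x => G x ord0 i) /\
    forall phi, test_function Omega phi ->
      inner (@lebesgue R n) Omega u (partial i phi) =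
      - inner (@lebesgue R n) Omega (fun x => G x ord0 i) phi.

(* The weak gradient is unique almost everywhere on Omega; one representative
   is chosen. The value 0 is only taken when u has no
   weak gradient in L^2. *)
Definition weak_gradient (Omega : set Rn) (u : Rn -> R) : Rn -> Rn :=
  xget (fun=> 0) [set G | is_weak_gradient Omega u G].

Definition dirichlet_form (Omega : set Rn) (u v : Rn -> R) : R :=
  Rintegral (@lebesgue R n) Omega (fun x =>
    \sum_(i < n) weak_gradient Omega u x ord0 i *
                 weak_gradient Omega v x ord0 i).

End dirichlet.

Section triangulation.
Variables (R : realType) (n : nat).
Local Notation Rn := 'rV[R]_n.

(* The rows of the matrix are the vertices. *)
Definition simplex := 'M[R]_(n.+1, n).

Definition nondegenerate (T : simplex) : bool :=
  (\matrix_(i < n) (row (lift ord0 i) T - row ord0 T)) \in unitmx.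

(* The convex hull of the vertices with index in [I]. *)
Definition face (T : simplex) (I : {set 'I_n.+1}) : set Rn :=
  [set x | exists t : 'rV[R]_n.+1,
     [/\ forall j, 0 <= t ord0 j, forall j, j \notin I -> t ord0 j = 0,
         \sum_j t ord0 j = 1 & x = t *m T]].

Definition hull (T : simplex) : set Rn := face T [set: 'I_n.+1]%SET.

Definition polygonal_domain (Omega : set Rn) : Prop :=
  [/\ Omega !=set0, open Omega, connected Omega, bounded_set Omega &
      exists2 s : seq simplex, all nondegenerate s &
        Omega = interior [set x | exists2 T, T \in s & hull T x]].

(* The empty face is allowed, so disjoint simplices are covered. *)
Definition meet_in_common_face (T T' : simplex) : Prop :=
  exists I I', hull T `&` hull T' = face T I /\ face T I = face T' I'.

Definition triangulation (Omega : set Rn) (tau : seq simplex) : Prop :=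
  [/\ all nondegenerate tau,
      closure Omega = [set x | exists2 T, T \in tau & hull T x] &
      forall T T', T \in tau -> T' \in tau -> meet_in_common_face T T'].

Definition longest_side (T : simplex) : R :=
  \big[Num.max/0]_(i < n.+1) \big[Num.max/0]_(j < n.+1) enorm (row i T - row j T).

Definition mesh_size (tau : seq simplex) : R :=
  \big[Num.max/0]_(T <- tau) longest_side T.

Definition insphere_diameter (T : simplex) : R :=
  sup [set 2 * r | r in [set r | 0 <= r /\
    exists c, forall x, enorm (x - c) <= r -> hull T x]].

(* [Hs] is the set of mesh sizes occurring in the family: since Omega is
   bounded, no family can be indexed by all positive reals. *)
Definition regular_family (Omega : set Rn) (Hs : set R)
    (tau : R -> seq simplex) : Prop :=
  [/\ forall h, Hs h ->
        [/\ 0 < h, triangulation Omega (tau h) & mesh_size (tau h) = h],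
      exists sigma, forall h T, Hs h -> T \in (tau h) ->
        longest_side T <= sigma * insphere_diameter T &
      forall e, 0 < e -> exists2 h, Hs h & h < e].

Definition affine_on (A : set Rn) (v : Rn -> R) : Prop :=
  exists (c : R) (p : Rn), forall x, A x ->
    v x = c + \sum_(i < n) p ord0 i * x ord0 i.

End triangulation.

Section control.
Variables (R : realType) (n : nat).
Local Notation Rn := 'rV[R]_n.
Variables (Omega Gamma1 Gamma2 : set Rn) (b M : R) (q : Rn -> R).

(* Functions on the closure of Omega are represented by functions on R^n, whose
   values outside of the closure are ignored. *)
Definition Kh (tau : seq (simplex R n)) : set (Rn -> R) :=
  [set v : Rn -> R |
    [/\ {within closure Omega, continuous v},
        forall x, closure Omega x -> 0 <= v x,
        forall x, Gamma1 x -> v x = b &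
        forall T, T \in tau -> affine_on (hull T) v]].

(* The functions of [Kh] are continuous up to the boundary: their trace is their
   restriction. *)
Definition is_state (tau : seq (simplex R n)) (g u : Rn -> R) : Prop :=
  Kh tau u /\ forall v, Kh tau v ->
    dirichlet_form Omega u (v \- u) >=
    inner (@lebesgue R n) Omega g (v \- u) -
    inner (@surface R n) Gamma2 q (v \- u).

Definition state (tau : seq (simplex R n)) (g : Rn -> R) : Rn -> R :=
  xget (fun=> 0) [set u | is_state tau g u].

Definition cost (tau : seq (simplex R n)) (g : Rn -> R) : R :=
  norm2 (@lebesgue R n) Omega (state tau g) ^+ 2 / 2 +
  M / 2 * norm2 (@lebesgue R n) Omega g ^+ 2.

End control.

(* Main.v *)
(* On a fixed mesh everything is finite dimensional: a piecewise affine function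
   is determined by its values at nodes chosen inside each simplex, and its
   Dirichlet form is a quadratic form in these values. For this one needs its weak
   gradient: the forward difference quotients converge on Omega to the slope of
   the piece entered by the ray, and discrete integration by parts with dominated
   convergence identifies the limit, uniqueness being the fundamental lemma of the
   calculus of variations.

   If the Dirichlet form of w is small then w oscillates little on each simplex,
   hence on the connected set Omega, so that functions vanishing at a point of
   Gamma1 satisfy a Poincare inequality in the sup norm. Coercivity gives the
   state as the minimizer of the energy, and its values depend in a Lipschitz way
   on the finitely many moments of g against the shape functions. Hence the state
   part of J is weakly continuous, the control part is weakly lower
   semicontinuous, and for a minimizer one may project g onto the span of the shape
   functions and use compactness there. The surface integral only requires
   Gamma2 to have finite Hausdorff measure, being contained in finitely many
   bounded pieces of hyperplanes. *)
Require Import Defs.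
From mathcomp Require Import all_boot all_order all_algebra.
From mathcomp Require Import all_classical all_reals all_analysis.
From mathcomp Require Import measurable_realfun ring lra.
Set Implicit Arguments.
Unset Strict Implicit.
Unset Printing Implicit Defensive.
Import Order.TTheory GRing.Theory Num.Theory.
Import numFieldNormedType.Exports.
Local Open Scope classical_set_scope.
Local Open Scope ring_scope.

(** * Lebesgue measure *)

(** Lebesgue measure is defined by covers with boxes, so it has to be shown that a box does not have
    too small a measure: without positive volumes the Dirichlet form would control no slope. Mesh
    faces are never shown to be null. Forward rays make the difference quotients converge at every
    point of Omega, and at a point of several pieces the ray decides which slope counts; this rests
    on closedness and convexity of the pieces. Likewise functions are not taken modulo null
    functions: the chosen weak gradient differs from the computed one by functions d with (d,d) = 0,
    which disappear from inner products by a discriminant argument. The oscillation estimate counts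
    pieces by a pigeonhole instead of chaining neighbours. Apart from (b), every claim concerns a
    single mesh, so constants such as inverse volumes of inscribed boxes may depend on it; (b)
    follows by discarding the nonnegative state term. *)

Section lebesgue_outer_theory.
Context {R : realType} {n : nat}.
Local Notation Rn := 'rV[R]_n.
Local Open Scope ereal_scope.
Implicit Types (A B X : set Rn) (i : 'I_n).

Lemma maxr_split (a b c : R) :
  (Num.max 0 (Num.min b c - a) + Num.max 0 (b - Num.max a c) =
   Num.max 0 (b - a))%R.
Proof.
case: (leP b c) => bc; case: (leP a c) => ac;
  rewrite /Num.max /Num.min; do ?[case: ifPn]; rewrite -?leNgt => *; lra.
Qed.

(** Both halves of a cut box are again closed boxes, possibly empty. Truncating side lengths at 0
    keeps the volumes exactly additive in the empty case too. *)
Definition box_below i (c : R) (ab : Rn * Rn) : Rn * Rn :=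
  (ab.1, \row_j if j == i then Num.min (ab.2 ord0 j) c else ab.2 ord0 j)%R.

Definition box_above i (c : R) (ab : Rn * Rn) : Rn * Rn :=
  (\row_j (if j == i then Num.max (ab.1 ord0 j) c else ab.1 ord0 j), ab.2)%R.

Lemma box_volume_split i c ab :
  box_volume (box_below i c ab) + box_volume (box_above i c ab) =
  box_volume ab.
Proof.
rewrite /box_volume -EFinD; congr EFin.
rewrite (bigD1 i)//= [X in (_ + X)%R = _](bigD1 i)//= [RHS](bigD1 i)//=.
rewrite !mxE eqxx -(maxr_split (ab.1 ord0 i) (ab.2 ord0 i) c) mulrDl.
congr (_ + _)%R; congr (_ * _)%R; apply: eq_bigr => j /negPf ji; by rewrite mxE ji.
Qed.

Lemma weight_map_split i c o :
  weight (@box_volume R n) (omap (box_below i c) o) +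
  weight (@box_volume R n) (omap (box_above i c) o) =
  weight (@box_volume R n) o.
Proof. by case: o => [ab|] /=; rewrite ?adde0// box_volume_split. Qed.

(** Cutting every box of a cover of X along the hyperplane yields covers of both parts of X, with no
    loss of total volume. *)
Lemma lebesgue_halfspace i (c : R) :
  (@lebesgue_outer R n).-caratheodory [set x : Rn | (x ord0 i <= c)%R].
Proof.
apply: le_caratheodory_measurable => X.
apply: le_ereal_inf_tmp => _ [F [_ XF] <-].
have w0 o : 0 <= weight (@box_volume R n) o.
  by apply: weight_ge0; exact: box_volume_ge0.
rewrite (eq_eseriesr (g := fun k =>
    weight (@box_volume R n) (omap (box_below i c) (F k)) +
    weight (@box_volume R n) (omap (box_above i c) (F k)))); last first.
  by move=> k _; rewrite weight_map_split.
rewrite nneseriesD; [|by move=> *; exact: w0|by move=> *; exact: w0].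
apply: leeD; apply: ereal_inf_lbound.
- exists (fun k => omap (box_below i c) (F k)) => //; split=> // x [Xx xc].
  have [k _ /=] := XF _ Xx; case Fk : (F k) => [ab|//] abx.
  exists k => //=; rewrite Fk /= => j; rewrite mxE; have /andP[-> /=] := abx j.
  by case: eqP => // ->; rewrite le_min xc andbT.
- exists (fun k => omap (box_above i c) (F k)) => //; split=> // x [Xx xc].
  have [k _ /=] := XF _ Xx; case Fk : (F k) => [ab|//] abx.
  exists k => //=; rewrite Fk /= => j; rewrite mxE; have /andP[+ ->] := abx j.
  rewrite andbT; case: eqP => // -> aj; rewrite ge_max aj/=.
  by move/negP : xc; rewrite -ltNge => /ltW.
Qed.

Lemma lebesgue_outer_box ab : lebesgue_outer (box ab) <= @box_volume R n ab.
Proof.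
apply: ereal_inf_lbound.
exists (fun k => if k == 0%N then Some ab else None).
  by split=> // x abx; exists 0%N.
rewrite (nneseriesD1 (n := 0%N))//=.
  by rewrite eseries0 ?adde0// => k _ /negPf ->.
by move=> k _; apply: weight_ge0; exact: box_volume_ge0.
Qed.

Lemma lebesgue_outer_translate_le (h : Rn) A :
  lebesgue_outer A <= lebesgue_outer [set x | A (x + h)%R].
Proof.
apply: le_ereal_inf_tmp => _ [F [_ AF] <-].
pose sh (ab : Rn * Rn) := (ab.1 + h, ab.2 + h)%R.
apply: ereal_inf_lbound; exists (fun k => omap sh (F k)).
  split=> // x Ax; have [|k _ /=] := AF (x - h)%R; first by rewrite /= subrK.
  case Fk : (F k) => [ab|//] abx; exists k => //=; rewrite Fk /= => i.
  by have := abx i; rewrite /= !mxE lerBrDr lerBlDr.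
apply: eq_eseriesr => k _; case: (F k) => //= ab; rewrite /box_volume /sh /=.
by congr EFin; apply: eq_bigr => i _; rewrite !mxE opprD addrACA subrr addr0.
Qed.

Lemma lebesgue_outer_translate (h : Rn) A :
  lebesgue_outer [set x | A (x + h)%R] = lebesgue_outer A.
Proof.
apply/eqP; rewrite eq_le lebesgue_outer_translate_le andbT.
apply: (le_trans (lebesgue_outer_translate_le (- h)%R _)).
by apply: le_outer_measure => x; rewrite /= subrK.
Qed.

Lemma caratheodory_translate (h : Rn) A :
  (@lebesgue_outer R n).-caratheodory A ->
  (@lebesgue_outer R n).-caratheodory [set x | A (x + h)%R].
Proof.
move=> mA X.
rewrite -(lebesgue_outer_translate (- h)%R X) (mA [set x | X (x - h)%R]).
congr (_ + _); rewrite -(lebesgue_outer_translate h); congr lebesgue_outer;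
  by apply/seteqP; split => x /=; rewrite addrK.
Qed.

Lemma lebesgue_outer_bounded A : bounded_set A -> lebesgue_outer A < +oo.
Proof.
move=> [M [Mr MA]]; set K := (M + 1)%R.
have AK : A `<=` box (const_mx (- K)%R, const_mx K).
  move=> x Ax i; rewrite !mxE -ler_norml.
  apply: le_trans (MA K _ _ Ax); last by rewrite ltrDl.
  by rewrite [leRHS]/Num.norm /= mx_normrE (bigmax_sup (ord0, i)).
apply: (le_lt_trans (le_outer_measure (@lebesgue_outer R n) _ _ AK)).
by apply: (le_lt_trans (lebesgue_outer_box _)); rewrite ltry.
Qed.

End lebesgue_outer_theory.

(** * Lower bound for the volume of countable covers of a box *)

Section cover_lower_bound.
Context {R : realType}.
Local Open Scope ereal_scope.
Variables (a b : nat -> R) (l r : nat -> nat -> R).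
Hypothesis ab : forall i, (a i <= b i)%R.

Let chi k i (t : R) : R := \1_(`[l k i, r k i]%classic) t.

(** Induction on the number of coordinates: the pointwise bound is integrated over the last one with
    one-dimensional Lebesgue measure, the series termwise. This treats countable covers without
    compactness. [d] and [c k] collect the side lengths already integrated; points are sequences so
    that their type stays fixed along the induction. *)
Lemma prod_le_cover (m : nat) (d : R) (c : nat -> R) :
  (forall k, 0 <= c k)%R -> (0 <= d)%R ->
  (forall x : nat -> R, (forall i, a i <= x i <= b i)%R ->
     d%:E <= \sum_(k <oo) (c k * \prod_(i < m) chi k i (x i))%:E) ->
  (d * \prod_(i < m) (b i - a i))%:E <=
    \sum_(k <oo) (c k * \prod_(i < m) Num.max 0 (r k i - l k i))%:E.
Proof.
elim: m d c => [|m IH] d c c0 d0 H.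
  rewrite big_ord0 mulr1; apply: le_trans (H a _) _.
    by move=> i; rewrite lexx ab.
  by rewrite le_eqVlt; apply/orP; left; apply/eqP; apply: eq_eseriesr => k _; rewrite !big_ord0.
have -> : \sum_(k <oo) (c k * \prod_(i < m.+1) Num.max 0 (r k i - l k i))%:E =
   \sum_(k <oo) ((c k * Num.max 0 (r k m - l k m)) * \prod_(i < m) Num.max 0 (r k i - l k i))%:E.
  by apply: eq_eseriesr => k _; rewrite big_ord_recr/=; congr EFin; ring.
rewrite big_ord_recr/= [X in (d * X)%R]mulrC mulrA.
apply: IH => [k||x xab].
- by rewrite mulr_ge0// le_max lexx.
- by rewrite mulr_ge0// subr_ge0.
(* [P k] is the part of the k-th term that is constant in the last coordinate t. *)
pose P k := (c k * \prod_(i < m) chi k i (x i))%R.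
have P0 k : (0 <= P k)%R.
  by rewrite mulr_ge0// prodr_ge0// => i _; rewrite /chi indicE ler0n.
have mchi k i : measurable_fun setT (chi k i) by exact: measurable_indic.
have mPchi k : measurable_fun setT (fun t => P k * chi k m t)%R.
  by apply: (@measurable_funM _ _ _ _ (cst (P k)) (chi k m)).
pose mu := @lebesgue_measure R.
have mab : measurable (`[a m, b m]%classic : set (measurableTypeR R)).
  exact: measurable_itv.
have muE (u v : R) : mu `[u, v]%classic = (Num.max 0 (v - u))%:E.
  rewrite /mu lebesgue_measure_itv/= lte_fin; case: ltP => uv.
    by rewrite -EFinB max_r// subr_ge0 ltW.
  by rewrite max_l// subr_le0.
have -> : (d * (b m - a m))%:E = \int[mu]_(t in `[a m, b m]) d%:E.
  by rewrite integral_cst// [X in _ * X]muE max_r// subr_ge0.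
apply: (@le_trans _ _ (\int[mu]_(t in `[a m, b m]) \sum_(k <oo) (P k * chi k m t)%:E)).
  apply: ge0_le_integral => //.
  - apply: ge0_emeasurable_sum => [k t _ _|k _].
      by rewrite lee_fin mulr_ge0// /chi indicE ler0n.
    by apply/measurable_EFinP; apply: measurable_funTS; exact: mPchi.
  move=> t; rewrite /= in_itv/= => tab.
  apply: (le_trans (H (fun i => if i == m then t else x i) _)).
    by move=> i; case: eqP => // ->.
  rewrite le_eqVlt; apply/orP; left; apply/eqP; apply: eq_eseriesr => k _.
  rewrite big_ord_recr/= eqxx mulrA; congr (_ * _ * _)%:E.
  by apply: eq_bigr => i _; rewrite ltn_eqF.
rewrite integral_nneseries//; last 2 first.
- by move=> k; apply/measurable_EFinP; apply: measurable_funTS; exact: mPchi.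
- by move=> k t _; rewrite lee_fin mulr_ge0// /chi indicE ler0n.
apply: lee_nneseries => [k _ _|k _].
  by apply: integral_ge0 => t _; rewrite lee_fin mulr_ge0// /chi indicE ler0n.
under eq_integral do rewrite EFinM.
rewrite ge0_integralZl//; last 3 first.
- by apply/measurable_EFinP; apply: measurable_funTS; exact: mchi.
- by move=> t _; rewrite lee_fin /chi indicE ler0n.
- by rewrite lee_fin.
have -> : (c k * Num.max 0 (r k m - l k m) * \prod_(i < m) chi k i (x i))%:E
   = (P k)%:E * (Num.max 0 (r k m - l k m))%:E by rewrite -EFinM /P; congr EFin; ring.
apply: lee_wpmul2l; first by rewrite lee_fin.
rewrite integral_indic//.
apply: (@le_trans _ _ (mu `[l k m, r k m]%classic)).
  by apply: le_measure; rewrite ?inE//; apply: measurableI.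
by rewrite [leLHS]muE.
Qed.

End cover_lower_bound.

Section box_measure.
Context {R : realType} {n : nat}.
Local Notation Rn := 'rV[R]_n.
Local Open Scope ereal_scope.

Lemma box_volume_le_outer (ab : Rn * Rn) :
  (forall i, ab.1 ord0 i <= ab.2 ord0 i)%R ->
  @box_volume R n ab <= lebesgue_outer (box ab).
Proof.
move=> abi; apply: le_ereal_inf_tmp => _ [F [_ XF] <-].
(* Rows are extended by 0 to sequences; an entry [None] of the cover gets weight 0 through [c]. *)
pose ext (v : Rn) (i : nat) : R := oapp (v ord0) 0%R (insub i).
have extE v (i : 'I_n) : ext v i = v ord0 i by rewrite /ext valK.
pose lo k := ext (if F k is Some cd then cd.1 else 0%R).
pose hi k := ext (if F k is Some cd then cd.2 else 0%R).
pose c k : R := if F k is Some cd then 1%R else 0%R.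
have ext_le i : (ext ab.1 i <= ext ab.2 i)%R.
  by rewrite /ext; case: insubP => [j _ _|_] /=.
have c0 k : (0 <= c k)%R by rewrite /c; case: (F k).
have H := @prod_le_cover R (ext ab.1) (ext ab.2) lo hi ext_le n 1%R c c0 ler01.
have -> : @box_volume R n ab = (1 * \prod_(i < n) (ext ab.2 i - ext ab.1 i))%:E.
  rewrite mul1r; congr EFin; apply: eq_bigr => i _.
  by rewrite !extE max_r// subr_ge0.
apply: (le_trans (H _)).
  (* A covering box that contains the point already contributes 1 to the sum. *)
  move=> x xab; have [|k0 _] := XF (\row_i x i).
    by move=> i; rewrite mxE; have := xab i; rewrite !extE.
  case Fk : (F k0) => [cd|//] xcd.
  have cprod_ge0 k : 0 <= (c k * \prod_(i < n) \1_`[lo k i, hi k i] (x i))%:E.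
    by rewrite lee_fin mulr_ge0// prodr_ge0.
  rewrite (nneseriesD1 (n := k0))//.
  rewrite -[leLHS]adde0; apply: leeD; last exact: nneseries_ge0.
  rewrite lee_fin /c Fk mul1r big1// => i _.
  rewrite /= indicE mem_set//= in_itv/= /lo /hi Fk !extE.
  by have := xcd i; rewrite mxE.
rewrite le_eqVlt; apply/orP; left; apply/eqP; apply: eq_eseriesr => k _.
rewrite /c /lo /hi /weight; case: (F k) => [cd|]; last by rewrite mul0r.
by rewrite mul1r; congr EFin; apply: eq_bigr => i _; rewrite !extE.
Qed.

End box_measure.

Lemma ex_natSinv_lt {R : realType} (e : R) :
  0 < e -> exists k : nat, k.+1%:R^-1 < e.
Proof.
move=> e0; have [k _ H] := near_infty_natSinv_lt (PosNum e0).
by exists k; exact: (H k (leqnn _)).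
Qed.

Section cvg_prod.
Context {R : realType} {T : topologicalType}.

Lemma continuous_prod (I : Type) (s : seq I) (f : I -> T -> R) :
  (forall i, continuous (f i)) -> continuous (fun x => \prod_(i <- s) f i x).
Proof.
move=> cf; elim: s => [|i s IH].
  rewrite (_ : (fun x => _) = cst 1); first exact: cst_continuous.
  by apply/funext => x; rewrite big_nil.
rewrite (_ : (fun x => _) = (fun x => f i x * \prod_(j <- s) f j x)); last first.
  by apply/funext => x; rewrite big_cons.
by move=> x; apply: continuousM; [exact: cf|exact: IH].
Qed.

Lemma continuous_sum (I : Type) (s : seq I) (f : I -> T -> R) :
  (forall i, continuous (f i)) -> continuous (fun x => \sum_(i <- s) f i x).
Proof.
move=> cf; elim: s => [|i s IH].
  rewrite (_ : (fun x => _) = cst 0); first exact: cst_continuous.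
  by apply/funext => x; rewrite big_nil.
rewrite (_ : (fun x => _) = (fun x => f i x + \sum_(j <- s) f j x)); last first.
  by apply/funext => x; rewrite big_cons.
by move=> x; apply: continuousD; [exact: cf|exact: IH].
Qed.

End cvg_prod.

(** * Open sets as countable unions of boxes *)

Section open_sets.
Context {R : realType} {n : nat}.
Local Notation Rn := 'rV[R]_n.
Implicit Types (U : set Rn) (ab : Rn * Rn).

Definition obox ab : set Rn :=
  [set x | forall i, ab.1 ord0 i < x ord0 i < ab.2 ord0 i].

Lemma obox_sub_box ab : obox ab `<=` box ab.
Proof. by move=> x xab i; have /andP[/ltW-> /ltW->] := xab i. Qed.

Lemma coord_continuous1 (i : 'I_n) : continuous (fun x : Rn => x ord0 i).
Proof. exact: coord_continuous. Qed.

Lemma open_obox ab : open (obox ab).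
Proof.
rewrite openE => x xab; rewrite /interior.
have near_coord i : nbhs x [set y : Rn | ab.1 ord0 i < y ord0 i < ab.2 ord0 i].
  have /(_ [set r | ab.1 ord0 i < r < ab.2 ord0 i]) := @coord_continuous1 i x.
  apply; apply: filterS (near_in_itvoo (_ : x ord0 i \in `]ab.1 ord0 i, ab.2 ord0 i[)).
    by move=> y; rewrite in_itv.
  by rewrite in_itv/=; exact: xab.
by have := @filter_forall _ _ _ _ (nbhs_filter x) near_coord; apply: filterS.
Qed.

Lemma closed_box ab : closed (box ab).
Proof.
have -> : box ab = \bigcap_i ([set x : Rn | ab.1 ord0 i <= x ord0 i] `&`
                             [set x : Rn | x ord0 i <= ab.2 ord0 i]).
  apply/seteqP; split=> [x xab i _|x xab i]; first by have /andP[] := xab i.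
  by have [|/= -> ->] := xab i.
apply: closed_bigI => i _; apply: closedI.
  apply: (@closed_comp _ _ (fun x : Rn => x ord0 i) [set y | ab.1 ord0 i <= y]).
    by move=> y _; exact: coord_continuous1.
  exact: closed_ge.
apply: (@closed_comp _ _ (fun x : Rn => x ord0 i) [set y | y <= ab.2 ord0 i]).
  by move=> y _; exact: coord_continuous1.
exact: closed_le.
Qed.

Lemma bounded_box ab : bounded_set (box ab).
Proof.
exists (\sum_i (`|ab.1 ord0 i| + `|ab.2 ord0 i|)); split; first exact: num_real.
move=> M /ltW sM x xab; apply: le_trans sM.
rewrite [leLHS]/Num.norm /= mx_normrE; apply: bigmax_le => [|[j i] _].
  by apply: sumr_ge0 => i _; rewrite addr_ge0.
rewrite (bigD1 i)//= -[leLHS]addr0 ord1; apply: lerD; last first.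
  by apply: sumr_ge0 => k _; rewrite addr_ge0.
have /andP[ax xb] := xab i; rewrite ler_norml; apply/andP; split.
  apply: le_trans ax; rewrite lerNl; apply: le_trans (ler_norm _) _.
  by rewrite normrN lerDl.
by apply: (le_trans xb); apply: (le_trans (ler_norm _)); rewrite lerDr.
Qed.

Lemma compact_box ab : compact (box ab).
Proof. by apply: bounded_closed_compact; [exact: bounded_box|exact: closed_box]. Qed.

Lemma near_box U x : open U -> U x ->
  exists2 e : R, 0 < e & box (x - const_mx e, x + const_mx e) `<=` U.
Proof.
rewrite openE => /(_ x)/[apply]; rewrite /interior => /nbhs_ballP[e /= e0 eU].
exists (e / 2); first by rewrite divr_gt0.
move=> y xy; apply: eU; split=> // i j; rewrite ord1 /ball/= .
have := xy j; rewrite !mxE => /andP[h1 h2].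
rewrite ltr_norml; apply/andP; split; lra.
Qed.

End open_sets.

Section rational_boxes.
Context {R : realType} {n : nat}.
Local Notation Rn := 'rV[R]_n.+1.

Lemma open_bigcup_boxes (U : set Rn) : open U ->
  exists ab : nat -> Rn * Rn,
    (forall k, box (ab k) `<=` U) /\ U = \bigcup_k obox (ab k).
Proof.
move=> oU.
pose rbox (c : 'rV[rat]_n.+1) (k : nat) : Rn * Rn :=
  (map_mx ratr c - const_mx k.+1%:R^-1, map_mx ratr c + const_mx k.+1%:R^-1).
(* Filler for codes of unwanted boxes; it is empty because there is at least one coordinate. *)
pose nobox : Rn * Rn := (const_mx 1, const_mx 0).
pose ab m : Rn * Rn :=
  if (@unpickle ('rV[rat]_n.+1 * nat)%type m) is Some ck then
    if `[< box (rbox ck.1 ck.2) `<=` U >] then rbox ck.1 ck.2 else nobox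
  else nobox.
have boxU m : box (ab m) `<=` U.
  have nob : box nobox `<=` U.
    move=> x /(_ ord0); rewrite !mxE => /andP[h1 h2].
    by have := le_trans h1 h2; rewrite ler10.
  by rewrite /ab; case: unpickle => // ck; case: asboolP.
exists ab; split=> //; apply/seteqP; split=> [x Ux|x [m _ /obox_sub_box]]; last exact: boxU.
have [e e0 eU] := near_box oU Ux.
(* A rational center closer to x than 1/(k+1) < e/2 gives a box around x whose points have
   coordinates within e of those of x. *)
have [k ke] : exists k : nat, k.+1%:R^-1 < e / 2.
  by apply: ex_natSinv_lt; rewrite divr_gt0.
have k0 : (0 : R) < k.+1%:R^-1 by rewrite invr_gt0.
pose t : R := k.+1%:R^-1; rewrite -/t in ke k0.
have rboxE : rbox^~ k = fun c => (map_mx ratr c - const_mx t, map_mx ratr c + const_mx t) by [].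
clearbody t.
have /choice[c cP] : forall i, exists q : rat, `|x ord0 i - ratr q| < t.
  move=> i; have xx : x ord0 i - t < x ord0 i + t by lra.
  have [q] := rat_in_itvoo xx; rewrite in_itv/= => /andP[h1 h2].
  by exists q; rewrite ltr_norml; apply/andP; split; lra.
exists (pickle (\row_i c i, k)) => //.
have {}rboxE := congr1 (fun f => f (\row_i c i)) rboxE; rewrite /= in rboxE.
rewrite /= /ab pickleK /= rboxE; case: asboolP => [_ i|].
  rewrite !mxE; have := cP i; rewrite ltr_norml => /andP[h1 h2].
  by apply/andP; split; lra.
case; apply: subset_trans eU => y yb i; have := yb i; rewrite !mxE => /andP[h1 h2].
have := cP i; rewrite ltr_norml => /andP[h3 h4].
by apply/andP; split; lra.
Qed.

End rational_boxes.

(** * Borel sets for outer measures that measure half-spaces *)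

Section caratheodory_borel.
Context {R : realType} {n : nat}.
Local Notation Rn := 'rV[R]_n.+1.
Variable mu : {outer_measure set Rn -> \bar R}.
Hypothesis mu_halfspace : forall i (c : R),
  mu.-caratheodory [set x : Rn | x ord0 i <= c].
Local Notation T := (caratheodory_type mu).

(** The outer measure is arbitrary because the same facts serve Lebesgue and Hausdorff measure.
    Strict half-spaces are countable unions of the closed ones assumed measurable. *)
Lemma caratheodory_coord i : measurable_fun [set: T] (fun x : T => (x : Rn) ord0 i).
Proof.
apply: (measurability _ (RGenInftyO.measurableE R)) => //.
move=> _ [_ [y ->] <-]; rewrite setTI.
have -> : (fun x : T => (x : Rn) ord0 i) @^-1` `]-oo, y[ =
    \bigcup_k [set x : Rn | x ord0 i <= y - k.+1%:R^-1].
  apply/seteqP; split=> [x /=|x [k _ /=] xk]; rewrite in_itv/=; last first.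
    by apply: le_lt_trans xk _; rewrite ltrBlDr ltrDl invr_gt0.
  move=> xy; have e0 : 0 < y - (x : Rn) ord0 i by rewrite subr_gt0.
  by have [k H] := ex_natSinv_lt e0; exists k => //=; rewrite lerBrDr -lerBrDl ltW.
by apply: bigcup_measurable => k _; exact: mu_halfspace.
Qed.

Lemma caratheodory_obox ab : measurable (obox ab : set T).
Proof.
have -> : obox ab = \bigcap_(i in [set: 'I_n.+1])
    (fun x : T => (x : Rn) ord0 i) @^-1` `]ab.1 ord0 i, ab.2 ord0 i[%classic.
  apply/seteqP; split=> [x xab i _|x xab i]; rewrite /= ?in_itv/=; first exact: xab.
  by have := xab i I; rewrite /= in_itv.
apply: fin_bigcap_measurable; first exact: finite_finset.
move=> i _; rewrite -[X in measurable X]setTI.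
by apply: caratheodory_coord => //; exact: measurable_itv.
Qed.

Lemma caratheodory_open (U : set Rn) : open U -> measurable (U : set T).
Proof.
move=> /open_bigcup_boxes[ab [_ ->]]; apply: bigcup_measurable => k _.
exact: caratheodory_obox.
Qed.

Lemma caratheodory_closed (U : set Rn) : closed U -> measurable (U : set T).
Proof.
move=> cU; rewrite -[U]setCK; apply: measurableC.
by apply: caratheodory_open; exact: closed_openC.
Qed.

Lemma caratheodory_continuous (f : Rn -> R) :
  continuous f -> measurable_fun [set: T] (f : T -> R).
Proof.
move=> /continuousP cf; apply: (measurability _ (RGenOpens.measurableE R)) => //.
move=> _ [_ [a [b ->] <-]]; rewrite setTI.
by apply: caratheodory_open; apply: cf; exact: interval_open.
Qed.

End caratheodory_borel.

(** * Square integrable functions *)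

Lemma le_mul_sqrD {R : realFieldType} (x y : R) : 0 <= x -> 0 <= y ->
  x * y <= x ^+ 2 + y ^+ 2.
Proof. by move=> x0 y0; nra. Qed.

Section L2_theory.
Context d (T : measurableType d) (R : realType).
Variables (mu : {measure set T -> \bar R}) (D : set T).
Hypothesis mD : measurable D.
Implicit Types f g h : T -> R.
Local Notation L2 := (L2 mu D).
Local Notation inner := (inner mu D).

(** [L2] speaks of f patched by 0 outside D; this working form speaks of f on D alone. *)
Lemma L2P f : L2 f <->
  measurable_fun D f /\ mu.-integrable D (EFin \o (fun x => f x ^+ 2)).
Proof.
have sqr_patch : (EFin \o (fun x => (f \_ D) x ^+ 2)) =
    ((EFin \o (fun x => f x ^+ 2)) \_ D).
  by apply/funext => x; rewrite /= !patchE; case: ifP => // _; rewrite expr0n.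
split=> [fL2|[mf intf]].
  split.
    apply: (@eq_measurable_fun _ _ _ _ D (f \_ D)) => [x xD|].
      by rewrite patchE xD.
    apply: measurable_funTS.
    by move: fL2; rewrite /Defs.L2 /= => /sub_Lfun_mfun; rewrite inE.
  by have := Lfun2_integrable_sqr fL2; rewrite sqr_patch; rewrite -integrable_mkcond.
have mfD : measurable_fun setT (f \_ D) by exact/(measurable_restrictT f mD).
rewrite /Defs.L2 /= inE/=; apply/andP; split; rewrite inE//=.
rewrite /finite_norm unlock /Lnorm poweR_lty//.
rewrite (_ : (\int[mu]_x _)%E =
    (\int[mu]_x `|(EFin \o (fun y => (f \_ D) y ^+ 2)%R) x|)%E); last first.
  apply: eq_integral => x _; rewrite /= powR_mulrn//.
  by rewrite real_normK ?num_real// ger0_norm// sqr_ge0.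
have /integrableP[_] // : mu.-integrable setT (EFin \o (fun x => (f \_ D) x ^+ 2)).
by rewrite sqr_patch -integrable_mkcond.
Qed.

Lemma L2_measurable f : L2 f -> measurable_fun D f.
Proof. by case/L2P. Qed.

Lemma L2_mul_integrable f g : L2 f -> L2 g ->
  mu.-integrable D (EFin \o (fun x => f x * g x)).
Proof.
move=> /L2P[mf intf] /L2P[mg intg].
apply: (le_integrable mD _ _ (integrableD mD intf intg)).
  by apply/measurable_EFinP; exact: measurable_funM.
move=> x _; rewrite /= lee_fin normrM [leRHS]ger0_norm ?addr_ge0 ?sqr_ge0//.
rewrite -[f x ^+ 2]real_normK ?num_real// -[g x ^+ 2]real_normK ?num_real//.
apply: le_mul_sqrD; exact: normr_ge0.
Qed.

Lemma L2_lin (a : R) f g : L2 f -> L2 g -> L2 (fun x => a * f x + g x).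
Proof.
move=> /[dup] fL2 /L2P[mf intf] /[dup] gL2 /L2P[mg intg].
apply/L2P; split.
  by apply: measurable_funD => //; exact: measurable_funM.
have intfg := L2_mul_integrable fL2 gL2.
have := integrableD mD (integrableD mD (integrableZl mD (a ^+ 2) intf)
  (integrableZl mD (2 * a) intfg)) intg.
apply: eq_integrable => // x _; rewrite /= -!EFinM -!EFinD; congr EFin; ring.
Qed.

Lemma L2_0 : L2 (fun=> 0).
Proof.
apply/L2P; split => //.
rewrite (_ : _ \o _ = cst 0%E); first exact: integrable0.
by apply/funext => x; rewrite /= expr0n.
Qed.

Lemma L2_Z (a : R) f : L2 f -> L2 (fun x => a * f x).
Proof.
move=> fL2; rewrite (_ : (fun _ => _) = (fun x => a * f x + 0)); last first.
  by apply/funext => x; rewrite addr0.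
exact: L2_lin L2_0.
Qed.

Lemma L2_B f g : L2 f -> L2 g -> L2 (fun x => f x - g x).
Proof.
move=> fL2 gL2; rewrite (_ : (fun _ => _) = (fun x => -1 * g x + f x)); last first.
  by apply/funext => x; rewrite mulN1r addrC.
exact: L2_lin.
Qed.

Lemma L2_sum (I : Type) (r : seq I) (s : I -> R) (e : I -> T -> R) :
  (forall j, L2 (e j)) -> L2 (fun x => \sum_(j <- r) s j * e j x).
Proof.
move=> eL2; elim: r => [|i r IH].
  rewrite (_ : (fun _ => _) = (fun=> 0)); first exact: L2_0.
  by apply/funext => x; rewrite big_nil.
rewrite (_ : (fun _ => _) = (fun x => s i * e i x + \sum_(j <- r) s j * e j x)).
  exact: L2_lin.
by apply/funext => x; rewrite big_cons.
Qed.

Lemma bounded_L2 f (C : R) : (mu D < +oo)%E -> measurable_fun D f ->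
  (forall x, D x -> `|f x| <= C) -> L2 f.
Proof.
move=> muD mf fC; apply/L2P; split => //.
apply: (measurable_bounded_integrable mD muD); first exact: measurable_funX.
exists (C ^+ 2); split; first exact: num_real.
move=> M /ltW CM x Dx; apply: le_trans CM.
by rewrite normrX ler_sqr ?nnegrE ?fC// (le_trans _ (fC _ Dx)).
Qed.

Lemma innerC f g : inner f g = inner g f.
Proof. by apply: eq_Rintegral => x _; rewrite mulrC. Qed.

Lemma eq_inner f f' g : {in D, f =1 f'} -> inner f g = inner f' g.
Proof. by move=> ff'; apply: eq_Rintegral => x xD; rewrite ff'. Qed.

Lemma inner_lin (a : R) f g h : L2 f -> L2 g -> L2 h ->
  inner (fun x => a * f x + g x) h = a * inner f h + inner g h.
Proof.
move=> fL2 gL2 hL2; rewrite /Defs.inner.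
rewrite -RintegralZl//; last exact: L2_mul_integrable.
rewrite -RintegralD//; last exact: L2_mul_integrable.
  by apply: eq_Rintegral => x _; ring.
apply: eq_integrable (L2_mul_integrable (L2_Z a fL2) hL2) => // x _ /=.
by rewrite mulrA.
Qed.

Lemma inner_0 h : inner (fun=> 0) h = 0.
Proof.
rewrite /Defs.inner; under eq_Rintegral do rewrite mul0r.
by rewrite Rintegral_cst// mul0r.
Qed.

Lemma innerZ (a : R) f h : L2 f -> L2 h ->
  inner (fun x => a * f x) h = a * inner f h.
Proof.
move=> fL2 hL2; rewrite -[RHS]addr0 -(inner_0 h) -inner_lin//; last exact: L2_0.
by apply: eq_inner => x _; rewrite addr0.
Qed.

Lemma innerB f g h : L2 f -> L2 g -> L2 h ->
  inner (fun x => f x - g x) h = inner f h - inner g h.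
Proof.
move=> fL2 gL2 hL2; rewrite addrC -mulN1r -inner_lin//.
by apply: eq_inner => x _; rewrite mulN1r addrC.
Qed.

Lemma inner_sum (I : Type) (r : seq I) (s : I -> R) (e : I -> T -> R) h :
  (forall j, L2 (e j)) -> L2 h ->
  inner (fun x => \sum_(j <- r) s j * e j x) h = \sum_(j <- r) s j * inner (e j) h.
Proof.
move=> eL2 hL2; elim: r => [|i r IH].
  rewrite big_nil -[RHS](inner_0 h).
  by apply: eq_inner => x _; rewrite big_nil.
rewrite big_cons -IH -inner_lin//; last exact: L2_sum.
by apply: eq_inner => x _; rewrite big_cons.
Qed.

Lemma inner_ge0 f : 0 <= inner f f.
Proof. by apply: Rintegral_ge0 => x _; rewrite -expr2 sqr_ge0. Qed.

Lemma norm2_sqr f : norm2 mu D f ^+ 2 = inner f f.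
Proof. by rewrite /norm2 sqr_sqrtr// inner_ge0. Qed.

Lemma inner_null f h : L2 f -> L2 h -> inner f f = 0 -> inner h f = 0.
Proof.
move=> fL2 hL2 ff0; apply/eqP; apply: contraT => hf0.
have pos t : 0 <= inner h h + 2 * t * inner h f.
  have := inner_ge0 (fun x => t * f x + h x).
  have thL2 := L2_lin t fL2 hL2.
  by rewrite inner_lin// 2!(innerC _ (fun x => t * f x + h x)) !inner_lin// ff0
    (innerC f h) => p; move: p; congr (0 <= _); ring.
(* At this t the affine function takes the value -1. *)
have := pos (- (inner h h + 1) / (2 * inner h f)).
have -> : inner h h + 2 * (- (inner h h + 1) / (2 * inner h f)) * inner h f = -1.
  by field.
by rewrite ler0N1.
Qed.

(** Gram-Schmidt without passing to the quotient by null functions: a residual of norm 0 is dropped,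
    so [k i] is only claimed to agree with its expansion when paired with elements of L2. *)
Lemma orthonormal_system (I : eqType) (s : seq I) (k : I -> T -> R) :
  (forall i, L2 (k i)) ->
  exists m (e : nat -> T -> R),
    [/\ forall j, L2 (e j),
        forall i j, (i < m)%N -> (j < m)%N -> inner (e i) (e j) = (i == j)%:R &
        forall i, i \in s -> exists c : nat -> R, forall h, L2 h ->
          inner h (k i) = \sum_(j < m) c j * inner h (e j)].
Proof.
move=> kL2; elim: s => [|a s [m [e [eL2 eO ek]]]].
  by exists 0%N, (fun _ _ => 0); split=> // j; exact: L2_0.
have aL2 := kL2 a.
pose p x := \sum_(j < m) inner (k a) (e j) * e j x.
have pL2 : L2 p by exact: L2_sum.
pose r x := k a x - p x.
have rL2 : L2 r by exact: L2_B.
have re j : (j < m)%N -> inner r (e j) = 0.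
  move=> jm; rewrite innerB// (inner_sum _ (fun j : 'I_m => inner (k a) (e j)))//.
  rewrite (bigD1 (Ordinal jm))//= eO// eqxx mulr1 big1 ?addr0 ?subrr// => l lj.
  by rewrite eO// (_ : (l == j :> nat) = false) ?mulr0//; apply/negbTE.
have hr h : L2 h -> inner h (k a) =
    inner h r + \sum_(j < m) inner (k a) (e j) * inner h (e j).
  move=> hL2; rewrite (innerC h r) innerB//.
  rewrite (inner_sum _ (fun j : 'I_m => inner (k a) (e j)))//.
  under [X in _ = _ + X]eq_bigr => j _ do rewrite (innerC h).
  by rewrite subrK innerC.
have [rr0|rr0] := eqVneq (inner r r) 0.
  exists m, e; split=> // i; rewrite in_cons => /predU1P[->|]; last exact: ek.
  by exists (fun j => inner (k a) (e j)) => h hL2; rewrite hr// inner_null// add0r.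
have rr_gt0 : 0 < inner r r by rewrite lt_neqAle eq_sym rr0 inner_ge0.
pose v := Num.sqrt (inner r r).
have v0 : v != 0 by rewrite gt_eqF// sqrtr_gt0.
pose e' j := if j == m then (fun x => v^-1 * r x) else e j.
have e'm : e' m = (fun x => v^-1 * r x) by rewrite /e' eqxx.
have e'lt j : (j < m)%N -> e' j = e j by move=> jm; rewrite /e' ltn_eqF.
exists m.+1, e'; split=> //.
- by move=> j; rewrite /e'; case: eqP => // _; exact: L2_Z.
- have eme j : (j < m)%N -> inner (e' m) (e' j) = 0.
    by move=> jm; rewrite e'm e'lt// innerZ ?re ?mulr0.
  move=> i j; rewrite !ltnS (leq_eqVlt i) (leq_eqVlt j).
  move=> /predU1P[->|im] /predU1P[->|jm].
  + rewrite eqxx e'm innerZ//; last exact: L2_Z.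
    rewrite innerC innerZ// mulrA -expr2 exprVn sqr_sqrtr ?inner_ge0//.
    by rewrite mulVf.
  + by rewrite eme// gtn_eqF.
  + by rewrite innerC eme// ltn_eqF.
  + by rewrite !e'lt// eO.
- move=> i; rewrite in_cons => /predU1P[->|iN].
    exists (fun j => if j == m then v else inner (k a) (e j)) => h hL2.
    rewrite hr// big_ord_recr/= eqxx addrC; congr (_ + _).
      by rewrite e'm [in RHS]innerC innerZ// mulrA divff// mul1r innerC.
    by apply: eq_bigr => j _; rewrite ltn_eqF// e'lt.
  have [c hc] := ek _ iN.
  (* The vector of index m was appended after [c] was found, so [c] is cut off there. *)
  exists (fun j => if (j < m)%N then c j else 0) => h hL2.
  rewrite hc// big_ord_recr/= ltnn mul0r addr0.
  by apply: eq_bigr => j _; rewrite ltn_ord e'lt.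
Qed.

End L2_theory.

Section inner_cvg.
Context d (T : measurableType d) (R : realType).
Variables (mu : {measure set T -> \bar R}) (D : set T).
Hypothesis mD : measurable D.
Hypothesis muD : (mu D < +oo)%E.

(** Dominated by |f C|, which is integrable since constants are square integrable on a set of finite
    measure. *)
Lemma inner_cvg (f g : T -> R) (g_ : nat -> T -> R) (C : R) :
  L2 mu D f -> (forall k, measurable_fun D (g_ k)) -> measurable_fun D g ->
  (forall k x, D x -> `|g_ k x| <= C) ->
  (forall x, D x -> g_ ^~ x @ \oo --> g x) ->
  (fun k => inner mu D f (g_ k)) @ \oo --> inner mu D f g.
Proof.
move=> fL2 mg_ mg gC gcvg; have mf := L2_measurable mD fL2.
have CL2 : L2 mu D (fun=> C) by apply: (@bounded_L2 _ _ _ _ _ mD _ `|C|).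
have intfC : mu.-integrable D (EFin \o (fun x => `|f x * C|)).
  exact: integrable_norm (L2_mul_integrable mD fL2 CL2).
have [||||intfg _ cvg_int] := @dominated_convergence _ _ _ mu D mD
  (fun k x => (f x * g_ k x)%:E) (fun x => (f x * g x)%:E)
  (EFin \o (fun x => `|f x * C|)) _ _ _ intfC.
- by move=> k; apply/measurable_EFinP; exact: measurable_funM.
- by apply/measurable_EFinP; exact: measurable_funM.
- apply: aeW => x Dx; apply: cvg_EFin.
    by near=> k.
  by apply: cvgM; [exact: cvg_cst|exact: gcvg].
- apply: aeW => x k Dx; rewrite /= lee_fin !normrM ler_wpM2l//.
  by apply: (le_trans (gC _ _ Dx)); exact: ler_norm.
rewrite /inner /Rintegral; apply: fine_cvg.
by rewrite fineK//; apply: integrable_fin_num.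
Unshelve. all: by end_near.
Qed.

End inner_cvg.

(** * Regularity and translation invariance of Lebesgue measure *)

Section lebesgue_theory.
Context {R : realType} {n : nat}.
Local Notation Rn := 'rV[R]_n.+1.
Local Notation lam := (@lebesgue R n.+1).
Local Notation T := (caratheodory_type (@lebesgue_outer R n.+1)).

Lemma lebesgue_open (U : set Rn) : open U -> measurable (U : set T).
Proof. exact/caratheodory_open/lebesgue_halfspace. Qed.

Lemma lebesgue_closed (U : set Rn) : closed U -> measurable (U : set T).
Proof. exact/caratheodory_closed/lebesgue_halfspace. Qed.

Lemma lebesgue_continuous (f : Rn -> R) :
  continuous f -> measurable_fun [set: T] (f : T -> R).
Proof. exact/caratheodory_continuous/lebesgue_halfspace. Qed.

Lemma lebesgue_open_gt0 (U : set Rn) : open U -> U !=set0 -> (0 < lam U)%E.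
Proof.
move=> oU [x Ux]; have [e e0 eU] := near_box oU Ux.
apply: (@lt_le_trans _ _ (lebesgue_outer (box (x - const_mx e, x + const_mx e)))).
  apply: lt_le_trans (box_volume_le_outer _); last first.
    by move=> i; rewrite !mxE; lra.
  by rewrite lte_fin prodr_gt0// => i _; rewrite lt_max !mxE; apply/orP; right; lra.
exact: le_outer_measure.
Qed.

(** The volume depends continuously on the enlargement; this replaces the closed boxes of a cover by
    open ones at small cost. *)
Lemma box_volume_enlarge (ab : Rn * Rn) (e : R) : 0 < e ->
  exists2 t, 0 < t &
    (box_volume (ab.1 - const_mx t, ab.2 + const_mx t)%R <= box_volume ab + e%:E)%E.
Proof.
move=> e0.
pose f (i : 'I_n.+1) (t : R) := Num.max 0 (ab.2 ord0 i + t - (ab.1 ord0 i - t)).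
have cf i : continuous (f i).
  move=> t; apply: (@continuous_max _ _ (cst 0)
    (fun t => ab.2 ord0 i + t - (ab.1 ord0 i - t))); first exact: cst_continuous.
  apply: (@continuousB _ _ _ (fun t => ab.2 ord0 i + t) (fun t => ab.1 ord0 i - t)).
    by apply: (@continuousD _ _ _ (cst _) id) => //; exact: cst_continuous.
  by apply: (@continuousB _ _ _ (cst _) id) => //; exact: cst_continuous.
have := @continuous_prod R R _ (index_enum 'I_n.+1) f cf 0.
move=> /cvgrPdist_le /(_ _ e0) /nbhs_ballP[t /= t0 tP].
exists (t / 2); first by rewrite divr_gt0.
have /tP : ball (0 : R) t (t / 2).
  by rewrite /ball/= sub0r normrN gtr0_norm ?divr_gt0// gtr_pMr// invf_lt1// ltr1n.
rewrite /= ler_distlC => /andP[_ H].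
rewrite /box_volume -EFinD lee_fin.
have -> : \prod_(i < n.+1) Num.max 0 (ab.2 ord0 i - ab.1 ord0 i) = \prod_i f i 0.
  by apply: eq_bigr => i _; rewrite /f addr0 subr0.
apply: le_trans H; rewrite le_eqVlt; apply/orP; left; apply/eqP.
by apply: eq_bigr => i _; rewrite /f !mxE.
Qed.

Lemma lebesgue_outer_regular (A : set Rn) (e : R) :
  (lebesgue_outer A < +oo)%E -> 0 < e ->
  exists U : set Rn, [/\ open U, A `<=` U &
    (lebesgue_outer U <= lebesgue_outer A + e%:E)%E].
Proof.
move=> Afin e0.
(* Half of e pays for a nearly optimal cover; the other half, split geometrically, pays for opening
   its boxes. *)
have e20 : 0 < e / 2 by rewrite divr_gt0.
have fA : lebesgue_outer A \is a fin_num by rewrite ge0_fin_numE ?outer_measure_ge0.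
have [_ [F [_ AF] <-] Fe] := lb_ereal_inf_adherent e20 fA.
have vol0 ab : (0 <= @box_volume R n.+1 ab)%E by exact: box_volume_ge0.
have /choice[t tP] : forall k, exists t : R, 0 < t /\ forall ab, F k = Some ab ->
    (box_volume (ab.1 - const_mx t, ab.2 + const_mx t)%R <=
     box_volume ab + (e / 2 / (2 ^ k.+1)%:R)%:E)%E.
  move=> k; case: (F k) => [ab|]; last by exists 1; split.
  have [|t t0 tP] := @box_volume_enlarge ab (e / 2 / (2 ^ k.+1)%:R).
    by rewrite divr_gt0// ltr0n expn_gt0.
  by exists t; split=> // _ [<-].
pose G k := omap (fun ab : Rn * Rn => (ab.1 - const_mx (t k), ab.2 + const_mx (t k))) (F k).
exists (\bigcup_k (if G k is Some ab then obox ab else set0)); split.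
- by apply: bigcup_open => k _; case: (G k) => [ab|]; [exact: open_obox|exact: open0].
- move=> x Ax; have [k _ /=] := AF _ Ax; case Fk : (F k) => [ab|//] abx.
  exists k => //; rewrite /G Fk/= => i; rewrite !mxE.
  by have /andP[h1 h2] := abx i; have [h3 _] := tP k; apply/andP; split; lra.
apply: (@le_trans _ _ (\sum_(k <oo) (weight (@box_volume R n.+1) (F k) +
    (e / 2 / (2 ^ k.+1)%:R)%:E))%E).
  apply: (@le_trans _ _ (\sum_(k <oo) weight (@box_volume R n.+1) (G k))%E).
    apply: ereal_inf_lbound; exists G => //; split=> // x [k _ xk].
    by exists k => //; move: xk; case: (G k) => // ab; exact: obox_sub_box.
  apply: lee_nneseries => k _; first by rewrite weight_ge0.
  have [_] := tP k; rewrite /G; case: (F k) => [ab /(_ _ erefl)//|_ /=].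
  by rewrite add0e lee_fin divr_ge0 ?ltW.
apply: (le_trans (epsilon_trick _ _ _)).
- by move=> k; rewrite weight_ge0.
- exact: ltW.
have -> : (e%:E = (e / 2)%:E + (e / 2)%:E)%E by rewrite -EFinD -splitr.
by rewrite addeA leeD2r// ltW.
Qed.

Lemma lebesgue_translate_measurable (h : Rn) :
  measurable_fun [set: T] (fun x : T => ((x : Rn) + h : T)).
Proof.
by move=> _ A mA; rewrite setTI; exact: caratheodory_translate.
Qed.

Lemma Rintegral_translate (h : Rn) (f : Rn -> R) :
  measurable_fun [set: T] (f : T -> R) ->
  lam.-integrable [set: T] (EFin \o (fun x => f (x + h))) ->
  Rintegral lam [set: T] (fun x => f (x + h)) = Rintegral lam [set: T] f.
Proof.
move=> mf intfh; rewrite /Rintegral; congr fine.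
pose sh : T -> T := fun x => (x : Rn) + h.
transitivity (\int[pushforward lam sh]_x (f x)%:E)%E.
  rewrite (integral_pushforward (lebesgue_translate_measurable h))//.
  exact/measurable_EFinP.
apply: eq_measure_integral; first exact: lebesgue_translate_measurable.
by move=> msh A mA _; exact: lebesgue_outer_translate.
Qed.

End lebesgue_theory.

(** * Test functions *)

Section bump_profile.
Context {R : realType}.
Implicit Types (m : nat) (y h : R).

(* The derivatives of [expR (- y^-1)] stay in the span of this family. *)
Definition bump m y : R := if 0 < y then y^-1 ^+ m * expR (- y^-1) else 0.

Lemma bump_le0 m y : y <= 0 -> bump m y = 0.
Proof. by rewrite /bump leNgt => /negPf ->. Qed.

Lemma bump_ge0 m y : 0 <= bump m y.
Proof.
rewrite /bump; case: ifP => // y0.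
by rewrite mulr_ge0 ?expR_ge0// exprn_ge0// invr_ge0 ltW.
Qed.

Lemma bump0_gt0 y : 0 < y -> 0 < bump 0 y.
Proof. by move=> y0; rewrite /bump y0 expr0 mul1r expR_gt0. Qed.

Lemma bump0_le1 y : bump 0 y <= 1.
Proof.
rewrite /bump; case: ifP => // y0; rewrite expr0 mul1r -expR0 ler_expR.
by rewrite oppr_le0 invr_ge0 ltW.
Qed.

(** For z = 1/y the exponential series gives exp z >= z^(m+2)/(m+2)!. The two extra powers leave the
    factor y^2, which makes the difference quotient at 0 vanish. *)
Lemma bump_le_sqr m y : bump m y <= (m.+2)`!%:R * y ^+ 2.
Proof.
rewrite /bump; case: ifP => y0; last by rewrite mulr_ge0 ?sqr_ge0.
have z0 : 0 <= y^-1 by rewrite invr_ge0 ltW.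
have := expR_ge1Dxn m.+1 z0.
set F : R := (m.+2)`!%:R; have F0 : 0 < F by rewrite ltr0n fact_gt0.
move=> H; have {}H : y^-1 ^+ m.+2 <= F * expR y^-1.
  by rewrite mulrC -ler_pdivrMr// (le_trans _ H)// lerDr.
rewrite expRN ler_pdivrMr ?expR_gt0//.
have -> : y^-1 ^+ m = y^-1 ^+ m.+2 * y ^+ 2.
  by rewrite -addn2 exprD -mulrA -exprMn mulVf ?gt_eqF// expr1n mulr1.
by rewrite [leRHS]mulrAC ler_wpM2r ?sqr_ge0.
Qed.

Lemma is_derive_bump m y :
  is_derive y 1 (bump m) (bump m.+2 y - m%:R * bump m.+1 y).
Proof.
case: (ltgtP y 0) => [y0|y0|->].
- rewrite !bump_le0 ?ltW// mulr0 subr0.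
  apply: (@near_eq_is_derive _ _ _ (cst 0)).
  near=> z; rewrite bump_le0// ltW//; near: z; exact: lt_nbhsl.
- have yn0 : y != 0 by rewrite gt_eqF.
  have dV : is_derive y 1 (fun z : R => z^-1) (- y ^- 2).
    by apply: is_derive_eq; [exact: (@is_deriveV _ id)|rewrite [LHS]mulr1].
  have dE : is_derive y 1 (fun z : R => expR (- z^-1)) (expR (- y^-1) * y ^- 2).
    rewrite -[y ^- 2]opprK.
    exact: (@is_derive1_comp _ expR (fun z => - z^-1) _ _ _ _ (is_deriveN dV)).
  have := is_deriveM (is_deriveX m dV) dE; rewrite exprfctE => dM.
  apply: (@near_eq_is_derive _ _ _ ((fun z : R => z^-1 ^+ m) * (fun z => expR (- z^-1)))).
    by near=> z; have z0 : 0 < z by [near: z; exact: lt_nbhsr]; rewrite /bump z0.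
  apply: is_derive_eq; rewrite /bump y0 /GRing.scale/=.
  case: m {dM} => [|m]; rewrite ?exprS /=; move: (expR _) => E; rewrite ?expr0; by field.
- have c0 : h^-1 *: ((bump m \o shift 0) (h *: 1) - bump m 0) @[h --> 0^'] --> (0 : R).
    rewrite bump_le0//; pose K : R := (m.+2)`!%:R.
    have K0 : 0 < K by rewrite ltr0n fact_gt0.
    apply/cvgr0Pnorm_lt => e e0.
    near=> h; rewrite /= subr0 addr0 [h *: 1]mulr1 [_ *: _]/(_ * _).
    have h0 : h != 0 by near: h; exact: nbhs_dnbhs_neq.
    rewrite normrM normfV mulrC ltr_pdivrMr ?normr_gt0// ger0_norm ?bump_ge0//.
    apply: (le_lt_trans (bump_le_sqr _ _)).
    rewrite -real_normK ?num_real// expr2 mulrA ltr_pM2r ?normr_gt0//.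
    rewrite mulrC -ltr_pdivlMr//.
    by near: h; apply: dnbhs0_lt; rewrite divr_gt0.
  rewrite !bump_le0// mulr0 subr0; apply: DeriveDef.
    by apply/cvg_ex; exists 0.
  exact: cvg_lim c0.
Unshelve. all: by end_near.
Qed.

End bump_profile.

Section bump_algebra.
Context {R : realType} {n : nat}.
Local Notation Rn := 'rV[R]_n.

(** This class is closed under partial derivatives, so smoothness, a statement about all iterated
    partials, reduces to differentiability of its members. Atoms carry an affine map of one
    coordinate so that either side of a box can be described. *)
Inductive bump_alg : (Rn -> R) -> Prop :=
| bump_alg_cst c : bump_alg (fun=> c)
| bump_alg_atom m j a b : bump_alg (fun x => bump m (a * x ord0 j + b))
| bump_alg_add f g : bump_alg f -> bump_alg g -> bump_alg (f + g)
| bump_alg_mul f g : bump_alg f -> bump_alg g -> bump_alg (f * g).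

Lemma bump_alg_differentiable f : bump_alg f -> forall x, differentiable f x.
Proof.
elim=> {f} [c|m j a b|f g _ df _ dg|f g _ df _ dg] x.
- exact: differentiable_cst.
- apply: (@differentiable_comp _ _ _ _ (fun x : Rn => a * x ord0 j + b) (bump m)).
    apply: differentiableD; last exact: differentiable_cst.
    apply: (@differentiableZ _ _ _ (fun x : Rn => x ord0 j : R) a).
    exact: differentiable_coord.
  apply/derivable1_diffP; have := is_derive_bump m (a * x ord0 j + b).
  by move=> [].
- exact: differentiableD.
- exact: differentiableM.
Qed.

Lemma bump_alg_opp f : bump_alg f -> bump_alg (fun x => - f x).
Proof.
move=> bf; rewrite (_ : (fun _ => _) = (fun=> -1) * f).
  by apply: bump_alg_mul => //; exact: bump_alg_cst.
by apply/funext => x; rewrite fctE mulN1r.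
Qed.

Lemma bump_alg_prod (I : Type) (s : seq I) (f : I -> Rn -> R) :
  (forall k, bump_alg (f k)) -> bump_alg (fun x => \prod_(k <- s) f k x).
Proof.
move=> bf; elim: s => [|i s IH].
  rewrite (_ : (fun _ => _) = (fun=> 1)); first exact: bump_alg_cst.
  by apply/funext => x; rewrite big_nil.
rewrite (_ : (fun _ => _) = f i * (fun x => \prod_(k <- s) f k x)).
  exact: bump_alg_mul.
by apply/funext => x; rewrite big_cons.
Qed.

Lemma bump_alg_exp (f : Rn -> R) m : bump_alg f -> bump_alg (fun x => f x ^+ m).
Proof.
move=> bf; elim: m => [|m IH]; first exact: bump_alg_cst.
rewrite (_ : (fun _ => _) = f * (fun x => f x ^+ m)); first exact: bump_alg_mul.
by apply/funext => x; rewrite exprS.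
Qed.

Lemma bump_alg_onem (f : Rn -> R) : bump_alg f -> bump_alg (fun x => 1 - f x).
Proof.
move=> bf; rewrite (_ : (fun _ => _) = (fun=> 1) + (fun x => - f x))//.
by apply: bump_alg_add; [exact: bump_alg_cst|exact: bump_alg_opp].
Qed.

Lemma bump_alg_partial i f : bump_alg f -> bump_alg (partial i f).
Proof.
elim=> {f} [c|m j a b|f g bf df bg dg|f g bf df bg dg].
- rewrite (_ : partial i _ = fun=> 0); first exact: bump_alg_cst.
  by apply/funext => x; rewrite /partial derive_cst.
- pose l (x : Rn) : R := a * x ord0 j + b.
  have dl x : differentiable l x.
    apply: differentiableD; last exact: differentiable_cst.
    apply: (@differentiableZ _ _ _ (fun x : Rn => x ord0 j : R) a).
    exact: differentiable_coord.
  (* The derivative of the inner affine map in direction i: [a] if i = j, and 0 otherwise. *)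
  pose c : R := a * (delta_mx ord0 i : Rn) ord0 j.
  have cE x : 'd l x (delta_mx ord0 i) = c.
    rewrite -deriveE//; apply: cvg_lim => //.
    apply: (@cvg_near_cst _ _ _ _ _ (dnbhs_filter _)).
    near=> h; rewrite /= /l !mxE; have h0 : h != 0 by near: h; exact: nbhs_dnbhs_neq.
    by rewrite /c mxE /GRing.scale/=; field.
  rewrite (_ : partial i _ = (fun=> c) * ((fun x => bump m.+2 (a * x ord0 j + b)) +
     (fun=> - m%:R) * (fun x => bump m.+1 (a * x ord0 j + b)))).
    by repeat constructor.
  apply/funext => x; rewrite /partial.
  have [bdx bE] := is_derive_bump m (l x).
  have bdif : differentiable (bump m) (l x) by exact/derivable1_diffP.
  rewrite deriveE; last exact: (@differentiable_comp _ _ _ _ l (bump m)).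
  rewrite (@diff_comp _ _ _ _ l (bump m))//= cE.
  have -> : 'd (bump m) (l x) c = c *: 'd (bump m) (l x) 1.
    by rewrite -[in LHS](mulr1 c) -[c * 1]/(c *: 1) linearZ.
  by rewrite -deriveE// bE !fctE /l mulNr.
- rewrite (_ : partial i _ = partial i f + partial i g).
    exact: bump_alg_add.
  apply/funext => x; rewrite /partial deriveD//; apply: diff_derivable;
    exact: bump_alg_differentiable.
- rewrite (_ : partial i _ = f * partial i g + g * partial i f).
    by apply: bump_alg_add; exact: bump_alg_mul.
  apply/funext => x; rewrite /partial deriveM//; apply: diff_derivable;
    exact: bump_alg_differentiable.
Unshelve. all: by end_near.
Qed.

Lemma bump_alg_smooth f : bump_alg f -> smooth f.
Proof.
move=> bf s; have bs : bump_alg (partials s f).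
  by elim: s => //= i s IH; exact: bump_alg_partial.
split=> [x|i x].
  exact/differentiable_continuous/bump_alg_differentiable.
exact/diff_derivable/bump_alg_differentiable.
Qed.

End bump_algebra.

Lemma measurable_test_function {R : realType} {n : nat} (Omega : set 'rV[R]_n.+1)
    phi (D : set (caratheodory_type (@lebesgue_outer R n.+1))) :
  test_function Omega phi -> measurable_fun D phi.
Proof.
move=> [sphi _]; apply: measurable_funTS; apply: lebesgue_continuous.
exact: (sphi [::]).1.
Qed.

Section box_bumps.
Context {R : realType} {n : nat}.
Local Notation Rn := 'rV[R]_n.+1.

(** One factor per wall of the box. The redundant [1 *] and [+ -] give each factor the literal shape
    of an atom of [bump_alg]. *)
Definition box_bump (ab : Rn * Rn) (x : Rn) : R :=
  \prod_(i < n.+1) (bump 0 (1 * x ord0 i + - ab.1 ord0 i) *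
                    bump 0 (-1 * x ord0 i + ab.2 ord0 i)).

Lemma box_bump_alg ab : bump_alg (box_bump ab).
Proof.
apply: bump_alg_prod => i.
by apply: (@bump_alg_mul _ _ (fun x : Rn => bump 0 _) (fun x : Rn => bump 0 _));
  exact: bump_alg_atom.
Qed.

Lemma box_bump_itv ab x : 0 <= box_bump ab x <= 1.
Proof.
apply/andP; split; first by apply: prodr_ge0 => i _; rewrite mulr_ge0 ?bump_ge0.
apply: prodr_ile1 => i _; rewrite mulr_ge0 ?bump_ge0//=.
by rewrite mulr_ile1 ?bump_ge0 ?bump0_le1.
Qed.

Lemma box_bump_gt0 ab x : obox ab x -> 0 < box_bump ab x.
Proof.
move=> xab; apply: prodr_gt0 => i _; have /andP[h1 h2] := xab i.
by rewrite mulr_gt0// bump0_gt0//; lra.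
Qed.

Lemma box_bump_eq0 ab x : ~ box ab x -> box_bump ab x = 0.
Proof.
move=> xab; apply/eqP; apply: contraT => /prodf_neq0 H; exfalso.
apply: xab => i; have := H i isT; rewrite mulf_eq0 negb_or => /andP[h1 h2].
apply/andP; split; rewrite leNgt.
  by apply: contra h1 => h; rewrite bump_le0//; lra.
by apply: contra h2 => h; rewrite bump_le0//; lra.
Qed.

(** With U a union of open boxes, the m-th function is 1 minus the product over k < m of (1 -
    bump_k)^m: finitely many boxes keep the support compact, and the growing exponent drives the
    product to 0 at each point of U. *)
Lemma test_functions_approximate_open (U : set Rn) : open U ->
  exists w : nat -> Rn -> R,
    [/\ forall m, test_function U (w m),
        forall m x, 0 <= w m x <= 1 &
        forall x, U x -> w ^~ x @ \oo --> (1 : R)].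
Proof.
move=> /open_bigcup_boxes[ab [abU Uab]].
pose p (m : nat) (x : Rn) := \prod_(k <- iota 0 m) (1 - box_bump (ab k) x) ^+ m.
have factor_itv m k x : 0 <= (1 - box_bump (ab k) x) ^+ m <= 1.
  have /andP[h1 h2] := box_bump_itv (ab k) x.
  by rewrite exprn_ge0 ?subr_ge0//= exprn_ile1 ?subr_ge0// lerBlDr lerDl.
exists (fun m x => 1 - p m x); split.
- move=> m; split.
    apply/bump_alg_smooth/bump_alg_onem/bump_alg_prod => k.
    exact/bump_alg_exp/bump_alg_onem/box_bump_alg.
  exists (\big[setU/set0]_(k <- iota 0 m) box (ab k)); split.
  + by elim/big_ind : _ => [|A B cA cB|k _]; [exact: compact0|exact: compactU|
      exact: compact_box].
  + by elim/big_ind : _ => [//|A B AU BU|k _]; [rewrite subUset|exact: abU].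
  + move=> x; rewrite /p; elim: iota => [|k s IH]; first by rewrite !big_nil subrr.
    rewrite !big_cons => /not_orP[nk /IH]; rewrite (box_bump_eq0 nk) subr0 expr1n.
    by rewrite mul1r.
- move=> m x; rewrite subr_ge0 lerBlDr lerDl.
  by rewrite prodr_ge0 ?prodr_ile1// => k _; have /andP[] := factor_itv m k x.
- move=> x Ux; have := Ux; rewrite {1}Uab => -[k _ xk].
  set t := 1 - box_bump (ab k) x.
  have /andP[b0 b1] := box_bump_itv (ab k) x; have bgt := box_bump_gt0 xk.
  have t0 : 0 <= t by rewrite subr_ge0.
  have t1 : `|t| < 1 by rewrite ger0_norm// ltrBlDr ltrDl.
  have /cvgrPdist_lt tcvg := cvg_expr t1.
  apply/cvgrPdist_lt => e /tcvg te; near=> m.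
  rewrite opprB addrC subrK ger0_norm; last first.
    by rewrite prodr_ge0// => j _; have /andP[] := factor_itv m j x.
  (* All factors lie between 0 and 1, so the k-th alone bounds the product. *)
  apply: (@le_lt_trans _ _ (t ^+ m)); last first.
    have : `|0 - t ^+ m| < e by near: m.
    by rewrite sub0r normrN; apply: le_lt_trans; exact: ler_norm.
  have km : (k < m)%N by near: m; exact: nbhs_infty_gt.
  rewrite /p (bigD1_seq k)/= ?iota_uniq ?mem_iota//.
  rewrite ler_piMr ?exprn_ge0// prodr_ile1// => j _; exact: factor_itv.
Unshelve. all: by end_near.
Qed.

End box_bumps.

(** * The fundamental lemma of the calculus of variations *)

Lemma amgm_weighted {R : realFieldType} (s x y : R) : 0 < s ->
  `|x * y| <= s * (y * y) + s^-1 * (x * x).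
Proof.
move=> s0; rewrite -(ler_pM2l s0) mulrDr !mulrA divff ?gt_eqF// mul1r.
rewrite -{1}(gtr0_norm s0) -normrM ler_norml.
by apply/andP; split; have := sqr_ge0 (s * y - x); have := sqr_ge0 (s * y);
  have := sqr_ge0 x; have := sqr_ge0 (s * y + x); nra.
Qed.

Section fundamental_lemma.
Context {R : realType} {n : nat}.
Local Notation Rn := 'rV[R]_n.+1.
Local Notation lam := (@lebesgue R n.+1).
Local Notation T := (caratheodory_type (@lebesgue_outer R n.+1)).
Variable Omega : set Rn.
Hypotheses (oOmega : open Omega) (bOmega : bounded_set Omega).

Lemma lebesgue_bounded_lty : (lam Omega < +oo)%E.
Proof. exact: lebesgue_outer_bounded. Qed.

Variable f : Rn -> R.
Hypothesis fL2 : L2 lam Omega f.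
Hypothesis f_orth : forall phi, test_function Omega phi -> inner lam Omega f phi = 0.

Let mOmega : measurable (Omega : set T) := lebesgue_open oOmega.

Let indic_L2 (A : set T) : measurable A -> L2 lam Omega (\1_A : Rn -> R).
Proof.
move=> mA; apply: (@bounded_L2 _ _ _ _ _ mOmega _ 1).
- exact: lebesgue_bounded_lty.
- exact: measurable_indic.
- by move=> x _; rewrite indicE normr_nat; case: (_ \in _); rewrite ?ler01.
Qed.

Let inner_open (U : set Rn) : open U -> U `<=` Omega ->
  inner lam Omega f (\1_U : Rn -> R) = 0.
Proof.
move=> oU UO; have [w [wtest w01 wcvg]] := test_functions_approximate_open oU.
have wO m : test_function Omega (w m).
  have [ws [K [cK KU wK]]] := wtest m; split=> //; exists K; split=> //.
  exact: subset_trans UO.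
have U_cvg x : Omega x -> w ^~ x @ \oo --> (\1_U x : R).
  move=> Ox; rewrite indicE; have [Ux|nUx] := pselect (U x).
    by rewrite mem_set//; exact: wcvg.
  rewrite memNset//= (_ : w ^~ x = cst 0); first exact: cvg_cst.
  apply/funext => m; have [_ [K [_ KU wK]]] := wtest m.
  by apply: wK => /KU.
have m1U : measurable_fun (Omega : set T) (\1_U : T -> R).
  by apply: measurable_indic; exact: lebesgue_open.
have := inner_cvg mOmega lebesgue_bounded_lty fL2
  (fun m => measurable_test_function (wO m)) _ _ U_cvg.
move=> /(_ 1 m1U) H.
have {}H : (fun k => inner lam Omega f (w k)) @ \oo --> inner lam Omega f (\1_U : Rn -> R).
  by apply: H => m x _; have /andP[w0 w1] := w01 m x; rewrite ger0_norm.
rewrite (_ : (fun k => _) = cst 0) in H; last by apply/funext => k; rewrite f_orth.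
exact: cvg_unique H (cvg_cst 0).
Qed.

(** By outer regularity A lies in an open subset U of Omega with U minus A = E of measure at most
    s^2. As f is orthogonal to the indicator of U, only E remains, and [amgm_weighted] bounds its
    contribution by s (f,f) + s^-1 s^2, which is of order s. *)
Let inner_measurable (A : set T) : measurable A -> A `<=` Omega ->
  inner lam Omega f (\1_A : Rn -> R) = 0.
Proof.
move=> mA AO.
suff bound s : 0 < s ->
    `|inner lam Omega f (\1_A : Rn -> R)| <= s * (inner lam Omega f f + 1).
  apply/eqP; rewrite -normr_le0; apply/ler_addgt0Pl => e e0; rewrite addr0.
  have c0 : 0 < inner lam Omega f f + 1 by rewrite ltr_pwDr// inner_ge0.
  have := bound (e / (inner lam Omega f f + 1)).
  by rewrite divfK ?gt_eqF//; apply; rewrite divr_gt0.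
move=> s0.
have Afin : (lam A < +oo)%E.
  by apply: le_lt_trans lebesgue_bounded_lty; apply: le_outer_measure.
have [U0 [oU0 AU0 U0A]] := lebesgue_outer_regular Afin (exprn_gt0 2 s0).
pose U := U0 `&` Omega.
have oU : open U by exact: openI.
have UO : U `<=` Omega by move=> x [].
have AU : A `<=` U by move=> x Ax; split; [exact: AU0|exact: AO].
have mU : measurable (U : set T) by exact: lebesgue_open.
pose E : set T := U `\` A.
have mE : measurable E by exact: measurableD.
have lamE : (lam E <= (s ^+ 2)%:E)%E.
  have lamU : (lam U = lam A + lam E)%E.
    rewrite -measureU//; last by rewrite /E setDE setICA setICr setI0.
    by congr (lam _); rewrite /E setDE setUIr setUv setIT; apply/esym/setUidPr.
  have lamUle : (lam U <= lam A + (s ^+ 2)%:E)%E.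
    by apply: le_trans U0A; apply: le_outer_measure => x [].
  move: lamUle; rewrite lamU leeD2lE// ge0_fin_numE//.
have split_indic : {in Omega, (\1_U : Rn -> R) =1 (fun x => 1 * \1_A x + \1_E x)}.
  move=> x _; rewrite !indicE mul1r; have [Ax|nAx] := pselect (A x).
    rewrite (mem_set Ax) (mem_set (AU _ Ax)) (memNset (A := E)) ?addr0//.
    by case.
  rewrite (memNset nAx) add0r; have [Ux|nUx] := pselect (U x).
    by rewrite !mem_set.
  by rewrite !memNset// => -[].
have := inner_open oU UO.
have -> : inner lam Omega f (\1_U : Rn -> R) =
    inner lam Omega (fun x => 1 * (\1_A : Rn -> R) x + (\1_E : Rn -> R) x) f.
  by rewrite innerC; exact: eq_inner.
rewrite (inner_lin mOmega 1 (indic_L2 mA) (indic_L2 mE) fL2).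
rewrite mul1r innerC => /eqP; rewrite addr_eq0 => /eqP ->; rewrite normrN.
have intfE := L2_mul_integrable mOmega (indic_L2 mE) fL2.
apply: (le_trans (le_normr_Rintegral mOmega intfE)).
have intff := L2_mul_integrable mOmega fL2 fL2.
have intEE := L2_mul_integrable mOmega (indic_L2 mE) (indic_L2 mE).
have EE : inner lam Omega (\1_E : Rn -> R) (\1_E : Rn -> R) <= s ^+ 2.
  have -> : inner lam Omega (\1_E : Rn -> R) (\1_E : Rn -> R) =
      Rintegral lam Omega (\1_E : T -> R).
    apply: eq_Rintegral => x _.
    by rewrite indicE; case: (_ \in _); rewrite ?mulr1 ?mulr0.
  rewrite /Rintegral integral_indic// (_ : E `&` Omega = E); last first.
    by apply/setIidPl => x [] /UO.
  rewrite -lee_fin fineK//; rewrite ge0_fin_numE//.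
  by apply: le_lt_trans lamE _; rewrite ltry.
apply: (@le_trans _ _ (s * inner lam Omega f f + s^-1 * s ^+ 2)); last first.
  by rewrite mulrDr mulr1 lerD2l expr2 mulKf ?gt_eqF.
apply: (@le_trans _ _ (s * inner lam Omega f f + s^-1 *
    inner lam Omega (\1_E : Rn -> R) (\1_E : Rn -> R))); last first.
  by rewrite lerD2l ler_wpM2l// invr_ge0 ltW.
rewrite /inner -!RintegralZl// -RintegralD//; last 2 first.
- exact: (integrableZl mOmega s intff).
- exact: (integrableZl mOmega s^-1 intEE).
apply: le_Rintegral => //.
- exact: integrable_norm.
- exact: (integrableD mOmega (integrableZl mOmega s intff) (integrableZl mOmega s^-1 intEE)).
move=> x _; exact: amgm_weighted.
Qed.

(** The integrals of f over all measurable subsets vanish, so f = 0 almost everywhere. The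
    conclusion is phrased in the form that [inner_null] takes. *)
Lemma fundamental_lemma : inner lam Omega f f = 0.
Proof.
have intf : lam.-integrable Omega (EFin \o f).
  have := L2_mul_integrable mOmega fL2 (indic_L2 measurableT).
  by apply: eq_integrable => // x _; rewrite /= indicE in_setT mulr1.
have mf := L2_measurable mOmega fL2.
have f0 : ae_eq lam Omega (EFin \o f) (cst 0%E).
  apply: integral_ae_eq => // A AO mA; rewrite integral0.
  have intfA : lam.-integrable A (EFin \o f) by exact: integrableS AO intf.
  rewrite -[LHS]fineK ?integrable_fin_num//; congr EFin.
  rewrite -(inner_measurable mA AO) /inner.
  transitivity (Rintegral lam Omega ((f : T -> R) \_ A)); last first.
    apply: eq_Rintegral => x _.
    by rewrite indicE; case: (x \in A); rewrite ?mulr1 ?mulr0.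
  by rewrite -Rintegral_mkcondr (_ : Omega `&` A = A)//; exact/setIidPr.
rewrite /inner /Rintegral (ae_eq_integral (cst 0%E)) ?integral0//.
  by apply/measurable_EFinP; exact: measurable_funM.
by apply: filterS f0 => x H Ox; move: (H Ox) => /= [->]; rewrite mulr0.
Qed.

End fundamental_lemma.

(** * Hausdorff measure *)

Section enorm_theory.
Context {R : realType} {n : nat}.
Local Notation Rn := 'rV[R]_n.
Implicit Types x y : Rn.

Lemma sum_sqr_le_sqr_sum (I : Type) (s : seq I) (z : I -> R) :
  \sum_(i <- s) z i ^+ 2 <= (\sum_(i <- s) `|z i|) ^+ 2.
Proof.
elim: s => [|i s IH]; first by rewrite !big_nil expr0n.
rewrite !big_cons sqrrD real_normK ?num_real// -addrA lerD2l.
apply: (le_trans IH); rewrite lerDr mulrn_wge0// mulr_ge0//.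
exact: sumr_ge0.
Qed.

Lemma enorm_le_sum x : enorm x <= \sum_i `|x ord0 i|.
Proof.
rewrite /enorm -[leRHS]ger0_norm; last exact: sumr_ge0.
by rewrite -sqrtr_sqr ler_wsqrtr// sum_sqr_le_sqr_sum.
Qed.

Lemma le_coord_enorm x i : `|x ord0 i| <= enorm x.
Proof.
rewrite /enorm -sqrtr_sqr ler_wsqrtr// (bigD1 i)//= lerDl.
by apply: sumr_ge0 => j _; exact: sqr_ge0.
Qed.

End enorm_theory.

(** * Half-spaces are measurable for Hausdorff measure *)

Section hausdorff_metric.
Context {R : realType} {n k : nat}.
Local Notation Rn := 'rV[R]_n.
Local Open Scope ereal_scope.
Local Notation H := (@hausdorff_outer R n k).
Local Notation Hd := (@hausdorff_delta R n k).
Local Notation wt := (weight (@hausdorff_weight R n k)).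

Let leH A B : A `<=` B -> H A <= H B := @le_hausdorff_outer R n k A B.

Let wt_ge0 o : 0 <= wt o.
Proof. by apply: weight_ge0; exact: hausdorff_weight_ge0. Qed.

Lemma hausdorff_delta_antitone d1 d2 A : (d1 <= d2)%R -> Hd d2 A <= Hd d1 A.
Proof.
move=> d12; apply: le_ereal_inf_tmp => _ [F [CF AF] <-].
apply: ereal_inf_lbound; exists F => //; split=> // l B /CF HB x y Bx By.
exact: le_trans (HB _ _ Bx By) d12.
Qed.

(** A covering set of diameter at most d < t cannot meet both A and B, so selecting from a cover of
    the union the sets that meet A, or those that meet B, uses no set twice. *)
Lemma hausdorff_delta_separated (d t : R) (A B : set Rn) : (d < t)%R ->
  (forall x y, A x -> B y -> (t <= enorm (x - y))%R) ->
  Hd d A + Hd d B <= Hd d (A `|` B).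
Proof.
move=> dt AB; apply: le_ereal_inf_tmp => _ [F [CF ABF] <-].
pose sel (S : set Rn) l := if `[< piece id (F l) `&` S !=set0 >] then F l else None.
have selC (S : set Rn) : S `<=` \bigcup_l piece id (F l) ->
    Hd d S <= \sum_(l <oo) wt (sel S l).
  move=> SF; apply: ereal_inf_lbound; exists (sel S) => //; split.
    by move=> l D; rewrite /sel; case: asboolP => // _; exact: CF.
  move=> x Sx; have [l _ xl] := SF _ Sx; exists l => //.
  by rewrite /sel; case: asboolP => // -[]; exists x.
apply: (@le_trans _ _ (\sum_(l <oo) (wt (sel A l) + wt (sel B l)))).
  rewrite nneseriesD//; apply: leeD; apply: selC; apply: subset_trans ABF.
    exact: subsetUl.
  exact: subsetUr.
apply: lee_nneseries => l _; first by rewrite adde_ge0.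
rewrite /sel; case: asboolP => [[x [xF Ax]]|_]; last first.
  by case: asboolP => _; rewrite /= ?add0e ?adde0 ?wt_ge0.
case: asboolP => [[y [yF By]]|_]; last by rewrite /= adde0.
exfalso; case Fl : (F l) xF yF => [D|//]/= xD yD.
have := CF _ _ Fl x y xD yD; rewrite leNgt => /negP; apply.
exact: lt_le_trans dt (AB _ _ Ax By).
Qed.

Lemma hausdorff_separated (t : R) (A B : set Rn) : (0 < t)%R ->
  (forall x y, A x -> B y -> (t <= enorm (x - y))%R) ->
  H A + H B <= H (A `|` B).
Proof.
move=> t0 AB; have [->|Hoo] := eqVneq (H (A `|` B)) +oo; first by rewrite leey.
have fin S : S `<=` A `|` B -> H S \is a fin_num.
  move=> SAB; rewrite ge0_fin_numE ?hausdorff_outer_ge0//.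
  by apply: le_lt_trans (leH SAB) _; rewrite ltey.
have Hd_fin d S : (0 < d)%R -> S `<=` A `|` B -> Hd d S \is a fin_num.
  move=> d0 SAB; rewrite ge0_fin_numE; last first.
    exact: cover_measure_ge0 _ _ (@hausdorff_weight_ge0 R n k) _.
  apply: (@le_lt_trans _ _ (H S)); first by apply: ereal_sup_ubound; exists d.
  by have := fin _ SAB; rewrite ge0_fin_numE ?hausdorff_outer_ge0.
have finA := fin A (@subsetUl _ A B); have finB := fin B (@subsetUr _ A B).
rewrite -leeBrDr//; apply: ge_ereal_sup => _ [d1 d10 <-].
have fd1 := Hd_fin _ _ d10 (@subsetUl _ A B).
rewrite leeBrDr// -leeBrDl//; apply: ge_ereal_sup => _ [d2 d20 <-].
rewrite leeBrDl//.
(* The suprema for A and B are approached at different scales d1 and d2; a common smaller scale,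
   below the distance t, dominates both. *)
pose d := Num.min (Num.min d1 d2) (t / 2)%R.
have d0 : (0 < d)%R by rewrite !lt_min d10 d20 divr_gt0.
apply: (@le_trans _ _ (Hd d A + Hd d B)).
  by apply: leeD; apply: hausdorff_delta_antitone; rewrite !ge_min lexx ?orbT.
apply: (@le_trans _ _ (Hd d (A `|` B))).
  apply: (@hausdorff_delta_separated d t) => //.
  by rewrite gt_min; apply/orP; right; rewrite ltr_pdivrMr// ltr_pMr// ltr1n.
by apply: ereal_sup_ubound; exists d.
Qed.

Variables (i : 'I_n) (c : R).

Lemma hausdorff_coord_separated (s t : R) (A B : set Rn) : (s < t)%R ->
  (forall x, A x -> (x ord0 i <= s)%R) -> (forall x, B x -> (t <= x ord0 i)%R) ->
  H A + H B <= H (A `|` B).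
Proof.
move=> st As Bt; apply: (@hausdorff_separated (t - s)); first by rewrite subr_gt0.
move=> x y Ax By; apply: le_trans (le_coord_enorm (x - y) i).
rewrite !mxE distrC; apply: le_trans (ler_norm _).
by apply: lerB; [exact: Bt|exact: As].
Qed.

Section rings.
Variable X : set Rn.
Hypothesis Xfin : H X < +oo.

Let inv j : R := j.+1%:R^-1.
(** Slices of X just above the hyperplane, at heights between 1/(j+2) and 1/(j+1), as in the proof
    of Caratheodory's criterion for metric outer measures. *)
Let ring j : set Rn := [set x | X x /\ (c + inv j.+1 < x ord0 i <= c + inv j)%R].

Let inv_lt j l : (j < l)%N -> (inv l < inv j)%R.
Proof. by move=> jl; rewrite /inv ltf_pV2 ?posrE// ltr_nat. Qed.

(** Two slices of equal parity have a slice of the other parity between them, hence a positive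
    distance, and their measures add up. [b] is the parity. *)
Let ring_sum_le (b : bool) m :
  \sum_(l < m) H (ring (l.*2 + b)) <= H (\big[setU/set0]_(l < m) ring (l.*2 + b)).
Proof.
elim: m => [|m IH]; first by rewrite !big_ord0 outer_measure0.
rewrite !big_ord_recr/= addeC setUC; apply: le_trans (leeD (lexx _) IH) _.
case: m {IH} => [|m]; first by rewrite !big_ord0 setU0 outer_measure0 adde0.
apply: (@hausdorff_coord_separated (c + inv (m.+1.*2 + b)) (c + inv (m.*2 + b).+1)).
- by rewrite ltrD2l inv_lt// doubleS !addSn.
- by move=> x [_ /andP[]].
move=> x; rewrite -(bigcup_mkord m.+1 (fun l => ring (l.*2 + b))) => -[l /= lm [_ /andP[/ltW + _]]].
apply: le_trans; rewrite lerD2l; move: lm; rewrite ltnS leq_eqVlt => /predU1P[->//|lm].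
by rewrite ltW// inv_lt// ltnS ltn_add2r ltn_double.
Qed.

Let ring_sum_lty : \sum_(j <oo) H (ring j) < +oo.
Proof.
apply: (@le_lt_trans _ _ (H X + H X)); last by rewrite lte_add_pinfty.
apply: lime_le.
  by apply: is_cvg_nneseries => *; exact: hausdorff_outer_ge0.
near=> m.
apply: (@le_trans _ _ (\sum_(0 <= j < m.*2) H (ring j))).
  rewrite (big_cat_nat (n := m) (p := m.*2))//= -?addnn ?leq_addr//.
  by rewrite leeDl// sume_ge0// => *; exact: hausdorff_outer_ge0.
have -> : \sum_(0 <= j < m.*2) H (ring j) =
    \sum_(l < m) H (ring (l.*2 + false)) + \sum_(l < m) H (ring (l.*2 + true)).
  elim: (m) => [|p IH]; first by rewrite !big_ord0 big_nil adde0.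
  rewrite doubleS 2?big_nat_recr//= IH !big_ord_recr/= addn0 addn1.
  by rewrite -addeA addeACA addeA.
apply: leeD; apply: (le_trans (ring_sum_le _ _)); apply: leH;
  rewrite -(bigcup_mkord m (fun l => ring (l.*2 + _))) => x [l _ []] //.
Unshelve. all: by end_near.
Qed.

(** The part B of X above height c + 1/(N+1) has positive distance from the half-space, so
    additivity holds for it. The slices left out form the tail of a convergent series, of sum below
    e. *)
Lemma hausdorff_halfspace_le :
  H (X `&` [set x | (x ord0 i <= c)%R]) + H (X `&` ~` [set x | (x ord0 i <= c)%R])
    <= H X.
Proof.
apply/lee_addgt0Pr => e e0.
have := nneseries_tail_cvg ring_sum_lty (fun j _ => hausdorff_outer_ge0 k (ring j)).
move=> /fine_cvgP[tail_fin /cvgrPdist_lt /(_ _ e0) tail].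
have [N [tfin tN]] : exists N, \sum_(N <= j <oo) H (ring j) \is a fin_num /\
    (`|0 - fine (\sum_(N <= j <oo) H (ring j))| < e)%R.
  by have [N _ HN] := filterI tail_fin tail; exists N; exact: (HN N (leqnn N)).
pose B : set Rn := [set x | X x /\ (c + inv N < x ord0 i)%R].
have cover : X `&` ~` [set x | (x ord0 i <= c)%R] `<=`
    B `|` \bigcup_(j in ~` `I_N) ring j.
  move=> x [Xx /= /negP]; rewrite -ltNge => cx.
  have [xB|xB] := ltP (c + inv N)%R (x ord0 i); [by left|right].
  have exl : exists l, (c + inv l < x ord0 i)%R.
    have [|l Hl] := @ex_natSinv_lt R (x ord0 i - c); first by rewrite subr_gt0.
    by exists l; rewrite -ltrBrDl.
  (* The least l with c + 1/(l+1) below the coordinate is positive, and x lies in the slice of index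
     l - 1. *)
  have [l Hl lmin] := ex_minnP exl.
  have Nl : (N < l)%N.
    rewrite ltnNge; apply/negP => lN; move: xB; rewrite leNgt => /negP; apply.
    apply: le_lt_trans Hl; rewrite lerD2l; move: lN.
    by rewrite leq_eqVlt => /predU1P[->//|/inv_lt/ltW].
  case: l Nl Hl lmin => // j; rewrite ltnS => Nj Hj jmin.
  exists j; first by rewrite /= ltnNge Nj.
  split=> //; rewrite Hj/= leNgt; apply/negP => /jmin.
  by rewrite ltnn.
apply: (@le_trans _ _ (H (X `&` [set x | (x ord0 i <= c)%R]) + (H B + e%:E))).
  rewrite leeD2l//; apply: (le_trans (leH cover)).
  apply: (le_trans (outer_measureU2 _ _ _)); rewrite leeD2l//.
  apply: (le_trans (outer_measure_sigma_subadditive_tail _ _ _)).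
  rewrite -(fineK tfin) lee_fin; apply: le_trans (ltW tN).
  by rewrite sub0r normrN ler_norm.
rewrite addeA leeD2r//.
apply: (le_trans (@hausdorff_coord_separated c (c + inv N) _ _ _ _ _)).
- by rewrite ltrDl invr_gt0.
- by move=> x [].
- by move=> x [_ /ltW].
- by apply: leH => x [[]|[]].
Qed.

End rings.

Lemma hausdorff_halfspace : H.-caratheodory [set x : Rn | (x ord0 i <= c)%R].
Proof.
apply: le_caratheodory_measurable => X.
have [Xoo|Xoo] := eqVneq (H X) +oo; first by rewrite [leRHS]Xoo leey.
by apply: hausdorff_halfspace_le; rewrite ltey.
Qed.

End hausdorff_metric.

(** * Finite measure of bounded pieces of hyperplanes *)

Lemma diam_itv {R : realType} {n : nat} (A : set 'rV[R]_n) (e : R) : 0 <= e ->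
  (forall x y, A x -> A y -> enorm (x - y) <= e) -> 0 <= diam A <= e.
Proof.
move=> e0 Ae; rewrite /diam; set E := image _ _.
have [[[_ [p Ap _]] ubE]|/sup_out->] := pselect (has_sup E); last by rewrite lexx.
have Ep : E (enorm (p.1 - p.2)) by exists p.
apply/andP; split.
  by apply: (le_trans _ (ub_le_sup ubE Ep)); exact: sqrtr_ge0.
by apply: ge_sup; [exists (enorm (p.1 - p.2))|move=> _ [x [x1 x2] <-]; exact: Ae].
Qed.

Lemma grid_cell {R : realType} (a s : R) (N : nat) (t : R) : 0 < s ->
  a <= t <= a + s * N.+1%:R ->
  exists m : 'I_N.+1, a + s * m%:R <= t <= a + s * m.+1%:R.
Proof.
move=> s0; elim: N => [|N IH] /andP[h1 h2].
  by exists ord0; rewrite mulr0 addr0 h1.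
have [tN|tN] := leP t (a + s * N.+1%:R).
  have [|m mt] := IH; first by rewrite h1.
  by exists (widen_ord (leqnSn _) m).
by exists ord_max; rewrite ltW.
Qed.

Section hausdorff_finite.
Context {R : realType} {n : nat}.
Local Notation Rn := 'rV[R]_n.+1.
Variables (i0 : 'I_n.+1) (c L : R) (g : 'I_n -> R).
Hypothesis L0 : 0 < L.

Let P : set Rn := [set x | (forall i, `|x ord0 i| <= L) /\
  x ord0 i0 = c + \sum_j g j * x ord0 (lift i0 j)].

Let cell (s : R) (N : nat) (f : {ffun 'I_n -> 'I_N.+1}) : set Rn :=
  [set x | P x /\ forall j, - L + s * (f j)%:R <= x ord0 (lift i0 j) <= - L + s * (f j).+1%:R].

(** A cell has extent at most s in each of the n base coordinates and at most s times the sum of |g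
    j| in coordinate i0; the Euclidean norm is bounded by the sum of the coordinates. *)
Let C := n%:R + \sum_j `|g j|.

Let C_ge0 : 0 <= C.
Proof. by rewrite addr_ge0// sumr_ge0. Qed.

Let cell_diam s N f x y : 0 <= s -> @cell s N f x -> @cell s N f y ->
  enorm (x - y) <= C * s.
Proof.
move=> s0 [[_ xP] xf] [[_ yP] yf].
have xy j : `|x ord0 (lift i0 j) - y ord0 (lift i0 j)| <= s.
  have := xf j; have := yf j; rewrite -natr1 mulrDr mulr1.
  move: (s * _) => u /andP[h1 h2] /andP[h3 h4].
  by rewrite ler_norml; apply/andP; split; lra.
apply: (le_trans (enorm_le_sum _)).
rewrite (bigD1_ord i0)//= /C mulrDl addrC; apply: lerD.
  rewrite -[n in n%:R]card_ord -sumr_const mulr_suml; apply: ler_sum => j _.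
  by rewrite !mxE mul1r.
rewrite !mxE xP yP opprD addrACA subrr add0r -sumrB; apply: (le_trans (ler_norm_sum _ _ _)).
rewrite mulr_suml; apply: ler_sum => j _.
by rewrite -mulrBr normrM ler_wpM2l.
Qed.

Local Open Scope ereal_scope.

Let w0 : 0 <= @unit_ball_volume R n.
Proof. exact: outer_measure_ge0. Qed.

Let w_lty : @unit_ball_volume R n < +oo.
Proof.
apply: lebesgue_outer_bounded; exists 1%R; split; first exact: num_real.
move=> M M1 x /= x1; apply: le_trans (ltW M1).
rewrite [leLHS]/Num.norm /= mx_normrE; apply: bigmax_le => // -[j i] _ /=.
by rewrite ord1; exact: le_trans (le_coord_enorm _ _) x1.
Qed.

(** The set is a graph over the coordinates other than i0. A grid of width s = 2L/(N+1) has (N+1)^n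
    cells, each of weight at most a constant times s^n, so the total is bounded by [K] however fine
    the grid, hence at every scale d. *)
Lemma hausdorff_hyperplane_lty : @hausdorff_outer R n.+1 n P < +oo.
Proof.
pose K := @unit_ball_volume R n * ((C * (2 * L) / 2) ^+ n)%R%:E.
apply: (@le_lt_trans _ _ K); last first.
  by rewrite /K lte_mul_pinfty ?ltry ?ge0_fin_numE//.
apply: ge_ereal_sup => _ [d d0 <-].
(* Chosen to make cell diameters at most d; the [+ 1] keeps the denominator positive, since C
   vanishes when n = 0. *)
have [N HN] : exists N : nat, (N.+1%:R^-1 < d / (C * (2 * L) + 1))%R.
  apply: ex_natSinv_lt; rewrite divr_gt0// ltr_wpDl// mulr_ge0// mulr_ge0// ltW//.
pose s : R := (2 * L / N.+1%:R)%R.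
have s0 : (0 < s)%R by rewrite divr_gt0// mulr_gt0.
have Cs : (C * s <= d)%R.
  rewrite /s mulrA; move: HN; rewrite ltr_pdivlMr; last first.
    by rewrite ltr_wpDl// mulr_ge0// mulr_ge0// ltW.
  rewrite mulrDr mulr1 => /ltW; apply: le_trans.
  by rewrite mulrC lerDl invr_ge0.
pose ff : finType := {ffun 'I_n -> 'I_N.+1}.
pose F l : option (set Rn) := omap (fun u : 'I_#|ff| => cell s (enum_val u)) (insub l).
have w_cell f : hausdorff_weight n (@cell s N f) <=
    @unit_ball_volume R n * ((C * s / 2) ^+ n)%R%:E.
  have Cs0 : (0 <= C * s)%R by rewrite mulr_ge0// ltW.
  have [|d1 d2] := andP (@diam_itv _ _ (@cell s N f) (C * s)%R Cs0 _).
    by move=> x y; apply: cell_diam; exact: ltW.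
  by rewrite lee_wpmul2l// lee_fin lerXn2r ?nnegrE ?divr_ge0// ler_pM2r.
apply: (@le_trans _ _ (\sum_(l <oo) weight (@hausdorff_weight R n.+1 n) (F l))).
  apply: ereal_inf_lbound; exists F => //; split.
    move=> l B; rewrite /F; case: insub => //= u [<-] x y xc yc.
    exact: le_trans (cell_diam (ltW s0) xc yc) Cs.
  move=> x Px.
  have /choice[f fP] : forall j : 'I_n, exists m : 'I_N.+1,
      (- L + s * m%:R <= x ord0 (lift i0 j) <= - L + s * m.+1%:R)%R.
    move=> j; apply: grid_cell => //.
    rewrite /s divfK ?pnatr_eq0//; have := Px.1 (lift i0 j).
    by rewrite ler_norml => /andP[h1 h2]; apply/andP; split; lra.
  exists (enum_rank (finfun f : ff)) => //.
  rewrite /F valK /= enum_rankK; split=> // j; rewrite ffunE; exact: fP.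
rewrite (nneseries_split 0 #|ff|)//; last first.
  by move=> l _; apply: weight_ge0; exact: hausdorff_weight_ge0.
rewrite [X in _ + X]eseries0 ?adde0; last first.
  by move=> l /= ffl _; rewrite /F insubF// ltnNge ffl.
pose W : R := (fine (@unit_ball_volume R n) * (C * s / 2) ^+ n)%R.
have WE : @unit_ball_volume R n * ((C * s / 2) ^+ n)%R%:E = W%:E.
  by rewrite /W EFinM fineK// ge0_fin_numE.
apply: (@le_trans _ _ (\sum_(0 <= l < #|ff|) W%:E)).
  apply: lee_sum => l _; rewrite -WE /F; case: insub => [u|] /=; first exact: w_cell.
  by rewrite mule_ge0// lee_fin exprn_ge0// divr_ge0// mulr_ge0// ltW.
rewrite sumEFin sumr_const_nat subn0 /ff card_ffun !card_ord.
rewrite /K -[X in X * _]fineK ?ge0_fin_numE// -EFinM lee_fin /W.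
rewrite -[leLHS]mulr_natr natrX -[leLHS]mulrA -exprMn le_eqVlt; apply/orP; left; apply/eqP.
by congr (_ * _ ^+ _)%R; rewrite /s; field.
Qed.

End hausdorff_finite.

(** * Simplices *)

Section barycentric.
Context {R : realType} {n : nat}.
Local Notation Rn := 'rV[R]_n.
Implicit Types (T : simplex R n) (x y : Rn).

Definition aff (c : R) (p : Rn) (x : Rn) : R := c + \sum_i p ord0 i * x ord0 i.

Lemma aff_continuous c p : continuous (aff c p).
Proof.
move=> x; apply: (@continuousD _ _ _ (cst c) (fun x : Rn => \sum_i p ord0 i * x ord0 i)).
  exact: cst_continuous.
apply: (@continuous_sum R Rn _ _ (fun i (x : Rn) => p ord0 i * x ord0 i)) => i y.
apply: (@continuousM _ _ (cst (p ord0 i)) (fun x : Rn => x ord0 i)).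
  exact: cst_continuous.
exact: coord_continuous1.
Qed.

Lemma aff_segment c p x y (s : R) :
  aff c p (x + s *: (y - x)) = (1 - s) * aff c p x + s * aff c p y.
Proof.
have sumE : \sum_i p ord0 i * (x + s *: (y - x)) ord0 i =
    (1 - s) * \sum_i p ord0 i * x ord0 i + s * \sum_i p ord0 i * y ord0 i.
  rewrite !mulr_sumr -big_split/=; apply: eq_bigr => i _; rewrite !mxE; ring.
rewrite /aff sumE; ring.
Qed.

Definition edges T : 'M[R]_n := \matrix_(i < n) (row (lift ord0 i) T - row ord0 T).

Definition bary T (x : Rn) (j : 'I_n.+1) : R :=
  let s := (x - row ord0 T) *m invmx (edges T) in
  if unlift ord0 j is Some i then s ord0 i else 1 - \sum_i s ord0 i.

Lemma comb_edges T (t : 'rV[R]_n.+1) : \sum_j t ord0 j = 1 ->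
  t *m T - row ord0 T = (\row_i t ord0 (lift ord0 i)) *m edges T.
Proof.
move=> t1; rewrite !mulmx_sum_row big_ord_recl.
rewrite -[X in _ - X]scale1r -t1 big_ord_recl scalerDl scaler_suml.
rewrite opprD addrACA subrr add0r -sumrB; apply: eq_bigr => i _.
by rewrite mxE rowK scalerBr.
Qed.

Lemma bary_comb T (t : 'rV[R]_n.+1) j : Defs.nondegenerate T ->
  \sum_j t ord0 j = 1 -> bary T (t *m T) j = t ord0 j.
Proof.
move=> nT t1; rewrite /bary comb_edges// mulmxK//.
case: unliftP => [i ->|->]; first by rewrite mxE.
move: t1; rewrite big_ord_recl => /(canRL (addrK _)) ->.
by congr (_ - _); apply: eq_bigr => i _; rewrite mxE.
Qed.

Lemma sum_bary T x : \sum_j bary T x j = 1.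
Proof.
rewrite big_ord_recl {1}/bary unlift_none.
rewrite [X in _ + X](eq_bigr (fun i => ((x - row ord0 T) *m invmx (edges T)) ord0 i)).
  by rewrite subrK.
by move=> i _; rewrite /bary liftK.
Qed.

Lemma baryK T x : Defs.nondegenerate T -> (\row_j bary T x j) *m T = x.
Proof.
move=> nT; apply: (addIr (- row ord0 T)); rewrite comb_edges; last first.
  by rewrite -[RHS](sum_bary T x); apply: eq_bigr => j _; rewrite mxE.
rewrite (_ : \row_i _ = (x - row ord0 T) *m invmx (edges T)) ?mulmxKV//.
by apply/rowP => i; rewrite !mxE /bary liftK !mxE.
Qed.

Lemma hullP T x : Defs.nondegenerate T -> hull T x <-> forall j, 0 <= bary T x j.
Proof.
move=> nT; split=> [[t [t0 _ t1 ->] j]|x0]; first by rewrite bary_comb.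
exists (\row_j bary T x j); split=> [j|j|//|]; rewrite ?mxE ?inE ?baryK//.
by rewrite -[RHS](sum_bary T x); apply: eq_bigr => j _; rewrite mxE.
Qed.

Lemma bary_aff T j : exists c p, forall x, bary T x j = aff c p x.
Proof.
have coordE i x : ((x - row ord0 T) *m invmx (edges T)) ord0 i =
    aff (- (row ord0 T *m invmx (edges T)) ord0 i) (\row_k invmx (edges T) k i) x.
  rewrite mulmxBl mxE [X in _ + X]mxE addrC /aff; congr (_ + _).
  by rewrite mxE; apply: eq_bigr => k _; rewrite mxE mulrC.
rewrite /bary; case: unliftP => [i _|_]; first by do 2 eexists; move=> x; exact: coordE.
pose c i := - (row ord0 T *m invmx (edges T)) ord0 i.
exists (1 - \sum_i c i), (\row_k - \sum_i invmx (edges T) k i) => x.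
under eq_bigr do rewrite coordE.
rewrite /aff big_split/= opprD addrA; congr (_ + _).
rewrite exchange_big/= -sumrN; apply: eq_bigr => k _.
by rewrite mxE mulNr mulr_suml; congr (- _); apply: eq_bigr => i _; rewrite mxE.
Qed.

End barycentric.

Section hull_topology.
Context {R : realType} {n : nat}.
Local Notation Rn := 'rV[R]_n.
Variable T : simplex R n.
Hypothesis nT : Defs.nondegenerate T.

Let bary_continuous j : continuous (fun x : Rn => bary T x j).
Proof.
have [c [p E]] := bary_aff T j; rewrite (_ : (fun _ => _) = aff c p).
  exact: aff_continuous.
exact/funext.
Qed.

Lemma hull_closed : closed (hull T).
Proof.
have -> : hull T = \bigcap_j (fun x : Rn => bary T x j) @^-1` [set y | 0 <= y].
  apply/seteqP; split=> [x /(hullP _ nT) x0 j _|x x0]; first exact: x0.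
  by apply/(hullP _ nT) => j; exact: x0.
apply: closed_bigI => j _; apply: closed_comp; last exact: closed_ge.
by move=> x _; exact: bary_continuous.
Qed.

Lemma hull_segment x y (s : R) : 0 <= s <= 1 -> hull T x -> hull T y ->
  hull T (x + s *: (y - x)).
Proof.
move=> /andP[s0 s1] /(hullP _ nT) x0 /(hullP _ nT) y0; apply/(hullP _ nT) => j.
have [c [p E]] := bary_aff T j.
by rewrite E aff_segment -!E addr_ge0// mulr_ge0// subr_ge0.
Qed.

Let open_bary_gt0 : open [set x : Rn | forall j, 0 < bary T x j].
Proof.
rewrite openE => x x0; rewrite /interior.
have near_bary j : nbhs x [set y : Rn | 0 < bary T y j].
  by have /(_ [set r | 0 < r]) := @bary_continuous j x; apply; exact: lt_nbhsr.
by have := @filter_forall _ _ _ _ (nbhs_filter x) near_bary; apply: filterS.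
Qed.

Let bary_gt0_hull : [set x : Rn | forall j, 0 < bary T x j] `<=` hull T.
Proof. by move=> x x0; apply/(hullP _ nT) => j; exact: ltW. Qed.

Lemma hull_inner_box : exists (z : Rn) (r : R), 0 < r /\
  box (z - const_mx r, z + const_mx r) `<=` hull T.
Proof.
(* The barycenter, all of whose barycentric coordinates are positive. *)
pose t : 'rV[R]_n.+1 := const_mx n.+1%:R^-1.
have t1 : \sum_j t ord0 j = 1.
  under eq_bigr do rewrite mxE.
  by rewrite sumr_const card_ord -[LHS]mulr_natr mulVf// pnatr_eq0.
have [|r r0 rP] := near_box open_bary_gt0 (x := t *m T).
  by move=> j; rewrite bary_comb// mxE invr_gt0.
by exists (t *m T), r; split=> //; exact: subset_trans bary_gt0_hull.
Qed.

Lemma hull_boundary x : hull T x -> ~ (hull T)^° x -> exists j, bary T x j = 0.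
Proof.
move=> /(hullP _ nT) x0 nint; apply: contrapT => /forallNP nz; apply: nint.
have xpos : [set x : Rn | forall j, 0 < bary T x j] x.
  by move=> j; rewrite lt_neqAle x0 andbT eq_sym; apply/eqP; exact: nz.
apply: filterS bary_gt0_hull _; move: open_bary_gt0; rewrite openE; exact.
Qed.

End hull_topology.

Lemma bounded_set_coord {R : realType} {n : nat} (A : set 'rV[R]_n) :
  bounded_set A -> exists2 L : R, 0 < L & forall x, A x -> forall i, `|x ord0 i| <= L.
Proof.
move=> [M [Mr MA]]; exists (`|M| + 1); first by rewrite ltr_wpDl.
move=> x Ax i; apply: le_trans (MA (`|M| + 1) _ _ Ax); last first.
  by rewrite (le_lt_trans (ler_norm _))// ltrDl.
by rewrite [leRHS]/Num.norm /= mx_normrE (bigmax_sup (ord0, i)).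
Qed.

Lemma bounded_closure_coord {R : realType} {n : nat} (A : set 'rV[R]_n) :
  bounded_set A -> exists2 L : R, 0 < L &
    forall x, closure A x -> forall i, `|x ord0 i| <= L.
Proof.
move=> /bounded_set_coord[L L0 AL]; exists L => //.
have AB : A `<=` box (const_mx (- L), const_mx L).
  by move=> x Ax i; rewrite !mxE -ler_norml AL.
move=> x /(closureS AB); rewrite -(closure_id _).1; last exact: closed_box.
by move=> xB i; have := xB i; rewrite !mxE -ler_norml.
Qed.

(** * The boundary of a polygonal domain *)

Section polygonal_boundary.
Context {R : realType} {n : nat}.
Local Notation Rn := 'rV[R]_n.+1.
Local Notation H := (@hausdorff_outer R n.+1 n).
Local Open Scope ereal_scope.

(** The vanishing of a barycentric coordinate is an affine equation, and a nontrivial one since the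
    coordinate is 1 at one vertex and 0 at another. Solving for a coordinate i0 with nonzero
    coefficient exhibits the face as a graph. *)
Lemma hausdorff_face_lty (T : simplex R n.+1) j (L : R) : (0 < L)%R ->
  Defs.nondegenerate T ->
  H [set x : Rn | (forall i, `|x ord0 i| <= L)%R /\ bary T x j = 0%R] < +oo.
Proof.
move=> L0 nT; have [c [p E]] := bary_aff T j.
have vertex k : bary T (row k T) j = (j == k)%:R.
  rewrite rowE bary_comb//; first by rewrite mxE eqxx.
  rewrite (bigD1 k)//= mxE !eqxx big1 ?addr0// => l /negPf lk.
  by rewrite mxE lk andbF.
have [i0 pi0] : exists i0, p ord0 i0 != 0%R.
  apply: contrapT => /forallNP p0.
  have Ec x : bary T x j = c.
    rewrite E /aff big1 ?addr0// => i _; have /negP := p0 i.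
    by rewrite negbK => /eqP ->; rewrite mul0r.
  have [k jk] : exists k, j != k.
    by have [->|?] := eqVneq j ord0; [exists ord_max|exists ord0].
  have := vertex j; rewrite eqxx Ec => c1; have := vertex k.
  by rewrite (negPf jk) Ec c1 => /eqP; rewrite oner_eq0.
apply: le_lt_trans (hausdorff_hyperplane_lty i0 (- c / p ord0 i0)
  (fun l => - p ord0 (lift i0 l) / p ord0 i0) L0)%R.
apply: le_outer_measure => x [xL]; rewrite E /aff (bigD1_ord i0)//= => /eqP.
rewrite addrCA addr_eq0 => /eqP xE; split=> //.
apply: (mulfI pi0); rewrite xE opprD mulrDr mulrCA divff// mulr1; congr (_ + _)%R.
rewrite mulr_sumr -sumrN; apply: eq_bigr => l _.
by rewrite mulrA mulrCA divff// mulr1 mulNr.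
Qed.

Lemma outer_measure_bigsetU_lty (I : eqType) (s : seq I) (F : I -> set Rn) :
  (forall i, i \in s -> H (F i) < +oo) -> H (\big[setU/set0]_(i <- s) F i) < +oo.
Proof.
elim: s => [|i s IH] Fs; first by rewrite big_nil outer_measure0.
rewrite big_cons; apply: le_lt_trans (outer_measureU2 _ _ _) _.
rewrite lte_add_pinfty ?Fs ?mem_head// IH// => k ks.
by rewrite Fs// in_cons ks orbT.
Qed.

Variable Omega : set Rn.
Hypothesis domain : polygonal_domain Omega.

Lemma closed_bigcup_hull (s : seq (simplex R n.+1)) : all (@Defs.nondegenerate R n.+1) s ->
  closed [set x : Rn | exists2 T, T \in s & hull T x].
Proof.
move=> sn; rewrite (_ : mkset _ = \bigcup_(T in [set` s]) hull T); last first.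
  by apply/seteqP; split=> [x [T Ts xT]|x [T Ts xT]]; exists T.
apply: closed_bigcup; first exact: finite_seq.
by move=> T Ts; apply: hull_closed; move/allP: sn; exact.
Qed.

(** Omega is the interior of a closed set, which excludes slits: boxes inside a mesh piece then have
    their interior in Omega itself, not just in its closure. *)
Lemma polygonal_interior_closure : (closure Omega)^° `<=` Omega.
Proof.
have [_ _ _ _ [s sn OE]] := domain.
have clO : closure Omega `<=` [set x : Rn | exists2 T, T \in s & hull T x].
  rewrite [X in _ `<=` X](closure_id _).1; last exact: closed_bigcup_hull.
  by apply: closureS; rewrite {1}OE; exact: interior_subset.
by move=> x /(interiorS clO); rewrite -OE.
Qed.

Lemma hausdorff_boundary_lty : H (closure Omega `\` Omega) < +oo.
Proof.
have [_ _ _ bO [s sn OE]] := domain.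
have [L L0 OL] := bounded_closure_coord bO.
pose P (T : simplex R n.+1) j : set Rn :=
  [set x : Rn | (forall i, `|x ord0 i| <= L)%R /\ bary T x j = 0%R].
apply: (@le_lt_trans _ _ (H (\big[setU/set0]_(T <- s)
    \big[setU/set0]_(j <- enum 'I_n.+2) P T j))); last first.
  apply: outer_measure_bigsetU_lty => T Ts.
  apply: outer_measure_bigsetU_lty => j _; apply: hausdorff_face_lty => //.
  by move/allP: sn; exact.
apply: le_outer_measure => x [clx nOx].
have clO : closure Omega `<=` [set x : Rn | exists2 T, T \in s & hull T x].
  rewrite [X in _ `<=` X](closure_id _).1; last exact: closed_bigcup_hull.
  by apply: closureS; rewrite {1}OE; exact: interior_subset.
have [T Ts xT] := clO _ clx.
have nT : Defs.nondegenerate T by move/allP: sn; exact.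
have [|j xj] := hull_boundary nT xT.
  move=> xint; apply: nOx; rewrite OE; apply: interiorS xint.
  by move=> y yT; exists T.
rewrite -bigcup_seq; exists T => //; rewrite -bigcup_seq; exists j => /=.
  by rewrite mem_enum.
by split=> // i; exact: OL.
Qed.

End polygonal_boundary.

(** * Piecewise affine functions *)

Section difference_quotients.
Context {R : realType} {n : nat}.
Local Notation Rn := 'rV[R]_n.+1.
Local Notation lam := (@lebesgue R n.+1).
Local Notation T := (caratheodory_type (@lebesgue_outer R n.+1)).
Local Notation e_ i := (delta_mx ord0 i : Rn).
Variables (Omega : set Rn).
Hypotheses (oOmega : open Omega) (bOmega : bounded_set Omega).

Let mOmega : measurable (Omega : set T) := lebesgue_open oOmega.

Lemma bounded_support_integrable (F : Rn -> R) (C : R) :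
  measurable_fun [set: T] (F : T -> R) -> (forall x, `|F x| <= C) ->
  (forall x, ~ Omega x -> F x = 0) -> lam.-integrable [set: T] (EFin \o F).
Proof.
move=> mF FC F0; rewrite (_ : EFin \o F = (EFin \o F) \_ Omega); last first.
  apply/funext => x; rewrite patchE; case: ifPn => //.
  by rewrite notin_setE => /F0 /= ->.
rewrite -integrable_mkcond//; apply: measurable_bounded_integrable => //.
- exact: lebesgue_bounded_lty.
- exact: measurable_funTS.
- by exists C; split; [exact: num_real|move=> M /ltW CM x _; exact: le_trans (FC x) CM].
Qed.

(** Each point of K has a neighbourhood with a segment length that fits; compactness makes the
    length uniform. *)
Lemma compact_segments_in_open (K : set Rn) (i : 'I_n.+1) : compact K -> K `<=` Omega ->
  exists L, forall l x s, (L <= l)%N -> K x -> `|s| <= l.+1%:R^-1 ->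
    Omega (x + s *: e_ i).
Proof.
move=> /compact_near_coveringP cK KO.
have near_seg : \forall l \near \oo, K `<=`
    (fun x => forall s, `|s| <= l.+1%:R^-1 -> Omega (x + s *: e_ i)).
  apply: (cK nat \oo (fun l x => forall s, `|s| <= l.+1%:R^-1 -> Omega (x + s *: e_ i))).
  move=> x /KO Ox; have [d d0 dO] := near_box oOmega Ox.
  have [k kd] : exists k : nat, k.+1%:R^-1 < d / 2 by apply: ex_natSinv_lt; rewrite divr_gt0.
  pose U := obox (x - const_mx (d / 2), x + const_mx (d / 2)).
  have Ux : U x by move=> j; rewrite !mxE; apply/andP; split; lra.
  exists (U, [set l | (k <= l)%N]); first split => /=.
  - by apply: open_nbhs_nbhs; split=> //; exact: open_obox.
  - exact: nbhs_infty_ge.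
  move=> [y l] /= [Uy kl] s sl; apply: dO => j; rewrite !mxE eqxx/=.
  have sd : `|s| < d / 2.
    apply: (le_lt_trans sl); apply: le_lt_trans kd.
    by rewrite lef_pV2 ?posrE// ler_nat.
  have := Uy j; rewrite !mxE => /andP[h1 h2]; move: sd; rewrite ltr_norml => /andP[h3 h4].
  by case: (j == i); rewrite ?mulr1 ?mulr0; apply/andP; split; lra.
have [L _ HL] := near_seg; exists L => l x s Ll Kx sl; exact: (HL l Ll x Kx s sl).
Qed.

Section test.
Variables (phi : Rn -> R) (i : 'I_n.+1).
Hypothesis phi_test : test_function Omega phi.

Lemma test_function_continuous : continuous phi.
Proof. exact: (phi_test.1 [::]).1. Qed.

Lemma test_function_partial_continuous : continuous (partial i phi).
Proof. exact: (phi_test.1 [:: i]).1. Qed.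

Lemma compact_support_bounded (f : Rn -> R) (K : set Rn) : continuous f -> compact K ->
  (forall x, ~ K x -> f x = 0) -> exists2 C, 0 <= C & forall x, `|f x| <= C.
Proof.
move=> cf cK f0.
have /compact_bounded[M [_ MC]] : compact (f @` K).
  by apply: continuous_compact => //; exact: continuous_subspaceT.
exists (`|M| + 1); first by rewrite addr_ge0.
move=> x; have [Kx|/f0->] := pselect (K x); last by rewrite normr0 addr_ge0.
by apply: MC; [rewrite (le_lt_trans (ler_norm _))// ltrDl|exists x].
Qed.

Lemma test_function_bounded : exists2 C, 0 <= C & forall x, `|phi x| <= C.
Proof.
have [_ [K [cK _ phi0]]] := phi_test.
exact: compact_support_bounded test_function_continuous cK phi0.
Qed.

Lemma test_function_partial_bounded :
  exists2 C, 0 <= C & forall x, `|partial i phi x| <= C.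
Proof.
have [_ [K [cK _ phi0]]] := phi_test.
apply: (compact_support_bounded test_function_partial_continuous cK) => x nKx.
transitivity ('D_(e_ i) (cst (0 : R)) x); last exact: derive_cst.
apply: near_eq_derive.
have cK' : closed K by apply: compact_closed cK; exact: norm_hausdorff.
have oK := closed_openC cK'.
have : nbhs x (~` K) by exact: open_nbhs_nbhs.
by apply: filterS => y; exact: phi0.
Qed.

Lemma line_derivative x (s : R) :
  is_derive s 1 (fun t : R => phi (x + t *: e_ i)) (partial i phi (x + s *: e_ i)).
Proof.
have dphi := (phi_test.1 [::]).2 i (x + s *: e_ i).
have E : (fun h : R => h^-1 *: (((fun t : R => phi (x + t *: e_ i)) \o shift s) (h *: 1) -
     phi (x + s *: e_ i))) =
   (fun h => h^-1 *: ((phi \o shift (x + s *: e_ i)) (h *: e_ i) - phi (x + s *: e_ i))).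
  apply/funext => h; congr (_ *: (phi _ - _)) => /=.
  by rewrite [h *: 1]mulr1 scalerDl addrCA.
by apply: DeriveDef; rewrite /derivable/derive E.
Qed.

Lemma test_function_increment (C : R) x (t : R) : 0 <= t ->
  (forall y, `|partial i phi y| <= C) -> `|phi (x - t *: e_ i) - phi x| <= C * t.
Proof.
move=> t0 HC; pose g (s : R) := phi (x + s *: e_ i).
have t0' : - t <= 0 by rewrite oppr_le0.
have [|s _] := @MVT_segment _ g (fun s => partial i phi (x + s *: e_ i)) _ _ t0'
  (fun s _ => line_derivative x s).
  apply: derivable_within_continuous => s _.
  by have [] := line_derivative x s.
rewrite /g scale0r addr0 scaleNr opprK add0r distrC => ->.
by rewrite normrM (ger0_norm t0) ler_wpM2r.
Qed.

(** The quotient is backward because translation moves the forward quotient of v onto the test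
    function. *)
Lemma test_function_quotient_cvg x :
  (fun l : nat => (phi (x - l.+1%:R^-1 *: e_ i) - phi x) * - l.+1%:R) @ \oo -->
  partial i phi x.
Proof.
have dphi := (phi_test.1 [::]).2 i x.
have /cvgr_dnbhsP H : h^-1 *: ((phi \o shift x) (h *: e_ i) - phi x) @[h --> 0^'] -->
  partial i phi x by exact: dphi.
pose u (l : nat) : R := - l.+1%:R^-1.
have u0 : (forall l, u l != 0) /\ u @ \oo --> 0.
  split=> [l|]; first by rewrite oppr_eq0 invr_eq0 pnatr_eq0.
  by rewrite -[X in _ --> X]oppr0; apply: cvgN; exact: cvg_harmonic.
suff -> : (fun l : nat => (phi (x - l.+1%:R^-1 *: e_ i) - phi x) * - l.+1%:R) =
    (fun l => (u l)^-1 *: ((phi \o shift x) (u l *: e_ i) - phi x)) by exact: H u u0.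
apply/funext => l; rewrite /u /= invrN invrK mulrC [RHS]/(_ * _).
by rewrite scaleNr [- _ + x]addrC.
Qed.

End test.
Section integration_by_parts.
Variables (v g : Rn -> R) (i : 'I_n.+1) (B Lip : R).
Hypotheses (mv : measurable_fun (Omega : set T) (v : T -> R))
  (mg : measurable_fun (Omega : set T) (g : T -> R))
  (vB : forall x, Omega x -> `|v x| <= B)
  (v_lip : forall x t, 0 <= t -> (forall s, 0 <= s <= t -> Omega (x + s *: e_ i)) ->
     `|v (x + t *: e_ i) - v x| <= Lip * t)
  (v_cvg : forall x, Omega x ->
     (fun l : nat => (v (x + l.+1%:R^-1 *: e_ i) - v x) * l.+1%:R) @ \oo --> g x).
Variable phi : Rn -> R.
Hypothesis phi_test : test_function Omega phi.

(** Extension by 0 to the whole space, where integrals are translation invariant. *)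
Let w : Rn -> R := v \_ Omega.

Let wE x : Omega x -> w x = v x.
Proof. by move=> Ox; rewrite /w patchE mem_set. Qed.

Let w0 x : ~ Omega x -> w x = 0.
Proof. by move=> nOx; rewrite /w patchE memNset. Qed.

Let mw : measurable_fun [set: T] (w : T -> R).
Proof. exact/(measurable_restrictT _ mOmega). Qed.

Let wB x : `|w x| <= `|B|.
Proof.
have [Ox|nOx] := pselect (Omega x); last by rewrite w0// normr0.
by rewrite wE// (le_trans (vB Ox))// ler_norm.
Qed.

Let mshift (f : Rn -> R) h : measurable_fun [set: T] (f : T -> R) ->
  measurable_fun [set: T] ((fun x => f (x + h)) : T -> R).
Proof. by move=> mf; exact: measurableT_comp mf (lebesgue_translate_measurable h). Qed.

Let mphi : measurable_fun [set: T] (phi : T -> R).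
Proof. exact: lebesgue_continuous (test_function_continuous phi_test). Qed.

Let phi_out x : ~ Omega x -> phi x = 0.
Proof.
have [_ [K [_ KO phi0]]] := phi_test.
by move=> nOx; apply: phi0 => /KO.
Qed.

Let psi (l : nat) x := (phi (x - l.+1%:R^-1 *: e_ i) - phi x) * - l.+1%:R.
Let theta (l : nat) x := (w (x + l.+1%:R^-1 *: e_ i) - w x) * l.+1%:R.

Let mM (f1 f2 : Rn -> R) (D : set T) : measurable_fun D (f1 : T -> R) ->
  measurable_fun D (f2 : T -> R) -> measurable_fun D ((fun x => f1 x * f2 x) : T -> R).
Proof. exact: measurable_funM. Qed.

Let mpsi l : measurable_fun [set: T] (psi l : T -> R).
Proof.
apply: (@mM (fun x => phi (x - l.+1%:R^-1 *: e_ i) - phi x) (fun=> - l.+1%:R)).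
  exact: measurable_funB (mshift _ mphi) mphi.
exact: measurable_cst.
Qed.

Let mtheta l : measurable_fun [set: T] (theta l : T -> R).
Proof.
apply: (@mM (fun x => w (x + l.+1%:R^-1 *: e_ i) - w x) (fun=> l.+1%:R)).
  exact: measurable_funB (mshift _ mw) mw.
exact: measurable_cst.
Qed.

Lemma discrete_integration_by_parts l :
  inner lam Omega v (psi l) = - inner lam Omega phi (theta l).
Proof.
set h := l.+1%:R^-1 *: e_ i; set c : R := l.+1%:R.
have [C C0 phiC] := test_function_bounded phi_test.
pose a x := w x * phi (x - h); pose b x := w (x + h) * phi x; pose d x := w x * phi x.
have bound x y : `|w x * phi y| <= `|B| * C by rewrite normrM ler_pM.
have ma : measurable_fun [set: T] (a : T -> R) := mM mw (mshift (- h) mphi).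
have mb : measurable_fun [set: T] (b : T -> R) := mM (mshift h mw) mphi.
have md : measurable_fun [set: T] (d : T -> R) := mM mw mphi.
have inta : lam.-integrable [set: T] (EFin \o a).
  apply: (bounded_support_integrable ma (C := `|B| * C)) => [|x nOx].
  - by move=> x; exact: bound.
  - by rewrite /a w0// mul0r.
have intb : lam.-integrable [set: T] (EFin \o b).
  apply: (bounded_support_integrable mb (C := `|B| * C)) => [|x nOx].
  - by move=> x; exact: bound.
  - by rewrite /b phi_out// mulr0.
have intd : lam.-integrable [set: T] (EFin \o d).
  apply: (bounded_support_integrable md (C := `|B| * C)) => [|x nOx].
  - by move=> x; exact: bound.
  - by rewrite /d w0// mul0r.
(* Translation by h carries [a] into [b]; what remains is linearity. *)
have ab : Rintegral lam [set: T] a = Rintegral lam [set: T] b.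
  have bE : (fun x => a (x + h)) = b.
    by apply/funext => x; rewrite /a /b addrK.
  by rewrite -bE; apply/esym/(Rintegral_translate ma); rewrite bE.
transitivity (Rintegral lam [set: T] (fun x => - c * (a x - d x))).
  rewrite /inner Rintegral_mkcond; apply: eq_Rintegral => x _.
  rewrite patchE /a /d; case: ifPn => [/set_mem Ox|/negP nOx].
    by rewrite wE// /psi -/h -/c; ring.
  by rewrite w0 ?mul0r ?subrr ?mulr0// => Ox; apply: nOx; exact: mem_set.
transitivity (- Rintegral lam [set: T] (fun x => c * (b x - d x))); last first.
  congr (- _); rewrite /inner [RHS]Rintegral_mkcond; apply: eq_Rintegral => x _.
  rewrite patchE /b /d; case: ifPn => [/set_mem Ox|/negP nOx].
    by rewrite /theta -/h -/c; ring.
  by rewrite (phi_out (x := x)) ?mulr0 ?subrr ?mulr0// => Ox; apply: nOx; exact: mem_set.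
have intad : lam.-integrable [set: T] (EFin \o (fun x => a x - d x)).
  exact: (integrableB measurableT inta intd).
have intbd : lam.-integrable [set: T] (EFin \o (fun x => b x - d x)).
  exact: (integrableB measurableT intb intd).
by rewrite !RintegralZl// !RintegralB// ab mulNr.
Qed.

Lemma integration_by_parts :
  inner lam Omega v (partial i phi) = - inner lam Omega g phi.
Proof.
have lamO := lebesgue_bounded_lty bOmega.
have vL2 : L2 lam Omega v by exact: (@bounded_L2 _ _ _ _ _ mOmega v B lamO mv vB).
have [C C0 phiC] := test_function_bounded phi_test.
have phiL2 : L2 lam Omega phi.
  exact: (@bounded_L2 _ _ _ _ _ mOmega phi C lamO (measurable_funTS mphi) (fun x _ => phiC x)).
have [D D0 dphiD] := test_function_partial_bounded i phi_test.
have lim_l : (fun l => inner lam Omega v (psi l)) @ \oo -->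
    inner lam Omega v (partial i phi).
  apply: (inner_cvg mOmega lamO vL2 (C := D)).
  - by move=> l; exact: (measurable_funTS (mpsi l)).
  - apply: measurable_funTS; apply: lebesgue_continuous.
    exact: test_function_partial_continuous phi_test.
  - move=> l x _; rewrite /psi normrM normrN normr_nat -ler_pdivlMr//.
    by apply: (test_function_increment phi_test) => //; rewrite invr_ge0.
  - by move=> x _; exact: test_function_quotient_cvg.
have [_ [K [cK KO phi0]]] := phi_test.
have [L HL] := compact_segments_in_open i cK KO.
have mK : measurable (K : set T).
  by apply: lebesgue_closed; apply: compact_closed cK; exact: norm_hausdorff.
have m1K : measurable_fun (Omega : set T) (\1_K : T -> R) by exact: measurable_indic.
(* [theta] is not uniformly bounded near the boundary of Omega, where w jumps to 0. On the support K
   of phi and for indices at least L the segments stay in Omega and the Lipschitz bound dominates;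
   multiplying by the indicator of K does not change the pairing with phi. *)
pose thetaK l x := (\1_K : Rn -> R) x * theta (l + L)%N x.
have lim_r : (fun l => inner lam Omega phi (thetaK l)) @ \oo -->
    inner lam Omega phi (fun x => (\1_K : Rn -> R) x * g x).
  apply: (inner_cvg mOmega lamO phiL2 (C := `|Lip|)).
  - by move=> l; exact: (mM m1K (measurable_funTS (mtheta _))).
  - exact: (mM m1K mg).
  - move=> l x Ox; rewrite /thetaK indicE; have [Kx|nKx] := pselect (K x); last first.
      by rewrite memNset// mul0r normr0.
    rewrite mem_set// mul1r /theta.
    have seg s : `|s| <= (l + L).+1%:R^-1 -> Omega (x + s *: e_ i).
      by apply: HL => //; exact: leq_addl.
    rewrite !wE//; last by apply: seg; rewrite ger0_norm.
    rewrite normrM normr_nat -ler_pdivlMr//.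
    apply: (le_trans (v_lip _ _)); first by rewrite invr_ge0.
      by move=> s /andP[s0 sl]; apply: seg; rewrite ger0_norm.
    by rewrite ler_wpM2r ?invr_ge0// ler_norm.
  - move=> x Ox; rewrite /thetaK indicE; have [Kx|nKx] := pselect (K x); last first.
      rewrite memNset// mul0r (_ : (fun _ => _) = cst 0); first exact: cvg_cst.
      by apply/funext => l; rewrite mul0r.
    rewrite mem_set// mul1r.
    rewrite (_ : (fun _ => _) = (fun l : nat =>
      (v (x + (l + L)%N.+1%:R^-1 *: e_ i) - v x) * (l + L)%N.+1%:R)).
      by have := v_cvg Ox; rewrite -(cvg_shiftn L).
    apply/funext => l; rewrite mul1r /theta !wE//.
    by apply: HL (leq_addl _ _) Kx _; rewrite ger0_norm.
have phiK (f : Rn -> R) : inner lam Omega phi (fun x => (\1_K : Rn -> R) x * f x) =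
    inner lam Omega phi f.
  apply: eq_Rintegral => x _; rewrite indicE; have [Kx|nKx] := pselect (K x).
    by rewrite mem_set// mul1r.
  by rewrite phi0// !mul0r.
rewrite phiK innerC in lim_r.
have {}lim_r : (fun l => inner lam Omega v (psi (l + L)%N)) @ \oo -->
    - inner lam Omega g phi.
  rewrite (_ : (fun _ => _) = (fun l => - inner lam Omega phi (thetaK l))); last first.
    by apply/funext => l; rewrite discrete_integration_by_parts phiK.
  exact: cvgN.
move: lim_l; rewrite -(cvg_shiftn L) => lim_l.
exact: cvg_unique lim_l lim_r.
Qed.

End integration_by_parts.
End difference_quotients.

(** * Oscillation on connected sets and selection of a piece *)

(** Connectedness enters only through the intermediate value theorem, so the sets [H j] may overlap
    and be disconnected, and no path through them is constructed. *)
Lemma connected_oscillation {R : realType} {T : topologicalType} (A : set T)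
    (u : T -> R) (N : nat) (H : nat -> set T) (d : R) :
  connected A -> {within A, continuous u} -> 0 <= d ->
  A `<=` \bigcup_(j in `I_N) H j ->
  (forall j x y, A x -> A y -> H j x -> H j y -> `|u x - u y| <= d) ->
  forall x y, A x -> A y -> `|u x - u y| <= d *+ N.
Proof.
move=> cA cu d0 AH Hd.
suff half x y : A x -> A y -> u y - u x <= d *+ N.
  by move=> x y Ax Ay; rewrite ler_norml half// andbT lerNl opprB half.
move=> Ax Ay; rewrite leNgt; apply/negP => dN.
have N0 : (0 < N)%N by have [j] := AH _ Ax; case: (N).
have N0R : 0 < N%:R :> R by rewrite ltr0n.
have itv : is_interval [set u t | t in A].
  by apply/connected_intervalP; exact: connected_continuous_connected.
(* Among the N + 1 points where u takes equidistant values between u x and u y,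
   two lie in the same piece. *)
pose s := (u y - u x) / N%:R.
have ds : d < s by rewrite ltr_pdivlMr// mulr_natr.
have s0 : 0 < s by exact: le_lt_trans ds.
have /choice[a aP] : forall l : 'I_N.+1, exists t, A t /\ u t = u x + s * l%:R.
  move=> l; have [t At ut] : [set u t | t in A] (u x + s * l%:R).
    have lo : u x <= u x + s * l%:R by rewrite lerDl mulr_ge0// ltW.
    have hi : u x + s * l%:R <= u y.
      rewrite -lerBrDl -[leRHS](@divfK _ N%:R) ?gt_eqF//.
      by apply: (ler_wpM2l (ltW s0)); rewrite ler_nat -ltnS.
    by apply: (itv (u x) (u y)); [exists x|exists y|rewrite lo hi].
  by exists t.
have /choice[f fP] : forall l : 'I_N.+1, exists j : 'I_N, H j (a l).
  move=> l; have [j jN Hj] := AH _ (aP l).1.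
  by exists (Ordinal jN).
have : ~~ injectiveb f.
  apply/negP => /injectiveP /leq_card; rewrite !card_ord.
  by rewrite ltnn.
case/injectivePn => l1 [l2 l12 fl].
have := Hd _ _ _ (aP l1).1 (aP l2).1 (fP l1); rewrite fl => /(_ (fP l2)).
rewrite (aP l1).2 (aP l2).2 opprD addrACA subrr add0r -mulrBr normrM gtr0_norm//.
rewrite leNgt => /negP; apply; apply: (lt_le_trans ds).
rewrite ler_pMr//.
wlog lt12 : l1 l2 l12 {fl} / (l1 < l2)%N.
  move=> W; have [lt12|lt21|/val_inj eq12] := ltngtP l1 l2; first exact: W.
    by rewrite distrC W// eq_sym.
  by rewrite eq12 eqxx in l12.
by rewrite distrC -(natrB _ (ltnW lt12)) normr_nat ler1n subn_gt0.
Qed.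

Lemma box_shift {R : realType} {n : nat} (x : 'rV[R]_n) i (t e : R) : `|t| <= e ->
  box (x - const_mx e, x + const_mx e) (x + t *: delta_mx ord0 i).
Proof.
rewrite ler_norml => /andP[et te] k; rewrite !mxE eqxx/=.
by case: (k == i); rewrite ?mulr1 ?mulr0; apply/andP; split; lra.
Qed.

Lemma seqDU_select {R : realType} {T : Type} (N : nat) (F : nat -> set T) (x : T) :
  (\bigcup_(j in `I_N) F j) x ->
  exists2 j, (j < N)%N & F j x /\ forall j', \1_(seqDU F j') x = (j' == j)%:R :> R.
Proof.
move=> [j0 /= j0N Fj0].
have ex : exists j, `[< F j x >] by exists j0; exact/asboolP.
have [j /asboolP Fj jmin] := ex_minnP ex.
exists j; first by apply: leq_ltn_trans j0N; apply: jmin; exact/asboolP.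
have Dj : seqDU F j x.
  split=> //; rewrite -bigcup_mkord => -[l /= lj Fl].
  have /jmin : `[< F l x >] by exact/asboolP.
  by rewrite leqNgt lj.
split=> // j'; rewrite indicE; congr (_%:R); congr nat_of_bool.
apply/idP/eqP => [|->]; last exact/mem_set.
rewrite inE => Dj'; apply/eqP; apply: contraT => /eqP jj'; exfalso; apply: jj'.
by apply: (@trivIset_seqDU _ F j' j I I); exists x.
Qed.

Lemma closed_ray_limit {R : realType} {n : nat} (A : set 'rV[R]_n) x i : closed A ->
  (forall k, exists2 l, (k <= l)%N & A (x + l.+1%:R^-1 *: delta_mx ord0 i)) -> A x.
Proof.
move=> cA freq; apply: contrapT => nAx.
have [d d0 dA] := near_box (closed_openC cA) nAx.
have [k kd] := ex_natSinv_lt d0; have [l kl] := freq k.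
apply/dA/box_shift; rewrite ger0_norm// ltW//.
by apply: le_lt_trans kd; rewrite lef_pV2 ?posrE// ler_nat.
Qed.

(** * Piecewise affine functions on a mesh of closed convex pieces *)

Section pieces.
Context {R : realType} {n : nat}.
Local Notation Rn := 'rV[R]_n.+1.
Local Notation lam := (@lebesgue R n.+1).
Local Notation T := (caratheodory_type (@lebesgue_outer R n.+1)).
Local Notation e_ i := (delta_mx ord0 i : Rn).
Variables (Omega : set Rn) (N : nat) (H : nat -> set Rn) (z : nat -> Rn) (r : nat -> R).
Hypotheses (oOmega : open Omega) (bOmega : bounded_set Omega)
  (cOmega : connected Omega) (intOmega : (closure Omega)^° `<=` Omega).
Hypotheses (closedH : forall j, closed (H j))
  (segH : forall j x y s, 0 <= s <= 1 -> H j x -> H j y -> H j (x + s *: (y - x)))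
  (r_gt0 : forall j, 0 < r j)
  (boxH : forall j, box (z j - const_mx (r j), z j + const_mx (r j)) `<=` H j)
  (coverH : closure Omega = \bigcup_(j in `I_N) H j).

(** Center of the inscribed box and its displacements along the axes: slopes of an affine function
    become plain difference quotients of nodal values, with no linear system to solve. *)
Definition node j (o : option 'I_n.+1) : Rn :=
  if o is Some i then z j + r j *: e_ i else z j.

Definition slope (v : Rn -> R) j i : R := (v (node j (Some i)) - v (node j None)) / r j.

Definition piecewise_affine (v : Rn -> R) := forall j, affine_on (H j) v.

Lemma node_in j o : H j (node j o).
Proof.
have r0 := r_gt0 j.
apply: boxH; case: o => [i|] k; rewrite !mxE.
  by rewrite eqxx/=; case: (k == i); rewrite ?mulr1 ?mulr0; apply/andP; split; lra.
by apply/andP; split; lra.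
Qed.

Lemma affine_onE v j x : affine_on (H j) v -> H j x ->
  v x = v (z j) + \sum_i slope v j i * (x ord0 i - z j ord0 i).
Proof.
move=> [c [p vE]] Hx; have Hz := node_in j None.
have slopeE i : slope v j i = p ord0 i.
  rewrite /slope (vE _ (node_in j (Some i))) (vE _ Hz) /=.
  rewrite opprD addrACA subrr add0r -sumrB (bigD1 i)//= big1 ?addr0 => [|k /negPf ki].
    by rewrite !mxE !eqxx mulr1 mulrDr addrAC subrr add0r mulfK// gt_eqF.
  by rewrite !mxE ki andbF mulr0 addr0 subrr.
rewrite (vE _ Hx) (vE _ Hz) -addrA; congr (_ + _).
by rewrite -big_split/=; apply: eq_bigr => i _; rewrite slopeE; ring.
Qed.

Lemma affine_on_lin (a : R) (f g : Rn -> R) (A : set Rn) :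
  affine_on A f -> affine_on A g -> affine_on A (fun x => a * f x + g x).
Proof.
move=> [c [p fE]] [d [q gE]]; exists (a * c + d), (a *: p + q) => x Ax.
rewrite fE// gE// mulrDr addrACA mulr_sumr -big_split/=; congr (_ + _).
by apply: eq_bigr => i _; rewrite !mxE; ring.
Qed.

Lemma piecewise_affine_lin (a : R) (f g : Rn -> R) :
  piecewise_affine f -> piecewise_affine g ->
  piecewise_affine (fun x => a * f x + g x).
Proof. by move=> pf pg j; exact: affine_on_lin. Qed.

Lemma piecewise_affine_continuous v : piecewise_affine v ->
  {within closure Omega, continuous v}.
Proof.
move=> vP; rewrite coverH.
have cH j : {within H j, continuous v}.
  have [c [p vE]] := vP j.
  apply: (@subspace_eq_continuous _ _ _ (aff c p)).
    by move=> x /set_mem Hx; exact/esym/vE.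
  exact/continuous_subspaceT/aff_continuous.
suff [] : closed (\bigcup_(j in `I_N) H j) /\ {within \bigcup_(j in `I_N) H j, continuous v} by [].
elim: N => [|m [IHc IHv]].
  by rewrite II0 bigcup_set0; split; [exact: closed0|exact: continuous_subspace0].
rewrite IIS bigcup_setU bigcup_set1; split; first exact: closedU.
exact: withinU_continuous.
Qed.

(** The points x + e_i/(l+1) eventually lie in Omega, hence in finitely many pieces. A piece visited
    infinitely often contains x by closedness and, by convexity, every later point. If there were
    none, all pieces would be avoided from some index on. *)
Lemma ray_enters (x : Rn) i : Omega x ->
  exists2 j : nat, (j < N)%N & H j x /\
    exists k : nat, forall l, (k <= l)%N -> H j (x + l.+1%:R^-1 *: e_ i).
Proof.
move=> Ox.
have [e e0 eO] := near_box oOmega Ox.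
have [k0 k0e] := ex_natSinv_lt e0.
have ray_in l : (k0 <= l)%N -> Omega (x + l.+1%:R^-1 *: e_ i).
  move=> k0l; apply/eO/box_shift; rewrite ger0_norm// ltW//.
  by apply: le_lt_trans k0e; rewrite lef_pV2 ?posrE// ler_nat.
have seg_down j l l' : H j x -> (l <= l')%N -> H j (x + l.+1%:R^-1 *: e_ i) ->
    H j (x + l'.+1%:R^-1 *: e_ i).
  move=> Hx ll' Hl.
  have -> : x + l'.+1%:R^-1 *: e_ i =
      x + (l.+1%:R / l'.+1%:R) *: ((x + l.+1%:R^-1 *: e_ i) - x).
    by rewrite addrAC subrr add0r scalerA mulrAC divff ?mul1r// pnatr_eq0.
  apply: segH => //; rewrite divr_ge0//= ler_pdivrMr// mul1r ler_nat//.
apply: contrapT => nex.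
have /choice[m mP] : forall j, exists m : nat, (j < N)%N ->
    forall l, (m <= l)%N -> ~ H j (x + l.+1%:R^-1 *: e_ i).
  move=> j; apply: contrapT => /forallNP nm; apply: nex.
  have jN : (j < N)%N by have /not_implyP[] := nm 0%N.
  have freq k : exists2 l, (k <= l)%N & H j (x + l.+1%:R^-1 *: e_ i).
    have /not_implyP[_ /existsNP[l]] := nm k.
    by move=> /not_implyP[kl /contrapT Hl]; exists l.
  have Hx : H j x := closed_ray_limit (@closedH j) freq.
  exists j => //; split=> //; have [l _ Hl] := freq 0%N; exists l => l' ll'.
  exact: seg_down Hl.
pose M := maxn k0 (\max_(j < N) m j).
have clM : closure Omega (x + M.+1%:R^-1 *: e_ i).
  by apply: subset_closure; apply: ray_in; exact: leq_maxl.
move: clM; rewrite coverH => -[j /= jN]; apply: (mP j jN).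
by rewrite leq_max; apply/orP; right; exact: (leq_bigmax (Ordinal jN)).
Qed.

(* A discrete limit of forward rays makes [hits] measurable, and on Omega some
   piece is always hit: the forward difference quotients at x converge to the
   slope of that piece. *)
Definition hits i j : set Rn :=
  [set x | exists k : nat, forall l, (k <= l)%N -> H j (x + l.+1%:R^-1 *: e_ i)].

Local Notation I := ('I_N * 'I_n.+2)%type.

Definition nd (k : I) : Rn := node k.1 (unlift ord0 k.2).

(* Pieces overlap on their boundaries; [seqDU] makes them disjoint, so that sums
   over all nodes only see one piece. *)
Definition shape (k : I) (x : Rn) : R :=
  \1_(seqDU H k.1) x *
  (if unlift ord0 k.2 is Some i then (x ord0 i - z k.1 ord0 i) / r k.1
   else 1 - \sum_i (x ord0 i - z k.1 ord0 i) / r k.1).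

(** Derivative in direction i of the affine factor of [shape]. The piece is selected by [hits i] and
    not by [H]: where pieces meet, the forward quotient sees the one that the ray enters. *)
Definition dshape i (k : I) (x : Rn) : R :=
  \1_(seqDU (hits i) k.1) x *
  (if unlift ord0 k.2 is Some i' then (i' == i)%:R / r k.1 else - (r k.1)^-1).

Definition pgrad (v : Rn -> R) i (x : Rn) : R := \sum_(k : I) v (nd k) * dshape i k x.

Lemma piecewise_affine_shape v x : piecewise_affine v -> closure Omega x ->
  v x = \sum_(k : I) v (nd k) * shape k x.
Proof.
move=> vP; rewrite coverH => exj.
have [j jN [Hj Dj]] := @seqDU_select R _ _ _ _ exj.
transitivity (\sum_(j' < N) \sum_(o < n.+2) v (nd (j', o)) * shape (j', o) x); last first.
  by rewrite pair_bigA/=; apply: eq_bigr => -[].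
rewrite (bigD1 (Ordinal jN))//= [X in _ + X]big1 ?addr0; last first.
  move=> j' j'j; rewrite big1// => o _; rewrite /shape/= Dj.
  by rewrite (_ : (j' == j :> nat) = false) ?mul0r ?mulr0//; exact/negbTE.
rewrite big_ord_recl /nd /shape/= unlift_none Dj eqxx mul1r.
under [X in _ = _ + X]eq_bigr => i _ do rewrite !liftK mul1r.
rewrite (affine_onE (vP j) Hj) mulrBr mulr1 -addrA; congr (_ + _).
rewrite mulr_sumr -sumrN -big_split/=; apply: eq_bigr => i _.
by rewrite /slope/=; ring.
Qed.

Lemma pgrad_slope v x i : Omega x -> exists2 j, (j < N)%N &
  [/\ H j x, hits i j x & pgrad v i x = slope v j i].
Proof.
move=> Ox; have [j0 j0N [Hj0 hj0]] := ray_enters i Ox.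
have [|j jN [hj Sj]] := @seqDU_select R _ N (hits i) x; first by exists j0.
exists j => //; split=> //.
  have [k hk] := hj; apply: (@closed_ray_limit _ _ _ _ i (@closedH j)) => l.
  by exists (maxn k l); rewrite ?leq_maxr//; apply: hk; exact: leq_maxl.
rewrite /pgrad.
transitivity (\sum_(j' < N) \sum_(o < n.+2) v (nd (j', o)) * dshape i (j', o) x).
  by rewrite pair_bigA/=; apply: eq_bigr => -[].
rewrite (bigD1 (Ordinal jN))//= [X in _ + X]big1 ?addr0; last first.
  move=> j' j'j; rewrite big1// => o _; rewrite /dshape/= Sj.
  by rewrite (_ : (j' == j :> nat) = false) ?mul0r ?mulr0//; exact/negbTE.
rewrite big_ord_recl /nd /dshape/= unlift_none Sj eqxx mul1r.
under eq_bigr => i' _ do rewrite !liftK mul1r.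
rewrite (bigD1 i)//= eqxx mul1r big1 ?addr0; last first.
  by move=> i' /negPf ->; rewrite mul0r mulr0.
by rewrite /slope /=; ring.
Qed.

Section shape_measurable.
Variable mu : {outer_measure set Rn -> \bar R}.
Hypothesis mu_halfspace : forall i (c : R),
  mu.-caratheodory [set x : Rn | x ord0 i <= c].
Local Notation M := (caratheodory_type mu).

(** The outer measure is general because shapes are integrated over Omega and over Gamma2. *)
Lemma shape_measurable k : measurable_fun [set: M] (shape k : M -> R).
Proof.
have mD j : measurable (seqDU H j : set M).
  rewrite /seqDU; apply: measurableD; first exact: caratheodory_closed.
  by apply: bigsetU_measurable => l _; exact: caratheodory_closed.
have [c [p E]] : exists c p, (fun x : Rn => if unlift ord0 k.2 is Some i
    then (x ord0 i - z k.1 ord0 i) / r k.1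
    else 1 - \sum_i (x ord0 i - z k.1 ord0 i) / r k.1) = aff c p.
  case: unlift => [i|].
    exists (- z k.1 ord0 i / r k.1), ((r k.1)^-1 *: e_ i); apply/funext => x.
    rewrite /aff (bigD1 i)//= big1 ?addr0 => [|l /negPf li]; rewrite !mxE ?eqxx ?li/=; ring.
  exists (1 + \sum_i z k.1 ord0 i / r k.1), (const_mx (- (r k.1)^-1)).
  apply/funext => x; rewrite /aff -addrA -sumrN -big_split/=; congr (_ + _).
  by apply: eq_bigr => i _; rewrite mxE; ring.
have maff := caratheodory_continuous mu_halfspace (@aff_continuous R n.+1 c p).
rewrite (_ : shape k = fun x => \1_(seqDU H k.1) x * aff c p x); last first.
  by apply/funext => x; rewrite -E.
apply: (@measurable_funM _ M R [set: M] (\1_(seqDU H k.1)) (aff c p)) maff.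
exact: measurable_indic.
Qed.

End shape_measurable.

Lemma compact_closure_Omega : compact (closure Omega).
Proof.
apply: bounded_closed_compact; last exact: closed_closure.
have [L L0 OL] := bounded_closure_coord bOmega.
exists L; split; first exact: num_real.
move=> K /ltW LK x clx; apply: le_trans LK.
rewrite [leLHS]/Num.norm /= mx_normrE; apply: bigmax_le; first exact: ltW.
by move=> [a i] _ /=; rewrite ord1; exact: OL.
Qed.

Lemma shape_bounded k : exists2 C, 0 <= C & forall x, closure Omega x -> `|shape k x| <= C.
Proof.
have [L L0 OL] := bounded_closure_coord bOmega.
have r0 := r_gt0 k.1.
pose B i := (L + `|z k.1 ord0 i|) / r k.1.
have B0 i : 0 <= B i by rewrite divr_ge0 ?addr_ge0// ltW.
have bnd i x : closure Omega x -> `|(x ord0 i - z k.1 ord0 i) / r k.1| <= B i.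
  move=> clx; rewrite normrM normfV (gtr0_norm r0) ler_pM2r ?invr_gt0//.
  by apply: (le_trans (ler_normB _ _)); rewrite lerD2r OL.
exists (1 + \sum_i B i); first by rewrite addr_ge0 ?sumr_ge0.
move=> x clx; rewrite /shape normrM -[leRHS]mul1r; apply: ler_pM => //.
  by rewrite indicE normr_nat; case: (_ \in _).
case: unlift => [i|].
  apply: (le_trans (bnd i x clx)); rewrite (bigD1 i)//= addrCA lerDl.
  by rewrite addr_ge0 ?sumr_ge0.
apply: (le_trans (ler_normB _ _)); rewrite normr1 lerD2l.
by apply: (le_trans (ler_norm_sum _ _ _)); apply: ler_sum => i _; exact: bnd.
Qed.

Let mOmega : measurable (Omega : set T) := lebesgue_open oOmega.
Let lamO : (lam Omega < +oo)%E := lebesgue_bounded_lty bOmega.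

Lemma shape_L2 k : L2 lam Omega (shape k).
Proof.
have [C _ HC] := shape_bounded k.
apply: (@bounded_L2 _ _ _ _ _ mOmega (shape k) C lamO).
  by apply: measurable_funTS; apply: shape_measurable; exact: lebesgue_halfspace.
by move=> x Ox; apply: HC; exact: subset_closure.
Qed.

Lemma hits_measurable i j : measurable (hits i j : set T).
Proof.
have -> : hits i j = \bigcup_k \bigcap_(l in [set l | (k <= l)%N])
    [set x : Rn | H j (x + l.+1%:R^-1 *: e_ i)].
  by apply/seteqP; split=> [x [k hk]|x [k _ hk]]; exists k.
apply: bigcup_measurable => k _; apply: bigcap_measurable; first by exists k => /=.
by move=> l _; apply: caratheodory_translate; exact: lebesgue_closed.
Qed.

Lemma dshape_L2 i k : L2 lam Omega (dshape i k).
Proof.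
apply: (@bounded_L2 _ _ _ _ _ mOmega (dshape i k) (r k.1)^-1 lamO).
  apply: (@measurable_funM _ T R Omega (\1_(seqDU (hits i) k.1)) (cst _)) => //.
  apply: measurable_indic; apply: measurableD; first exact: hits_measurable.
  by apply: bigsetU_measurable => l _; exact: hits_measurable.
have r0 : 0 <= (r k.1)^-1 by rewrite invr_ge0 ltW.
move=> x _; rewrite /dshape normrM -[leRHS]mul1r; apply: ler_pM => //.
  by rewrite indicE normr_nat; case: (_ \in _).
case: unlift => [i'|]; last by rewrite normrN ger0_norm.
by rewrite normrM normr_nat (ger0_norm r0); case: eqP => _; rewrite ?mul1r ?mul0r.
Qed.

Lemma pgrad_L2 v i : L2 lam Omega (pgrad v i).
Proof. by apply: L2_sum => // k; exact: dshape_L2. Qed.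

Lemma piecewise_affine_L2 v : piecewise_affine v -> L2 lam Omega v.
Proof.
move=> vP; apply/(L2P _ mOmega).
have /(L2P _ mOmega)[mS intS] : L2 lam Omega (fun x => \sum_k v (nd k) * shape k x).
  by apply: L2_sum => // k; exact: shape_L2.
have E : {in Omega, (fun x => \sum_k v (nd k) * shape k x) =1 v}.
  by move=> x /set_mem Ox; rewrite -piecewise_affine_shape//; exact: subset_closure.
split; first exact: eq_measurable_fun mS.
by apply: eq_integrable intS => // x xO; rewrite /= E.
Qed.

Lemma piecewise_affine_increment v j x y : piecewise_affine v -> H j x -> H j y ->
  v y - v x = \sum_i slope v j i * (y ord0 i - x ord0 i).
Proof.
move=> vP Hx Hy; rewrite (affine_onE (vP j) Hx) (affine_onE (vP j) Hy).
rewrite opprD addrACA subrr add0r -sumrB; apply: eq_bigr => i _; ring.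
Qed.

Lemma piecewise_affine_ray v j x i t : piecewise_affine v -> H j x ->
  H j (x + t *: e_ i) -> v (x + t *: e_ i) - v x = slope v j i * t.
Proof.
move=> vP Hx Hy; rewrite (piecewise_affine_increment vP Hx Hy).
rewrite (bigD1 i)//= big1 ?addr0 => [|l /negPf li].
  by rewrite !mxE !eqxx mulr1 addrAC subrr add0r.
by rewrite !mxE li andbF mulr0 addr0 subrr mulr0.
Qed.

(** Within one piece the increment over a length at most t is at most S t; [connected_oscillation]
    on the segment adds the factor N for the change of pieces. *)
Lemma piecewise_affine_lipschitz v i : piecewise_affine v ->
  exists K, forall x t, 0 <= t -> (forall s, 0 <= s <= t -> Omega (x + s *: e_ i)) ->
     `|v (x + t *: e_ i) - v x| <= K * t.
Proof.
move=> vP; pose S := \sum_(j < N) `|slope v j i|.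
have S0 : 0 <= S by exact: sumr_ge0.
have slopeS j : (j < N)%N -> `|slope v j i| <= S.
  by move=> jN; rewrite /S (bigD1 (Ordinal jN))//= lerDl sumr_ge0.
exists (S *+ N) => x t t0 seg.
pose A := [set x + s *: e_ i | s in `[0, t]%classic].
have AO : A `<=` closure Omega.
  by move=> _ [s /= st <-]; apply/subset_closure/seg; rewrite in_itv in st.
have cA : connected A.
  apply: connected_continuous_connected; first by apply/connected_intervalP; exact: interval_is_interval.
  apply: continuous_subspaceT => s; apply: cvgD; first exact: cvg_cst.
  by apply: cvgZl; exact: cvg_id.
rewrite mulrnAl.
apply: (@connected_oscillation R _ A v N (fun j => H j `&` [set y | (j < N)%N])) => //.
- exact: continuous_subspaceW AO (piecewise_affine_continuous vP).
- by rewrite mulr_ge0.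
- by move=> y /AO; rewrite coverH => -[j jN Hj]; exists j.
- move=> j _ _ [s + <-] [s' + <-] [Hs jN] [Hs' _]; rewrite /= !in_itv/= => /andP[s0 st] /andP[s'0 s't].
  have E : x + s *: e_ i = (x + s' *: e_ i) + (s - s') *: e_ i.
    by rewrite -addrA -scalerDl [s' + _]addrC subrK.
  rewrite E in Hs *; rewrite (piecewise_affine_ray vP Hs' Hs) normrM ler_pM ?slopeS//.
  by rewrite ler_norml; apply/andP; split; lra.
- by exists t => //=; rewrite in_itv/= t0 lexx.
- by exists 0; rewrite ?scale0r ?addr0//= in_itv/= t0 lexx.
Qed.

Lemma pgrad_is_weak_gradient v : piecewise_affine v ->
  is_weak_gradient Omega v (fun x => \row_i pgrad v i x).
Proof.
move=> vP i; have rowE : (fun x => (\row_i pgrad v i x) ord0 i) = pgrad v i.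
  by apply/funext => x; rewrite mxE.
split; first by rewrite rowE; exact: pgrad_L2.
move=> phi phi_test; rewrite rowE.
have mv : measurable_fun (Omega : set T) (v : T -> R) :=
  L2_measurable mOmega (piecewise_affine_L2 vP).
have mg : measurable_fun (Omega : set T) (pgrad v i : T -> R) :=
  L2_measurable mOmega (pgrad_L2 v i).
have [B vB] : exists B, forall x, Omega x -> `|v x| <= B.
  have /compact_bounded[B [_ HB]] : compact (v @` closure Omega).
    by apply: continuous_compact (compact_closure_Omega); exact: piecewise_affine_continuous.
  exists (B + 1) => x Ox; apply: (HB (B + 1)); first by rewrite ltrDl.
  by exists x => //; exact: subset_closure.
have [K vK] := piecewise_affine_lipschitz i vP.
apply: (integration_by_parts oOmega bOmega mv mg vB vK _ phi_test) => x Ox.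
have [j jN [Hj [k hk] ->]] := pgrad_slope v i Ox.
(* From index k on, x and the ray point share piece j, and the quotient is constantly its slope. *)
apply: (@cvg_near_cst _ _ _ _ _ _); near=> l.
have kl : (k <= l)%N by near: l; exact: nbhs_infty_ge.
by rewrite (piecewise_affine_ray vP Hj (hk l kl)) mulfVK ?pnatr_eq0.
Unshelve. all: by end_near.
Qed.

(** [weak_gradient] picks some representative, about which only the defining identities are known;
    tested on the difference with [pgrad], they give a null function by the fundamental lemma. *)
Lemma weak_gradient_null v i : piecewise_affine v ->
  exists2 d, L2 lam Omega d /\ inner lam Omega d d = 0 &
    forall x, weak_gradient Omega v x ord0 i = pgrad v i x + d x.
Proof.
move=> vP; have wg := pgrad_is_weak_gradient vP.
have wP : is_weak_gradient Omega v (weak_gradient Omega v).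
  exact: (xgetPex (P := [set G | is_weak_gradient Omega v G]) _ (ex_intro _ _ wg)).
pose W x := weak_gradient Omega v x ord0 i.
have WL2 : L2 lam Omega W by exact: (wP i).1.
have pL2 := pgrad_L2 v i.
exists (fun x => W x - pgrad v i x); last by move=> x; rewrite addrC subrK.
have dL2 : L2 lam Omega (fun x => W x - pgrad v i x) by exact: L2_B.
split=> //; apply: (fundamental_lemma oOmega bOmega dL2) => phi phi_test.
have phiL2 : L2 lam Omega phi.
  have [C _ HC] := test_function_bounded phi_test.
  apply: (@bounded_L2 _ _ _ _ _ mOmega phi C lamO _ (fun x _ => HC x)).
  exact: measurable_test_function phi_test.
rewrite innerB//; apply/eqP; rewrite subr_eq0; apply/eqP/oppr_inj.
rewrite -(wP i).2//; have := (wg i).2 phi phi_test.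
by rewrite (_ : (fun x => (\row_i pgrad v i x) ord0 i) = pgrad v i)//; apply/funext => x; rewrite mxE.
Qed.

Lemma dirichlet_form_pgrad v w : piecewise_affine v -> piecewise_affine w ->
  dirichlet_form Omega v w = \sum_i inner lam Omega (pgrad v i) (pgrad w i).
Proof.
move=> vP wP; pose V i x := weak_gradient Omega v x ord0 i.
pose W i x := weak_gradient Omega w x ord0 i.
have grad_L2 u i : piecewise_affine u -> L2 lam Omega (fun x => weak_gradient Omega u x ord0 i).
  move=> uP; have [d [dL2 _] E] := weak_gradient_null i uP.
  rewrite (_ : (fun x => _) = (fun x => 1 * pgrad u i x + d x)).
    by apply: L2_lin => //; exact: pgrad_L2.
  by apply/funext => x; rewrite E mul1r.
transitivity (\sum_i inner lam Omega (V i) (W i)).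
  rewrite /dirichlet_form.
  (* Integrability is carried along with the value, as the integral of a sum splits only for
     integrable terms. *)
  have sumVW (s : seq 'I_n.+1) : lam.-integrable Omega (EFin \o (fun x => \sum_(i <- s) V i x * W i x)) /\
      Rintegral lam Omega (fun x => \sum_(i <- s) V i x * W i x) =
      \sum_(i <- s) inner lam Omega (V i) (W i).
    elim: s => [|i s [IHi IH]].
      rewrite big_nil (_ : (fun x => _) = cst 0); last by apply/funext => x; rewrite big_nil.
      by split; [exact: integrable0|rewrite Rintegral_cst// mul0r].
    have VW := L2_mul_integrable mOmega (grad_L2 v i vP) (grad_L2 w i wP).
    rewrite big_cons -IH -RintegralD//.
    rewrite (_ : (fun x => _) = (fun x => V i x * W i x + \sum_(i <- s) V i x * W i x)).
      by split=> //; exact: (integrableD mOmega VW IHi).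
    by apply/funext => x; rewrite big_cons.
  exact: (sumVW _).2.
apply: eq_bigr => i _.
have [d [dL2 d0] Vd] := weak_gradient_null i vP.
have [d' [d'L2 d'0] Wd] := weak_gradient_null i wP.
have VE : V i = (fun x => 1 * pgrad v i x + d x) by apply/funext => x; rewrite mul1r -Vd.
have WE : W i = (fun x => 1 * pgrad w i x + d' x) by apply/funext => x; rewrite mul1r -Wd.
have VL2 : L2 lam Omega (V i) by exact: grad_L2.
rewrite WE innerC inner_lin//; last exact: pgrad_L2.
rewrite (innerC _ _ d') (inner_null mOmega d'L2 VL2 d'0) addr0 mul1r.
rewrite innerC VE inner_lin//; [|exact: pgrad_L2|exact: pgrad_L2].
rewrite (innerC _ _ d) (inner_null mOmega dL2 (pgrad_L2 w i) d0) addr0 mul1r//.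
Qed.

Definition stiffness (k l : I) : R := \sum_i inner lam Omega (dshape i k) (dshape i l).

Lemma stiffnessC k l : stiffness k l = stiffness l k.
Proof. by apply: eq_bigr => i _; rewrite innerC. Qed.

Lemma dirichlet_form_stiffness v w : piecewise_affine v -> piecewise_affine w ->
  dirichlet_form Omega v w = \sum_k \sum_l v (nd k) * w (nd l) * stiffness k l.
Proof.
move=> vP wP; rewrite dirichlet_form_pgrad//.
transitivity (\sum_i \sum_k \sum_l v (nd k) * w (nd l) * inner lam Omega (dshape i k) (dshape i l)).
  apply: eq_bigr => i _; rewrite inner_sum//; [|by move=> k; exact: dshape_L2|exact: pgrad_L2].
  apply: eq_bigr => k _; rewrite innerC inner_sum//; [|by move=> l; exact: dshape_L2|exact: dshape_L2].
  by rewrite mulr_sumr; apply: eq_bigr => l _; rewrite mulrA innerC.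
rewrite exchange_big/=; apply: eq_bigr => k _; rewrite exchange_big/=; apply: eq_bigr => l _.
by rewrite -mulr_sumr.
Qed.

Let cell j : set Rn := obox (z j - const_mx (r j), z j + const_mx (r j)).

Let cell_sub j : (j < N)%N -> cell j `<=` Omega `&` H j.
Proof.
move=> jN x xj; have cellH : cell j `<=` H j.
  by apply: subset_trans (@boxH j); exact: obox_sub_box.
split; last exact: cellH; apply: intOmega.
have oc : open (cell j) by exact: open_obox.
apply: filterS (open_nbhs_nbhs (conj oc xj)) => y yj.
by rewrite coverH; exists j => //; exact: cellH.
Qed.

(** The ray may select another piece j' that also contains x, but a point far along the ray lies in
    both pieces, and the increment of v there determines the slope. *)
Let pgrad_cell v j i x : piecewise_affine v -> (j < N)%N -> cell j x ->
  pgrad v i x = slope v j i.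
Proof.
move=> vP jN xj; have [Ox Hx] := cell_sub jN xj.
have [j' j'N [Hj' [k' hk'] ->]] := pgrad_slope v i Ox.
have oc : open (cell j) by exact: open_obox.
have [d d0 dcell] := near_box oc xj.
have [k kd] := ex_natSinv_lt d0; pose l := maxn k k'.
have Hxl : H j (x + l.+1%:R^-1 *: e_ i).
  suff /(cell_sub jN)[] : cell j (x + l.+1%:R^-1 *: e_ i) by [].
  apply/dcell/box_shift; rewrite ger0_norm//; apply: le_trans (ltW kd).
  by rewrite lef_pV2 ?posrE// ler_nat ltnS leq_maxl.
have t0 : l.+1%:R^-1 != 0 :> R by rewrite invr_eq0 pnatr_eq0.
apply: (mulIf t0); rewrite -(piecewise_affine_ray vP Hx Hxl).
by rewrite -(piecewise_affine_ray vP Hj' (hk' l (leq_maxr _ _))).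
Qed.

Lemma dirichlet_form_ge0 v : piecewise_affine v -> 0 <= dirichlet_form Omega v v.
Proof. by move=> vP; rewrite dirichlet_form_pgrad// sumr_ge0// => i _; exact: inner_ge0. Qed.

(** On the open box inside piece j the gradient is constantly the slope, so the squared slope times
    the volume of the box is at most the form. The sum of the inverse volumes serves all pieces at
    once. *)
Lemma slope_sqr_le : exists2 M, 0 <= M & forall v j i, piecewise_affine v -> (j < N)%N ->
  slope v j i ^+ 2 <= M * dirichlet_form Omega v v.
Proof.
pose vol j := fine (lam (cell j)).
have mcell j : measurable (cell j : set T) by apply: lebesgue_open; exact: open_obox.
have cell_lty j : (j < N)%N -> (lam (cell j) < +oo)%E.
  move=> jN; apply: le_lt_trans lamO; apply: le_outer_measure => x.
  by move=> /(cell_sub jN)[].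
have vol_gt0 j : (j < N)%N -> 0 < vol j.
  move=> jN; apply: fine_gt0; rewrite cell_lty// andbT.
  apply: lebesgue_open_gt0; first exact: open_obox.
  by exists (z j) => i; rewrite !mxE; have := r_gt0 j; move=> r0; apply/andP; split; lra.
exists (\sum_(j < N) (vol j)^-1).
  by apply: sumr_ge0 => j _; rewrite invr_ge0 ltW// vol_gt0.
move=> v j i vP jN; set a := dirichlet_form _ _ _.
have a_ge : slope v j i ^+ 2 * vol j <= a.
  apply: (@le_trans _ _ (inner lam Omega (pgrad v i) (pgrad v i))); last first.
    rewrite /a dirichlet_form_pgrad// (bigD1 i)//= lerDl.
    by apply: sumr_ge0 => l _; exact: inner_ge0.
  have m1 : L2 lam Omega (\1_(cell j) : Rn -> R).
    apply: (@bounded_L2 _ _ _ _ _ mOmega (\1_(cell j) : T -> R) 1 lamO).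
      exact: measurable_indic.
    by move=> x _; rewrite indicE normr_nat; case: (_ \in _); rewrite ?ler01.
  have int1 := L2_mul_integrable mOmega m1 m1.
  have intg := L2_mul_integrable mOmega (pgrad_L2 v i) (pgrad_L2 v i).
  have -> : vol j = inner lam Omega (\1_(cell j) : Rn -> R) (\1_(cell j) : Rn -> R).
    transitivity (Rintegral lam Omega (\1_(cell j) : T -> R)).
      rewrite /Rintegral integral_indic// (_ : cell j `&` Omega = cell j)//.
      by apply/setIidPl => x /(cell_sub jN)[].
    by apply: eq_Rintegral => x _; rewrite indicE; case: (_ \in _); rewrite ?mulr1 ?mulr0.
  rewrite /inner -RintegralZl//; apply: le_Rintegral => //.
    exact: (integrableZl mOmega (slope v j i ^+ 2) int1).
  move=> x _; rewrite indicE; have [xj|nxj] := pselect (cell j x).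
    by rewrite mem_set// !mulr1 (pgrad_cell i vP jN xj) expr2.
  by rewrite memNset// !mulr0 -expr2 sqr_ge0.
have a0 : 0 <= a by exact: dirichlet_form_ge0.
rewrite -ler_pdivlMr ?vol_gt0// in a_ge; apply: (le_trans a_ge).
rewrite mulrC ler_wpM2r// (bigD1 (Ordinal jN))//= lerDl.
by apply: sumr_ge0 => l _; rewrite invr_ge0 ltW// vol_gt0.
Qed.

Lemma poincare : exists2 C, 0 <= C & forall w x0 x, piecewise_affine w ->
  closure Omega x0 -> w x0 = 0 -> closure Omega x ->
  w x ^+ 2 <= C * dirichlet_form Omega w w.
Proof.
have [M M0 HM] := slope_sqr_le.
have [L L0 OL] := bounded_closure_coord bOmega.
(* Coordinates differ by at most 2L in each of n+1 directions, and there are N pieces to cross. *)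
pose c : R := 2 * L * n.+1%:R *+ N.
exists (c ^+ 2 * M); first by rewrite mulr_ge0 ?sqr_ge0.
move=> w x0 x wP clx0 wx0 clx; set a := dirichlet_form _ _ _.
have a0 : 0 <= a by exact: dirichlet_form_ge0.
pose s := Num.sqrt (M * a).
have s0 : 0 <= s by exact: sqrtr_ge0.
have slope_s j i : (j < N)%N -> `|slope w j i| <= s.
  by move=> jN; rewrite -sqrtr_sqr ler_wsqrtr// HM.
have d0 : 0 <= s * (2 * L) *+ n.+1 by rewrite mulrn_wge0// mulr_ge0// mulr_ge0// ltW.
have osc := @connected_oscillation R _ (closure Omega) w N
  (fun j => H j `&` [set y | (j < N)%N]) _ (connected_closure cOmega)
  (piecewise_affine_continuous wP) d0 _ _ x x0 clx clx0.
have {osc} : `|w x - w x0| <= s * (2 * L) *+ n.+1 *+ N.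
  apply: osc => [y|j y y' cly cly' [Hy jN] [Hy' _]].
    by rewrite coverH => -[j jN Hj]; exists j.
  rewrite (piecewise_affine_increment wP Hy' Hy).
  rewrite [leRHS](_ : _ = \sum_(i < n.+1) s * (2 * L)); last by rewrite sumr_const card_ord.
  apply: (le_trans (ler_norm_sum _ _ _)).
  apply: ler_sum => i _; rewrite normrM ler_pM ?slope_s//.
  have := OL _ cly i; have := OL _ cly' i; rewrite !ler_norml.
  by move=> /andP[h1 h2] /andP[h3 h4]; apply/andP; split; lra.
rewrite wx0 subr0 => wx.
have cs : s * (2 * L) *+ n.+1 *+ N = c * s.
  by rewrite /c -[LHS]mulr_natr -[_ *+ n.+1]mulr_natr -[_ *+ N]mulr_natr; ring.
rewrite cs in wx; rewrite -[leLHS]real_normK ?num_real//.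
have c0 : 0 <= c by rewrite /c mulrn_wge0// !mulr_ge0// ltW.
apply: (@le_trans _ _ ((c * s) ^+ 2)).
  by rewrite ler_sqr ?nnegrE// mulr_ge0.
by rewrite exprMn /s sqr_sqrtr ?mulr_ge0// mulrA.
Qed.

End pieces.

(** * The discrete variational inequality *)

Lemma coercive_min {R : realType} {m : nat} (S : set 'rV[R]_m) (f : 'rV[R]_m -> R)
    (y0 : 'rV[R]_m) (r : R) :
  closed S -> continuous f -> S y0 ->
  (forall y i, S y -> r < `|y ord0 i| -> f y0 <= f y) ->
  exists2 y, S y & forall y', S y' -> f y <= f y'.
Proof.
move=> cS cf Sy0 far.
(* Enlarged so that the box also contains y0, against which far points are compared. *)
pose r' := `|r| + \sum_i `|y0 ord0 i|.
pose B : set 'rV[R]_m := box (const_mx (- r'), const_mx r').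
have By0 : B y0.
  move=> i; rewrite !mxE -ler_norml /r' (bigD1 i)//= addrCA lerDl.
  by rewrite addr_ge0// sumr_ge0.
have cSB : compact (S `&` B).
  apply: bounded_closed_compact; last by apply: closedI => //; exact: closed_box.
  have [M [Mr MB]] := bounded_box (const_mx (- r') : 'rV[R]_m, const_mx r').
  by exists M; split=> // K MK x [_ /(MB K MK)].
have [y /set_mem[Sy By] ymin] := compact_EVT_min (ex_intro _ y0 (conj Sy0 By0)) cSB
  (continuous_subspaceT cf).
exists y => // y' Sy'; have [By'|nBy'] := pselect (B y').
  by apply: ymin; exact/mem_set.
have [i yi] : exists i, r < `|y' ord0 i|.
  apply: contrapT => /forallNP H; apply: nBy' => i; rewrite !mxE -ler_norml.
  have /negP := H i; rewrite -leNgt => /le_trans; apply.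
  by rewrite (le_trans (ler_norm r))// lerDl sumr_ge0.
by apply: le_trans (far _ _ Sy' yi); apply: ymin; exact/mem_set.
Qed.

Lemma linear_form_continuous {R : realType} {D : nat} (F : 'I_D -> R) :
  continuous (fun y : 'rV[R]_D => \sum_k y ord0 k * F k).
Proof.
apply: (@continuous_sum R _ _ _ (fun k (y : 'rV[R]_D) => y ord0 k * F k)) => k y.
apply: (@continuousM _ _ (fun y : 'rV[R]_D => y ord0 k) (cst (F k))).
  exact: coord_continuous1.
exact: cst_continuous.
Qed.

Lemma quadratic_form_continuous {R : realType} {D : nat} (A : 'I_D -> 'I_D -> R) :
  continuous (fun y : 'rV[R]_D => \sum_k \sum_l y ord0 k * y ord0 l * A k l).
Proof.
apply: (@continuous_sum R _ _ _
  (fun k (y : 'rV[R]_D) => \sum_l y ord0 k * y ord0 l * A k l)) => k.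
apply: (@continuous_sum R _ _ _
  (fun l (y : 'rV[R]_D) => y ord0 k * y ord0 l * A k l)) => l y.
apply: (@continuousM _ _ (fun y : 'rV[R]_D => y ord0 k * y ord0 l) (cst (A k l))).
  apply: (@continuousM _ _ (fun y : 'rV[R]_D => y ord0 k) (fun y => y ord0 l));
    exact: coord_continuous1.
exact: cst_continuous.
Qed.

Section discrete_obstacle_problem.
Context {R : realType} {U : Type}.
Variables (D : nat) (nd : 'I_D -> U) (kap : 'I_D -> U -> R) (A : 'I_D -> 'I_D -> R)
  (X : set (U -> R)) (cl G1 : set U) (b C : R) (a : (U -> R) -> (U -> R) -> R).

Let vec (y : 'rV[R]_D) (x : U) : R := \sum_u y ord0 u * kap u x.
Let ev (v : U -> R) : 'rV[R]_D := \row_u v (nd u).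

Hypotheses (X_lin : forall c f g, X f -> X g -> X (fun x => c * f x + g x))
  (X_cst : forall c, X (fun=> c))
  (X_ext : forall f g, X f -> {in cl, f =1 g} -> X g)
  (X_closed : closed [set y : 'rV[R]_D | X (vec y)])
  (nd_cl : forall u, cl (nd u))
  (X_vec : forall v x, X v -> cl x -> v x = \sum_u v (nd u) * kap u x)
  (aE : forall v w, X v -> X w -> a v w = \sum_k \sum_l v (nd k) * w (nd l) * A k l)
  (A_sym : forall k l, A k l = A l k)
  (a_ge0 : forall v, X v -> 0 <= a v v)
  (C_gt0 : 0 < C)
  (a_poincare : forall w x0 x, X w -> cl x0 -> w x0 = 0 -> cl x -> w x ^+ 2 <= C * a w w)
  (b_ge0 : 0 <= b) (G1_neq0 : G1 !=set0) (G1_cl : G1 `<=` cl).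

Definition admissible : set (U -> R) :=
  [set v | [/\ X v, forall x, cl x -> 0 <= v x & forall x, G1 x -> v x = b]].

Definition solves_vi (F : 'I_D -> R) (u : U -> R) := admissible u /\
  forall v, admissible v -> \sum_k (v (nd k) - u (nd k)) * F k <= a u (fun x => v x - u x).

Lemma X_sub f g : X f -> X g -> X (fun x => f x - g x).
Proof.
move=> Xf Xg; rewrite (_ : (fun x => _) = (fun x => -1 * g x + f x)).
  exact: X_lin.
by apply/funext => x; rewrite mulN1r addrC.
Qed.

Lemma form_lin c f g h : X f -> X g -> X h ->
  a (fun x => c * f x + g x) h = c * a f h + a g h.
Proof.
move=> Xf Xg Xh; rewrite !aE//; last exact: X_lin.
rewrite mulr_sumr -big_split/=; apply: eq_bigr => k _.
rewrite mulr_sumr -big_split/=; apply: eq_bigr => l _; ring.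
Qed.

Lemma formC f g : X f -> X g -> a f g = a g f.
Proof.
move=> Xf Xg; rewrite !aE// exchange_big/=; apply: eq_bigr => k _.
by apply: eq_bigr => l _; rewrite A_sym; ring.
Qed.

Lemma formB f g h : X f -> X g -> X h -> a (fun x => f x - g x) h = a f h - a g h.
Proof.
move=> Xf Xg Xh; rewrite (_ : (fun x => _) = (fun x => -1 * g x + f x)).
  by rewrite form_lin// mulN1r addrC.
by apply/funext => x; rewrite mulN1r addrC.
Qed.

Lemma form_quadratic c f g : X f -> X g ->
  a (fun x => c * f x + g x) (fun x => c * f x + g x) =
  c ^+ 2 * a f f + 2 * c * a f g + a g g.
Proof.
move=> Xf Xg; have Xfg := X_lin c Xf Xg.
rewrite form_lin// (formC Xf Xfg) (formC Xg Xfg) !form_lin// (formC Xg Xf); ring.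
Qed.

Lemma admissible_diff u v x : admissible u -> admissible v -> cl x ->
  `|u x - v x| <= Num.sqrt (C * a (fun x => u x - v x) (fun x => u x - v x)).
Proof.
move=> [Xu _ ub] [Xv _ vb] clx; rewrite -sqrtr_sqr ler_wsqrtr//.
have [x0 Gx0] := G1_neq0.
apply: (a_poincare (x0 := x0)) => //; first exact: X_sub.
  exact: G1_cl.
by rewrite ub// vb// subrr.
Qed.

Lemma admissible_cst : admissible (fun=> b).
Proof. by split. Qed.

Lemma admissible_segment u v s : admissible u -> admissible v -> 0 <= s <= 1 ->
  admissible (fun x => s * (v x - u x) + u x).
Proof.
move=> [Xu u0 ub] [Xv v0 vb] /andP[s0 s1]; split.
- by apply: X_lin => //; exact: X_sub.
- move=> x clx; rewrite (_ : _ + _ = s * v x + (1 - s) * u x); last by ring.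
  by rewrite addr_ge0// mulr_ge0 ?u0 ?v0// subr_ge0.
- by move=> x Gx; rewrite ub// vb// subrr mulr0 add0r.
Qed.

(** Each solution is tested against the other and the inequalities are added. With w = u - u', s =
    sqrt (C a(w,w)) bounding |w| and B the sum on the right, this gives a(w,w) <= s B, hence s^2 <=
    s C B. *)
Lemma vi_stability F F' u u' x : solves_vi F u -> solves_vi F' u' -> cl x ->
  `|u x - u' x| <= C * \sum_k `|F k - F' k|.
Proof.
move=> [Ku VIu] [Ku' VIu'] clx; have [Xu _ _] := Ku; have [Xu' _ _] := Ku'.
pose w x := u x - u' x; have Xw : X w by exact: X_sub.
pose s := Num.sqrt (C * a w w).
have s0 : 0 <= s by exact: sqrtr_ge0.
have ws y : cl y -> `|w y| <= s by exact: admissible_diff.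
set B := \sum_k _.
have B0 : 0 <= B by exact: sumr_ge0.
suff : s <= C * B by exact: le_trans (ws _ clx).
have aw : a w w <= s * B.
  apply: (@le_trans _ _ (\sum_k w (nd k) * (F k - F' k))).
    have XBw : X (fun x => u' x - u x) by exact: X_sub.
    have := lerD (VIu _ Ku') (VIu' _ Ku).
    have -> : a u (fun x => u' x - u x) = - a u w.
      rewrite (formC Xu XBw) formB// (formC Xu Xw) formB//; ring.
    rewrite -[X in X <= _ -> _]opprK lerNl opprD opprK => /le_trans.
    have -> : a u w - a u' w = a w w.
      by rewrite [in RHS]formB.
    by apply; rewrite -big_split/= -sumrN le_eqVlt; apply/orP; left; apply/eqP;
       apply: eq_bigr => k _; rewrite /w; ring.
  rewrite mulr_sumr; apply: ler_sum => k _; apply: le_trans (ler_norm _) _.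
  by rewrite normrM ler_wpM2r// ws.
have ss : s * s <= s * (C * B).
  rewrite -expr2 sqr_sqrtr; last by rewrite mulr_ge0 ?a_ge0// ltW.
  by rewrite mulrCA ler_pM2l.
have [sp|] := ltP 0 s; first by rewrite ler_pM2l in ss.
by move=> /le_trans; apply; rewrite mulr_ge0// ltW.
Qed.

Lemma vi_unique F u u' : solves_vi F u -> solves_vi F u' -> {in cl, u =1 u'}.
Proof.
move=> VIu VIu' x /set_mem clx; have := vi_stability VIu VIu' clx.
rewrite big1 => [|k _]; last by rewrite subrr normr0.
by rewrite mulr0 normr_le0 subr_eq0 => /eqP.
Qed.

Let vec_ev v : X v -> {in cl, v =1 vec (ev v)}.
Proof.
move=> Xv x /set_mem clx; rewrite X_vec//; apply: eq_bigr => u _.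
by rewrite mxE.
Qed.

Let vec_continuous x : continuous (fun y => vec y x).
Proof. exact: linear_form_continuous. Qed.

(** The nodal vectors of admissible functions. For an arbitrary y, the function [vec y] need not be
    in [X] nor take the values y at the nodes, since a node may lie in several pieces. *)
Let S : set 'rV[R]_D := [set y | admissible (vec y)] `&`
  [set y | forall u, vec y (nd u) = y ord0 u].

Let S_ev v : admissible v -> S (ev v).
Proof.
move=> [Xv v0 vb]; have E := vec_ev Xv; split; last first.
  by move=> u /=; rewrite -E ?mxE//; exact/mem_set.
split; first exact: X_ext E.
  by move=> x clx; rewrite -E ?v0//; exact/mem_set.
by move=> x Gx; rewrite -E ?vb//; exact/mem_set/G1_cl.
Qed.

Let S_closed : closed S.
Proof.
have closed_eq_fun (f g : 'rV[R]_D -> R) : continuous f -> continuous g ->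
    closed [set y | f y = g y].
  move=> cf cg; rewrite (_ : mkset _ = (fun y => f y - g y) @^-1` [set 0]).
    apply: closed_comp; last exact: closed_eq.
    by move=> y _; apply: continuousB; [exact: cf|exact: cg].
  by apply/seteqP; split=> y /= => [->|/eqP]; rewrite ?subrr// subr_eq0 => /eqP.
apply: closedI.
  rewrite (_ : mkset _ = [set y | X (vec y)] `&`
    ((\bigcap_(x in cl) [set y | 0 <= vec y x]) `&`
     (\bigcap_(x in G1) [set y | vec y x = b]))); last first.
    by apply/seteqP; split=> y => [[? ? ?]|[? [? ?]]].
  apply: closedI => //; apply: closedI; apply: closed_bigI => x _.
    apply: (@closed_comp _ _ (fun y => vec y x) [set t | 0 <= t]); last exact: closed_ge.
    by move=> y _; exact: vec_continuous.
  by apply: closed_eq_fun; [exact: vec_continuous|exact: cst_continuous].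
rewrite (_ : mkset _ = \bigcap_u [set y | vec y (nd u) = y ord0 u]); last first.
  by apply/seteqP; split=> y H u => [_|]; exact: H.
apply: closed_bigI => u _; apply: closed_eq_fun; first exact: vec_continuous.
exact: coord_continuous1.
Qed.

Lemma vi_exists F : exists u, solves_vi F u.
Proof.
pose f (y : 'rV[R]_D) := 2^-1 * (\sum_k \sum_l y ord0 k * y ord0 l * A k l) -
  \sum_k y ord0 k * F k.
have cf : continuous f.
  move=> y; apply: (@continuousB _ _ _
    (fun y : 'rV[R]_D => 2^-1 * (\sum_k \sum_l y ord0 k * y ord0 l * A k l))
    (fun y => \sum_k y ord0 k * F k)); last exact: linear_form_continuous.
  apply: (@continuousM _ _ (cst 2^-1)
    (fun y : 'rV[R]_D => \sum_k \sum_l y ord0 k * y ord0 l * A k l)).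
    exact: cst_continuous.
  exact: quadratic_form_continuous.
pose L (v : U -> R) := \sum_k v (nd k) * F k.
have fE y : S y -> f y = 2^-1 * a (vec y) (vec y) - L (vec y).
  move=> [[Xy _ _] ey]; rewrite /f aE// /L; congr (_ * _ - _).
    by apply: eq_bigr => k _; apply: eq_bigr => l _; rewrite !ey.
  by apply: eq_bigr => k _; rewrite ey.
have expand u v s : X u -> X v ->
    2^-1 * a (fun x => s * v x + u x) (fun x => s * v x + u x) - L (fun x => s * v x + u x) =
    2^-1 * a u u - L u + s * (a u v - L v) + s ^+ 2 / 2 * a v v.
  move=> Xu Xv; rewrite form_quadratic// (formC Xv Xu).
  have -> : L (fun x => s * v x + u x) = s * L v + L u.
    by rewrite /L mulr_sumr -big_split/=; apply: eq_bigr => k _; ring.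
  by field.
have evvec y : S y -> ev (vec y) = y.
  by move=> [_ ey]; apply/rowP => u; rewrite mxE ey.
have fev v : admissible v -> f (ev v) = 2^-1 * a v v - L v.
  move=> Kv; rewrite /f; have [Xv _ _] := Kv; rewrite aE// /L; congr (_ * _ - _).
    by apply: eq_bigr => k _; apply: eq_bigr => l _; rewrite !mxE.
  by apply: eq_bigr => k _; rewrite mxE.
(* [G] is the load less the form paired with the constant b. For w = vec y - b and s = sqrt (C
   a(w,w)), the energy of y exceeds that of b by at least s^2/(2C) - s B, nonnegative once s >= 2 B
   C; a coordinate of y larger than |b| + 2 B C in modulus forces this. *)
pose G k := F k - \sum_l b * A l k; pose B := \sum_k `|G k|.
have B0 : 0 <= B by exact: sumr_ge0.
have [|y Sy ymin] := @coercive_min R D S f (ev (fun=> b)) (`|b| + 2 * B * C)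
    S_closed cf (S_ev admissible_cst).
  move=> y i Sy yi; have [Ky ey] := Sy; have [Xy _ _] := Ky.
  pose w x := vec y x - b; have Xw : X w by apply: X_sub.
  have Xb := X_cst b.
  pose s := Num.sqrt (C * a w w).
  have s0 : 0 <= s by exact: sqrtr_ge0.
  have ws k : `|w (nd k)| <= s by apply: (admissible_diff Ky admissible_cst).
  have sB : 2 * B * C <= s.
    apply: le_trans (ws i); rewrite /w ey.
    have := ler_normD (y ord0 i - b) b; rewrite subrK => yb.
    by rewrite -(lerD2l `|b|); apply: (le_trans (ltW yi)); rewrite addrC.
  have Lw : L w - a (fun=> b) w <= s * B.
    rewrite aE// /L exchange_big/= -sumrB mulr_sumr; apply: ler_sum => k _.
    apply: (@le_trans _ _ (w (nd k) * G k)).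
      rewrite /G [w (nd k) * (_ - _)]mulrBr le_eqVlt; apply/orP; left; apply/eqP; congr (_ - _).
      by rewrite mulr_sumr; apply: eq_bigr => l _; ring.
    by apply: (le_trans (ler_norm _)); rewrite normrM ler_wpM2r.
  rewrite fev; last exact: admissible_cst.
  rewrite -(evvec y Sy) fev// (_ : vec y = (fun x => 1 * w x + (fun=> b) x)); last first.
    by apply/funext => x; rewrite mul1r subrK.
  rewrite expand// -addrA lerDl mul1r expr1n.
  have aw : 0 <= a w w by exact: a_ge0.
  have : C * a w w = s * s by rewrite -expr2 sqr_sqrtr// mulr_ge0// ltW.
  have := C_gt0; move: (a w w) (L w) (a _ w) aw Lw sB s0 B0 => q l p q0 Lw sB s0 B0 C0 qs.
  rewrite -(ler_pM2l C0) mulr0 mulrDr mulrCA mulrC; nra.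
exists (vec y); split; first exact: Sy.1.
move=> v Kv; have Ku := Sy.1; have [Xu _ _] := Ku; have [Xv _ _] := Kv.
pose w x := v x - vec y x; have Xw : X w by exact: X_sub.
rewrite -subr_ge0 -[\sum_k _]/(L w); set t := _ - _.
rewrite leNgt; apply/negP => t0.
have aw : 0 <= a w w by exact: a_ge0.
(* A step s towards v changes the energy by s (t + s a(w,w)/2). With t < 0, the choice s a(w,w) <=
   -t makes this negative, and s <= 1 preserves admissibility. *)
pose s := Num.min 1 (- t / (a w w + 1)).
have s0 : 0 < s by rewrite lt_min ltr01 divr_gt0 ?oppr_gt0// ltr_wpDl.
have s1 : s <= 1 by rewrite ge_min lexx.
have sa : s * a w w <= - t.
  apply: (@le_trans _ _ (s * (a w w + 1))); first by rewrite ler_pM2l// lerDl.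
  by rewrite -ler_pdivlMr ?ltr_wpDl// ge_min lexx orbT.
have Kz := admissible_segment Ku Kv (s := s).
have {}Kz : admissible (fun x => s * w x + vec y x) by apply: Kz; rewrite s1 ltW.
have := ymin _ (S_ev Kz); rewrite fev// expand// fE// -addrA lerDl.
have -> : s * (a (vec y) w - L w) + s ^+ 2 / 2 * a w w = s * (t + s * a w w / 2).
  by rewrite /t; field.
rewrite pmulr_rge0//; lra.
Qed.

End discrete_obstacle_problem.

(** * Optimal control *)

Lemma row_continuous {R : realType} {D : nat} {W : topologicalType} (y : W -> 'rV[R]_D) w :
  (forall k, {for w, continuous (fun w => y w ord0 k)}) -> {for w, continuous y}.
Proof.
move=> yc V /=; rewrite nbhsE => -[U [oU Uy] UV].
have [e e0 eU] := near_box oU Uy.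
have : \forall w' \near w, forall k, `|y w ord0 k - y w' ord0 k| < e.
  by apply: filter_forall => k; move/cvgrPdist_lt: (yc k); exact.
apply: filterS => w' yw'; apply/UV/eU => k; rewrite !mxE.
by have := yw' k; rewrite ltr_norml => /andP[? ?]; apply/andP; split; lra.
Qed.

(** Turns a Lipschitz estimate in finitely many continuous quantities into continuity; it serves
    both the weak topology and the coefficient space. *)
Lemma continuous_dominated {R : realType} {W : topologicalType} (D : nat) (f : W -> R)
    (F : 'I_D -> W -> R) C w : 0 <= C ->
  (forall k, {for w, continuous (F k)}) ->
  (forall w', `|f w - f w'| <= C * \sum_k `|F k w - F k w'|) ->
  {for w, continuous f}.
Proof.
move=> C0 Fc fF; apply/cvgrPdist_lt => e e0.
pose d := e / (C * D%:R + 1).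
have CD : 0 < C * D%:R + 1 by rewrite ltr_pwDr// mulr_ge0.
have d0 : 0 < d by rewrite divr_gt0.
have : \forall w' \near w, forall k, `|F k w - F k w'| < d.
  by apply: filter_forall => k; move/cvgrPdist_lt: (Fc k); exact.
apply: filterS => w' Fw'; apply: (le_lt_trans (fF w')).
have : \sum_k `|F k w - F k w'| <= D%:R * d.
  rewrite -[X in X%:R * _]card_ord mulr_natl -sumr_const.
  by apply: ler_sum => k _; exact/ltW.
move=> /(ler_wpM2l C0)/le_lt_trans; apply.
have -> : e = d * (C * D%:R + 1) by rewrite divfK// gt_eqF.
by lra.
Qed.

Section optimal_control.
Context d (T : measurableType d) (R : realType).
Variables (mu : {measure set T -> \bar R}) (O : set T).
Hypothesis mO : measurable O.
Local Notation L2 := (L2 mu O).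
Local Notation inner := (inner mu O).
Variables (D : nat) (kap : 'I_D -> T -> R) (y : (T -> R) -> 'rV[R]_D)
  (Psi : 'rV[R]_D -> R) (C M : R) (J : (T -> R) -> R).
Hypotheses (kap_L2 : forall k, L2 (kap k)) (Psi_continuous : continuous Psi)
  (Psi_ge0 : forall g, L2 g -> 0 <= Psi (y g)) (C_ge0 : 0 <= C) (M_gt0 : 0 < M)
  (y_stable : forall g g' k, L2 g -> L2 g' ->
    `|y g ord0 k - y g' ord0 k| <= C * \sum_l `|inner g (kap l) - inner g' (kap l)|)
  (JE : forall g, L2 g -> J g = Psi (y g) + M / 2 * inner g g).

Lemma inner_weak_continuous phi : L2 phi ->
  continuous (fun g : weakL2 mu O => inner (\val (g : L2)) phi).
Proof.
move=> /mem_set phiL2 g.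
have ev := @proj_continuous _ (fun _ : L2 => R : topologicalType) (SigSub phiL2).
exact: (continuous_comp (@initial_continuous _ _ _ g) (@ev _)).
Qed.

Lemma inner_sqrB f g : L2 f -> L2 g ->
  inner (fun x => f x - g x) (fun x => f x - g x) =
  inner f f - 2 * inner f g + inner g g.
Proof.
move=> fL2 gL2; have dL2 := L2_B mO fL2 gL2.
rewrite innerB// (innerC _ _ f) (innerC _ _ g) !innerB// (innerC _ _ g f).
by ring.
Qed.

Lemma weakly_lower_semicontinuous_cost : weakly_lower_semicontinuous mu O J.
Proof.
move=> g a /=.
have gL2 : L2 (\val (g : L2)) by exact: set_mem (valP (g : L2)).
(* The square norm lies above its tangents, which are weakly continuous. *)
pose tangent (g' : weakL2 mu O) : R := Psi (y (\val (g' : L2))) +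
  M * inner (\val (g' : L2)) (\val (g : L2)) - M / 2 * inner (\val (g : L2)) (\val (g : L2)).
have tangent_continuous : {for g, continuous tangent}.
  apply: (@continuousB _ _ _ (fun g' : weakL2 mu O => Psi (y (\val (g' : L2))) +
    M * inner (\val (g' : L2)) (\val (g : L2))) (cst _)); last exact: cst_continuous.
  apply: (@continuousD _ _ _ (fun g' : weakL2 mu O => Psi (y (\val (g' : L2))))
    (fun g' : weakL2 mu O => M * inner (\val (g' : L2)) (\val (g : L2)))).
    apply: continuous_comp; last exact: Psi_continuous.
    apply: row_continuous => k.
    apply: (@continuous_dominated _ _ D _
      (fun l (g' : weakL2 mu O) => inner (\val (g' : L2)) (kap l)) C) => //.
      by move=> l; exact: inner_weak_continuous.
    by move=> g'; apply: y_stable => //; exact: set_mem (valP (g' : L2)).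
  apply: (@continuousM _ _ (cst M)); first exact: cst_continuous.
  exact: inner_weak_continuous.
rewrite lte_fin (JE gL2) => aJ.
exists [set g' : weakL2 mu O | a < tangent g'].
  apply: (tangent_continuous [set t | a < t]); apply: open_nbhs_nbhs; split.
    exact: open_gt.
  by rewrite /tangent /=; lra.
move=> g' /= ag'; rewrite lte_fin.
have g'L2 : L2 (\val (g' : L2)) by exact: set_mem (valP (g' : L2)).
rewrite (JE g'L2); apply: (lt_le_trans ag'); rewrite /tangent.
have := inner_ge0 mu O (fun x => \val (g' : L2) x - \val (g : L2) x).
rewrite inner_sqrB// => /(mulr_ge0 (ltW M_gt0)).
by move: (inner _ _) (inner _ _) (inner _ _) (Psi _) => p r s P; lra.
Qed.

Lemma optimal_control_exists : exists2 g, L2 g & forall g', L2 g' -> J g <= J g'.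
Proof.
(* By Bessel, projecting a control onto the span of the [kap k] lowers its norm
   and keeps its state: it is enough to minimize over a finite dimensional space. *)
have [m [e [eL2 eO ekap]]] := orthonormal_system mO (enum 'I_D) kap_L2.
pose G (s : 'rV[R]_m) x := \sum_(j < m) s ord0 j * e j x.
have GL2 s : L2 (G s) by exact: L2_sum.
have G_inner s h : L2 h -> inner (G s) h = \sum_(j < m) s ord0 j * inner (e j) h.
  by move=> hL2; rewrite inner_sum.
have G_e s (j : 'I_m) : inner (G s) (e j) = s ord0 j.
  rewrite G_inner// (bigD1 j)//= big1 => [|i /negPf ij]; rewrite eO//.
    by rewrite eqxx mulr1 addr0.
  by rewrite (inj_eq val_inj) ij mulr0.
have G_sqr s : inner (G s) (G s) = \sum_(j < m) s ord0 j ^+ 2.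
  by rewrite G_inner//; apply: eq_bigr => j _; rewrite innerC G_e.
pose f s := J (G s).
have f_continuous : continuous f.
  move=> s; rewrite (_ : f = fun s => Psi (y (G s)) + M / 2 * \sum_(j < m) s ord0 j ^+ 2);
    last by apply/funext => s'; rewrite /f JE// G_sqr.
  apply: (@continuousD _ _ _ (fun s => Psi (y (G s)))
    (fun s : 'rV[R]_m => M / 2 * \sum_(j < m) s ord0 j ^+ 2)).
    apply: continuous_comp; last exact: Psi_continuous.
    apply: row_continuous => k.
    apply: (@continuous_dominated _ _ D _ (fun l s => inner (G s) (kap l)) C) => //.
      move=> l; rewrite (_ : (fun _ => _) =
        (fun s : 'rV[R]_m => \sum_(j < m) s ord0 j * inner (e j) (kap l))).
        exact: linear_form_continuous.
      by apply/funext => s'; rewrite G_inner.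
    by move=> s'; exact: y_stable.
  apply: (@continuousM _ _ (cst (M / 2))); first exact: cst_continuous.
  apply: (@continuous_sum R _ _ _ (fun j (s : 'rV[R]_m) => s ord0 j ^+ 2)) => j s'.
  by apply: (@continuousM _ _ (fun s : 'rV[R]_m => s ord0 j) (fun s => s ord0 j));
    exact: coord_continuous1.
(* A coordinate larger than 1 + t in modulus, with t = 2 f(0)/M, has square at least t, so the
   control term alone is at least f(0). *)
have [|s _ smin] := @coercive_min R m setT f 0 (1 + f 0 * 2 / M) closedT f_continuous I.
  move=> s j _ sj; rewrite {2}/f JE// G_sqr.
  have f0 : 0 <= f 0 by rewrite /f JE// addr_ge0 ?Psi_ge0// mulr_ge0 ?inner_ge0// divr_ge0// ltW.
  have t0 : 0 <= f 0 * 2 / M by rewrite divr_ge0 ?mulr_ge0// ltW.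
  have -> : f 0 = M / 2 * (f 0 * 2 / M) by field; rewrite gt_eqF.
  rewrite -[leLHS]add0r; apply: lerD; first exact: Psi_ge0.
  rewrite ler_pM2l ?divr_gt0// (bigD1 j)//= -[leLHS]addr0; apply: lerD.
    rewrite -real_normK ?num_real//; move: sj t0.
    by move: (f 0 * 2 / M) `|_| => u v; nra.
  by apply: sumr_ge0 => i _; exact: sqr_ge0.
exists (G s) => // g gL2.
pose t : 'rV[R]_m := \row_j inner g (e j).
apply: (le_trans (smin t I)).
have tE : y (G t) = y g.
  apply/rowP => k; apply/eqP; rewrite -subr_eq0 -normr_le0.
  apply: (le_trans (y_stable _ _ _)) => //.
  rewrite big1 ?mulr0// => l _; apply/eqP; rewrite normr_eq0 subr_eq0; apply/eqP.
  have [c cE] := ekap l (mem_enum _ _).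
  by rewrite !cE//; apply: eq_bigr => j _; rewrite G_e mxE.
rewrite /f !JE// tE lerD2l ler_pM2l ?divr_gt0//.
have := inner_ge0 mu O (fun x => g x - G t x).
rewrite inner_sqrB//.
have -> : inner g (G t) = inner (G t) (G t).
  rewrite innerC G_inner// G_sqr; apply: eq_bigr => j _.
  by rewrite innerC mxE expr2.
by lra.
Qed.
End optimal_control.

(** * The control problem on one mesh *)

Section fixed_mesh.
Context {R : realType} {n : nat}.
Local Notation Rn := 'rV[R]_n.+1.
Local Notation lam := (@lebesgue R n.+1).
Local Notation sigma := (@surface R n.+1).
Variables (Omega Gamma1 Gamma2 : set Rn) (b M : R) (q : Rn -> R) (tau : seq (simplex R n.+1)).
Variables (N : nat) (H : nat -> set Rn) (z : nat -> Rn) (r : nat -> R).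
Hypotheses (domain : polygonal_domain Omega)
  (boundary_split : closure Omega `\` Omega = Gamma1 `|` Gamma2)
  (mGamma2 : (@hausdorff_outer R n.+1 n).-cara.-measurable Gamma2)
  (Gamma1_neq0 : Gamma1 !=set0) (b_ge0 : 0 <= b) (M_gt0 : 0 < M)
  (qL2 : L2 sigma Gamma2 q).
Hypotheses (closedH : forall j, closed (H j))
  (segH : forall j x y s, 0 <= s <= 1 -> H j x -> H j y -> H j (x + s *: (y - x)))
  (r_gt0 : forall j, 0 < r j)
  (boxH : forall j, box (z j - const_mx (r j), z j + const_mx (r j)) `<=` H j)
  (subH : forall j, H j `<=` closure Omega)
  (coverH : closure Omega = \bigcup_(j in `I_N) H j)
  (tauH : forall v, piecewise_affine H v <-> forall T, T \in tau -> affine_on (hull T) v).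

Local Notation I := ('I_N * 'I_n.+2)%type.
Local Notation D := #|{: I}|.

Let p (u : 'I_D) : Rn := nd z r (enum_val u).
Let kap (u : 'I_D) : Rn -> R := shape H z r (enum_val u).
Let X := piecewise_affine H.
Let A (u v : 'I_D) := stiffness Omega H r (enum_val u) (enum_val v).

Let oO : open Omega. Proof. by case: domain. Qed.
Let bO : bounded_set Omega. Proof. by case: domain. Qed.
Let cO : connected Omega. Proof. by case: domain. Qed.
Let mO := lebesgue_open oO.

Let X_lin c f g : X f -> X g -> X (fun x => c * f x + g x).
Proof. exact: piecewise_affine_lin. Qed.

Let X_cst c : X (fun=> c).
Proof. by move=> j; exists c, 0 => x _; rewrite big1 ?addr0// => i _; rewrite mxE mul0r. Qed.

Let X_ext f g : X f -> {in closure Omega, f =1 g} -> X g.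
Proof.
move=> fX fg j; have [c [s fE]] := fX j; exists c, s => x Hx.
by rewrite -fE// fg//; apply/mem_set/(subH Hx).
Qed.

Let nd_cl u : closure Omega (p u).
Proof. exact: subH (node_in r_gt0 boxH _ _). Qed.

Let X_vec v x : X v -> closure Omega x -> v x = \sum_u v (p u) * kap u x.
Proof.
move=> vX clx; rewrite (piecewise_affine_shape r_gt0 boxH coverH vX clx).
exact: (reindex _ (onW_bij _ (@enum_val_bij _))).
Qed.

(** [defect j x v] is linear in v, and v is affine on piece j exactly when it vanishes for all x
    there. Membership in [X] becomes a system of linear equations in y. *)
Let X_closed : closed [set y : 'rV[R]_D | X (fun x => \sum_u y ord0 u * kap u x)].
Proof.
pose defect j x (v : Rn -> R) :=
  v x - (v (z j) + \sum_i slope z r v j i * (x ord0 i - z j ord0 i)).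
pose vec (y : 'rV[R]_D) x := \sum_u y ord0 u * kap u x.
have defect_vec j x y : defect j x (vec y) = \sum_u y ord0 u * defect j x (kap u).
  have slope_vec i : slope z r (vec y) j i = \sum_u y ord0 u * slope z r (kap u) j i.
    rewrite /slope /vec -sumrB mulr_suml; apply: eq_bigr => u _.
    by rewrite -mulrBr mulrA.
  under [RHS]eq_bigr do rewrite /defect mulrBr mulrDr.
  rewrite sumrB big_split/= /defect; congr (_ - (_ + _)).
  under [LHS]eq_bigr do rewrite slope_vec mulr_suml.
  rewrite exchange_big/=; apply: eq_bigr => u _; rewrite mulr_sumr.
  by apply: eq_bigr => i _; rewrite -mulrA.
have -> : [set y : 'rV[R]_D | X (fun x => \sum_u y ord0 u * kap u x)] =
    \bigcap_j \bigcap_(x in H j) [set y | defect j x (vec y) = 0].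
  apply/seteqP; split=> [y yX j _ x Hx|y y0 j].
    by apply/eqP; rewrite subr_eq0; apply/eqP; exact: (affine_onE r_gt0 boxH (v := vec y) (yX j) Hx).
  exists (vec y (z j) - \sum_i slope z r (vec y) j i * z j ord0 i),
    (\row_i slope z r (vec y) j i) => x Hx.
  have /eqP := y0 j Logic.I x Hx; rewrite subr_eq0 => /eqP; rewrite -/(vec y x) => ->.
  rewrite -addrA; congr (_ + _); rewrite addrC -sumrB.
  by apply: eq_bigr => i _; rewrite mxE mulrBr.
apply: closed_bigI => j _; apply: closed_bigI => x _.
rewrite (_ : mkset _ = (fun y : 'rV[R]_D => \sum_u y ord0 u * defect j x (kap u)) @^-1` [set 0]).
  by apply: closed_comp; [move=> y _; exact: linear_form_continuous|exact: closed_eq].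
by apply/seteqP; split=> y /=; rewrite defect_vec.
Qed.

Let aE v w : X v -> X w ->
  dirichlet_form Omega v w = \sum_k \sum_l v (p k) * w (p l) * A k l.
Proof.
move=> vX wX; rewrite (dirichlet_form_stiffness oO bO closedH segH r_gt0 boxH coverH vX wX).
rewrite (reindex _ (onW_bij _ (@enum_val_bij _))); apply: eq_bigr => k _.
exact: (reindex _ (onW_bij _ (@enum_val_bij _))).
Qed.

Let A_sym k l : A k l = A l k.
Proof. exact: stiffnessC. Qed.

Let a_ge0 v : X v -> 0 <= dirichlet_form Omega v v.
Proof. exact: dirichlet_form_ge0 oO bO closedH segH r_gt0 boxH coverH _. Qed.

Let a_poincare : exists2 C, 0 < C & forall w x0 x, X w -> closure Omega x0 ->
  w x0 = 0 -> closure Omega x -> w x ^+ 2 <= C * dirichlet_form Omega w w.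
Proof.
have intO := polygonal_interior_closure domain.
have [C C0 CP] := poincare oO bO cO intO closedH segH r_gt0 boxH coverH.
exists (C + 1); first by rewrite ltr_wpDl.
move=> w x0 x wX x0cl wx0 xcl; apply: (le_trans (CP w x0 x wX x0cl wx0 xcl)).
by rewrite mulrDl mul1r lerDl a_ge0.
Qed.

Let boundary_cl G : G `<=` Gamma1 `|` Gamma2 -> G `<=` closure Omega.
Proof. by move=> GG x /GG; rewrite -boundary_split => -[]. Qed.

Let G1_cl : Gamma1 `<=` closure Omega.
Proof. by apply: boundary_cl => x; left. Qed.

Let G2_cl : Gamma2 `<=` closure Omega.
Proof. by apply: boundary_cl => x; right. Qed.

Let kap_L2 u : L2 lam Omega (kap u).
Proof. exact: shape_L2 oO bO closedH r_gt0 _. Qed.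

Let kap_surface_L2 u : L2 sigma Gamma2 (kap u).
Proof.
have [C _ kC] := shape_bounded H z bO r_gt0 (enum_val u).
apply: (@bounded_L2 _ _ _ sigma Gamma2 mGamma2 _ C).
- apply: le_lt_trans (hausdorff_boundary_lty domain).
  by apply: le_outer_measure; rewrite boundary_split => x; right.
- by apply: measurable_funTS; apply: shape_measurable => // *; exact: hausdorff_halfspace.
- by move=> x /G2_cl; exact: kC.
Qed.

Let load (g : Rn -> R) (u : 'I_D) : R :=
  inner lam Omega g (kap u) - inner sigma Gamma2 q (kap u).

(** The expansion in shapes holds on the whole closure, so source and surface term alike depend on w
    through its nodal values only. *)
Let loadE g w : L2 lam Omega g -> X w ->
  inner lam Omega g w - inner sigma Gamma2 q w = \sum_u w (p u) * load g u.
Proof.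
move=> gL2 wX.
have expand d (T : measurableType d) (mu : {measure set T -> \bar R}) (E : set T)
    (mE : measurable E) (k : 'I_D -> T -> R) (v h : T -> R) :
    (forall u, L2 mu E (k u)) -> L2 mu E h ->
    (forall x, E x -> v x = \sum_u w (p u) * k u x) ->
    inner mu E h v = \sum_u w (p u) * inner mu E h (k u).
  move=> kL2 hL2 vE; rewrite innerC.
  rewrite (@eq_inner _ _ _ mu E v (fun x => \sum_u w (p u) * k u x)); last first.
    by move=> x /set_mem; exact: vE.
  by rewrite inner_sum//; apply: eq_bigr => u _; rewrite innerC.
rewrite (expand _ _ lam Omega mO kap w g kap_L2 gL2); last first.
  by move=> x Ox; apply: X_vec => //; exact: subset_closure.
rewrite (expand _ _ sigma Gamma2 mGamma2 kap w q kap_surface_L2 qL2); last first.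
  by move=> x /G2_cl; exact: X_vec.
by rewrite -sumrB; apply: eq_bigr => u _; rewrite mulrBr.
Qed.

Let KhE v : Kh Omega Gamma1 b tau v <-> admissible X (closure Omega) Gamma1 b v.
Proof.
split=> [[_ v0 vb /tauH vX]|[vX v0 vb]]; split=> //; last exact/tauH.
exact: (piecewise_affine_continuous closedH coverH vX).
Qed.

Let solvesE g u : L2 lam Omega g -> is_state Omega Gamma1 Gamma2 b q tau g u <->
  solves_vi p X (closure Omega) Gamma1 b (dirichlet_form Omega) (load g) u.
Proof.
move=> gL2; have diffX v : X u -> X v -> X (fun x => v x - u x).
  by move=> uX vX; apply: (X_sub X_lin).
split=> -[Ku uP]; split=> [|v Kv]; try exact/KhE.
- have [uX _ _] := (KhE u).1 Ku; have [vX _ _] := Kv.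
  apply: le_trans (uP v ((KhE v).2 Kv)).
  by rewrite (loadE gL2 (diffX _ uX vX)).
- have [uX _ _] := Ku; have [vX _ _] := (KhE v).1 Kv.
  apply: le_trans (uP v ((KhE v).1 Kv)).
  by rewrite (loadE gL2 (diffX _ uX vX)).
Qed.

Lemma state_solves g : L2 lam Omega g ->
  is_state Omega Gamma1 Gamma2 b q tau g (state Omega Gamma1 Gamma2 b q tau g).
Proof.
move=> gL2; apply: (@xgetPex _ (fun=> 0) [set u | is_state Omega Gamma1 Gamma2 b q tau g u]).
have [C C0 CP] := a_poincare.
have [u uP] := vi_exists X_lin X_cst X_ext X_closed nd_cl X_vec aE A_sym a_ge0 C0 CP
  b_ge0 Gamma1_neq0 G1_cl (load g).
by exists u; exact/solvesE.
Qed.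

Lemma state_unique g u : L2 lam Omega g -> is_state Omega Gamma1 Gamma2 b q tau g u ->
  {in closure Omega, u =1 state Omega Gamma1 Gamma2 b q tau g}.
Proof.
move=> gL2 /(solvesE _ gL2) uP; have /(solvesE _ gL2) sP := state_solves gL2.
have [C C0 CP] := a_poincare.
exact: (vi_unique X_lin nd_cl aE A_sym a_ge0 C0 CP Gamma1_neq0 G1_cl uP sP).
Qed.

Let y (g : Rn -> R) : 'rV[R]_D := \row_u state Omega Gamma1 Gamma2 b q tau g (p u).

Let Psi (y : 'rV[R]_D) : R :=
  2^-1 * \sum_k \sum_l y ord0 k * y ord0 l * inner lam Omega (kap k) (kap l).

Let Psi_continuous : continuous Psi.
Proof.
move=> s; apply: (@continuousM _ _ (cst 2^-1)
  (fun y : 'rV[R]_D => \sum_k \sum_l y ord0 k * y ord0 l * inner lam Omega (kap k) (kap l))).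
  exact: cst_continuous.
exact: quadratic_form_continuous.
Qed.

Let state_norm g : L2 lam Omega g ->
  norm2 lam Omega (state Omega Gamma1 Gamma2 b q tau g) ^+ 2 / 2 = Psi (y g).
Proof.
move=> gL2; set u := state _ _ _ _ _ _ _.
have /(solvesE _ gL2)[[uX _ _] _] := state_solves gL2; rewrite -/u in uX.
pose s x := \sum_k u (p k) * kap k x.
have us : {in Omega, u =1 s}.
  by move=> x /set_mem Ox; apply: X_vec => //; exact: subset_closure.
have sL2 : L2 lam Omega s by exact: L2_sum.
rewrite norm2_sqr mulrC /Psi; congr (_ * _).
rewrite (@eq_inner _ _ _ lam Omega u s u us) innerC (@eq_inner _ _ _ lam Omega u s s us).
rewrite inner_sum//; apply: eq_bigr => k _; rewrite innerC inner_sum// mulr_sumr.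
by apply: eq_bigr => l _; rewrite !mxE innerC mulrA.
Qed.

Let Psi_ge0 g : L2 lam Omega g -> 0 <= Psi (y g).
Proof. by move=> gL2; rewrite -state_norm// divr_ge0// sqr_ge0. Qed.

Let costE g : L2 lam Omega g -> cost Omega Gamma1 Gamma2 b M q tau g =
  Psi (y g) + M / 2 * inner lam Omega g g.
Proof. by move=> gL2; rewrite /cost state_norm// norm2_sqr. Qed.

Let y_stable : exists2 C, 0 <= C & forall g g' k, L2 lam Omega g -> L2 lam Omega g' ->
  `|y g ord0 k - y g' ord0 k| <=
    C * \sum_l `|inner lam Omega g (kap l) - inner lam Omega g' (kap l)|.
Proof.
have [C C0 CP] := a_poincare; exists C; first exact: ltW.
move=> g g' k gL2 g'L2; rewrite !mxE.
have /(solvesE _ gL2) sP := state_solves gL2.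
have /(solvesE _ g'L2) s'P := state_solves g'L2.
have := vi_stability X_lin nd_cl aE A_sym a_ge0 C0 CP Gamma1_neq0 G1_cl sP s'P (@nd_cl k).
(* The surface term is common to both loads and cancels. *)
congr (_ <= _ * _); apply: eq_bigr => l _.
by rewrite /load opprB addrA subrK.
Qed.

Lemma cost_weakly_lower_semicontinuous :
  weakly_lower_semicontinuous lam Omega (cost Omega Gamma1 Gamma2 b M q tau).
Proof.
have [C C0 yC] := y_stable.
exact: (weakly_lower_semicontinuous_cost mO kap_L2 Psi_continuous C0 M_gt0 yC costE).
Qed.

Lemma cost_minimizer : exists2 g, L2 lam Omega g & forall g', L2 lam Omega g' ->
  cost Omega Gamma1 Gamma2 b M q tau g <= cost Omega Gamma1 Gamma2 b M q tau g'.
Proof.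
have [C C0 yC] := y_stable.
exact: (optimal_control_exists mO kap_L2 Psi_continuous Psi_ge0 C0 M_gt0 yC costE).
Qed.

End fixed_mesh.

Lemma triangulation_pieces {R : realType} {n : nat} (Omega : set 'rV[R]_n.+1)
    (tau : seq (simplex R n.+1)) : Omega !=set0 -> triangulation Omega tau ->
  exists N (H : nat -> set 'rV[R]_n.+1) z r,
    [/\ forall j, closed (H j),
        forall j x y s, 0 <= s <= 1 -> H j x -> H j y -> H j (x + s *: (y - x)),
        forall j, 0 < r j /\ box (z j - const_mx (r j), z j + const_mx (r j)) `<=` H j,
        closure Omega = \bigcup_(j in `I_N) H j /\ forall j, H j `<=` closure Omega &
        forall v, piecewise_affine H v <-> forall T, T \in tau -> affine_on (hull T) v].
Proof.
move=> [x0 Ox0] [/allP tn clE _].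
have [T0 T0t _] : exists2 T, T \in tau & hull T x0.
  by move: (subset_closure Ox0); rewrite clE.
(* Beyond the length of [tau] the simplex [T0] is repeated, so that the hypotheses on pieces hold
   for every natural index. *)
have tau_nth j : nth T0 tau j \in tau.
  by have [jt|tj] := ltnP j (size tau); [exact: mem_nth|rewrite nth_default].
pose H j := hull (nth T0 tau j).
have /choice[z /choice[r zr]] j : exists z r, 0 < r /\
    box (z - const_mx r, z + const_mx r) `<=` H j.
  exact/hull_inner_box/tn.
exists (size tau), H, z, r; split=> //.
- by move=> j; exact/hull_closed/tn.
- by move=> j x y s; apply: hull_segment; exact: tn.
- split=> [|j x Hx]; last by rewrite clE; exists (nth T0 tau j).
  rewrite clE; apply/seteqP; split=> [x [T Tt Tx]|x [j _ Hx]].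
    by exists (index T tau); rewrite /H/= ?index_mem// nth_index.
  by exists (nth T0 tau j).
- move=> v; split=> [vH T Tt|vt j]; last exact: vt.
  by rewrite -(nth_index T0 Tt); exact: vH.
Qed.

Lemma mesh_control {R : realType} {n : nat} (Omega Gamma1 Gamma2 : set 'rV[R]_n.+1)
    (b M : R) (q : 'rV[R]_n.+1 -> R) (tau : seq (simplex R n.+1)) :
  polygonal_domain Omega -> closure Omega `\` Omega = Gamma1 `|` Gamma2 ->
  (@hausdorff_outer R n.+1 n).-cara.-measurable Gamma2 -> Gamma1 !=set0 ->
  0 <= b -> 0 < M -> L2 (@surface R n.+1) Gamma2 q -> triangulation Omega tau ->
  let H := L2 (@lebesgue R n.+1) Omega in
  let solves := is_state Omega Gamma1 Gamma2 b q tau in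
  let J := cost Omega Gamma1 Gamma2 b M q tau in
  [/\ forall g, H g -> solves g (state Omega Gamma1 Gamma2 b q tau g) /\
        forall u, solves g u ->
          {in closure Omega, u =1 state Omega Gamma1 Gamma2 b q tau g},
      weakly_lower_semicontinuous (@lebesgue R n.+1) Omega J &
      exists2 g, H g & forall g', H g' -> J g <= J g'].
Proof.
move=> domain split_bd mG2 G1 b0 M0 qL2 triang.
have [ne0 _ _ _ _] := domain.
have [N [H [z [r [cH sH rbH [covH subH] tH]]]]] := triangulation_pieces ne0 triang.
have rH j := (rbH j).1; have bH j := (rbH j).2.
split.
- move=> g gL2; split.
    exact: (state_solves domain split_bd mG2 G1 b0 qL2 cH sH rH bH subH covH tH gL2).
  move=> u uP.
  exact: (state_unique domain split_bd mG2 G1 b0 qL2 cH sH rH bH subH covH tH gL2 uP).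
- exact: (cost_weakly_lower_semicontinuous domain split_bd mG2 G1 b0 M0 qL2
    cH sH rH bH subH covH tH).
- exact: (cost_minimizer domain split_bd mG2 G1 b0 M0 qL2 cH sH rH bH subH covH tH).
Qed.

Lemma cost_ge {R : realType} {n : nat} (Omega Gamma1 Gamma2 : set 'rV[R]_n) (b M : R)
    (q : 'rV[R]_n -> R) tau g :
  M / 2 * norm2 (@lebesgue R n) Omega g ^+ 2 <= cost Omega Gamma1 Gamma2 b M q tau g.
Proof. by rewrite /cost lerDr divr_ge0// sqr_ge0. Qed.

(** [state] is total with a default value. The first clause shows that for h in [Hs] and g in [H] it
    is the unique solution, so that [cost] is the intended functional; uniqueness is on the closure
    because values elsewhere are ignored. *)
Theorem theorem3p1 (R : realType) (n : nat)
  (Omega Gamma1 Gamma2 : set 'rV[R]_n)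
  (domain : polygonal_domain Omega)
  (boundary_split : closure Omega `\` Omega = Gamma1 `|` Gamma2)
  (disjoint : Gamma1 `&` Gamma2 = set0)
  (mGamma1 : (@hausdorff_outer R n n.-1).-cara.-measurable Gamma1)
  (mGamma2 : (@hausdorff_outer R n n.-1).-cara.-measurable Gamma2)
  (Gamma1_pos : (0 < @surface R n Gamma1)%E)
  (b M : R) (b_pos : 0 < b) (M_pos : 0 < M)
  (q : 'rV[R]_n -> R) (qL2 : L2 (@surface R n) Gamma2 q)
  (Hs : set R) (tau : R -> seq (simplex R n))
  (tau_regular : regular_family Omega Hs tau) :
  let H := L2 (@lebesgue R n) Omega in
  let norm_H := norm2 (@lebesgue R n) Omega in
  let solves h g u := is_state Omega Gamma1 Gamma2 b q (tau h) g u in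
  let u_ h g := state Omega Gamma1 Gamma2 b q (tau h) g in
  let J h g := cost Omega Gamma1 Gamma2 b M q (tau h) g in
  [/\ (forall h g, Hs h -> H g ->
         solves h g (u_ h g) /\
         forall u, solves h g u -> {in closure Omega, u =1 u_ h g}),
      (forall h, Hs h ->
         forall A, exists B, forall g, H g -> B < norm_H g -> A < J h g),
      (exists C, forall h g, Hs h -> H g ->
         J h g >= M / 2 * norm_H g ^+ 2 - C * norm_H g),
      (forall h, Hs h ->
         weakly_lower_semicontinuous (@lebesgue R n) Omega (J h)) &
      (forall h, Hs h ->
         exists2 g_op, H g_op & forall g, H g -> J h g_op <= J h g)].
Proof.
move=> H norm_H solves u_ J.
(* Provides the point of Gamma1 at which the Poincare inequality is anchored. *)
have Gamma1_neq0 : Gamma1 !=set0.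
  apply/set0P; apply: contraTneq Gamma1_pos => ->.
  by rewrite /surface outer_measure0 ltxx.
have control h : Hs h -> [/\ forall g, H g -> solves h g (u_ h g) /\
    forall u, solves h g u -> {in closure Omega, u =1 u_ h g},
    weakly_lower_semicontinuous (@lebesgue R n) Omega (J h) &
    exists2 g_op, H g_op & forall g, H g -> J h g_op <= J h g].
  move=> /(let: And3 P _ _ := tau_regular in P)[_ triang _].
  case: n => [|n] in Omega Gamma1 Gamma2 domain boundary_split disjoint mGamma1 mGamma2
    Gamma1_pos q qL2 tau tau_regular H norm_H solves u_ J Gamma1_neq0 triang *.
    (* In dimension 0 the boundary is empty. *)
    have [[x Ox] _ _ _ _] := domain; have [w Gw] := Gamma1_neq0.
    have : (closure Omega `\` Omega) w by rewrite boundary_split; left.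
    by rewrite (thinmx0 w) -(thinmx0 x) => -[].
  exact: mesh_control (ltW b_pos) M_pos qL2 triang.
split=> [h g /control[+ _ _]|h _ A||h /control[]//|h /control[]//]; first exact.
(* A norm larger than 1 + t, with t = 2|A|/M, has square larger than t, so the control term alone
   exceeds |A|. *)
- exists (1 + `|A| * 2 / M) => g _ Bg.
  apply: lt_le_trans (cost_ge _ _ _ _ _ _ _ _).
  have t0 : 0 <= `|A| * 2 / M by rewrite divr_ge0 ?mulr_ge0// ltW.
  apply: (le_lt_trans (ler_norm A)).
  rewrite (_ : `|A| = M / 2 * (`|A| * 2 / M)); last by field; rewrite gt_eqF.
  rewrite ltr_pM2l ?divr_gt0// -/(norm_H g).
  by move: (norm_H g) (_ / M) Bg t0 => t s; nra.
(* The state term is nonnegative, so C = 0 works for all h at once. *)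
- by exists 0 => h g _ _; rewrite mul0r subr0 cost_ge.
Qed.
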